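(* Let $n$ be a natural number. (1) Let $g$ be a braid Gauss diagram on $n$ strands. Then there exists a virtual braid diagram $\beta\in VBD_n$ such that $G(\beta)=g$. (2) Let $\beta_1$ and $\beta_2$ be two virtual braid diagrams on $n$ strands. Then $G(\beta_1)=G(\beta_2)$ if and only if $\beta_1\sim_{vm}\beta_2$ (i.e. $\beta_1$ and $\beta_2$ are virtually equivalent).
   Context: Let $I=[0,1]$, $\mathbf D=I\times I$, and let $\pi_1,\pi_2:\mathbf D\to I$ be the coordinate projections. A strand diagram on $n$ strands is an $n$-tuple of curves $\beta=(\beta_1,\dots,\beta_n)$, $\beta_k:I\to\mathbf D$, such that: there is $\sigma\in S_n$ with $\beta_k(0)=a_k:=(0,\frac{k}{n+1})$ and $\beta_k(1)=b_{\sigma(k)}$, where $b_k:=(1,\frac{k}{n+1})$; $\pi_1(\beta_k(t))=t$ for all $t$; and the curves are in general position (all multiple points are transversal double points, called crossings). A virtual braid diagram is a strand diagram with a function assigning to each crossing a value in $\{+1,-1,v\}$ (positive, negative, virtual). Positive and negative crossings are called regular; $VBD_n$ is the set of virtual braid diagrams on $n$ strands. At a positive (resp. negative) crossing the over-passing strand is the one going from upper left to lower right (resp. from lower left to upper right), so the sign is the local writhe. An isotopy of virtual braid diagrams is a continuous deformation through virtual braid diagrams, fixing endpoints and carrying along the crossings and their values. Moves replace the part of a diagram inside a disc $V\subset\mathbf D$ (the diagrams agreeing outside $V$ up to isotopy). Let $\sigma_i,\sigma_i^{-1},\tau_i$ denote a single positive, negative, virtual crossing between the strands in adjacent positions $i,i+1$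 (positions counted inside $V$), products being concatenated from left to right. Virtual moves: $V2$: $\tau_i\tau_i\leftrightarrow 1$; $V3$: $\tau_i\tau_{i+1}\tau_i\leftrightarrow\tau_{i+1}\tau_i\tau_{i+1}$. Mixed moves: $M$: $\sigma_i\tau_{i+1}\tau_i\leftrightarrow\tau_{i+1}\tau_i\sigma_{i+1}$; $M'$: the same with $\sigma^{-1}$ in place of $\sigma$. Two diagrams are virtually equivalent, $\beta\sim_{vm}\beta'$, if they are related by isotopy and finitely many virtual or mixed moves. A Gauss diagram on $n$ strands is an ordered collection of $n$ oriented intervals, with finitely many arrows, each joining two points in the interiors of the intervals and labelled with a sign $\pm1$, and with a permutation $\sigma\in S_n$, the endpoint of the $i$-th interval being labelled $\sigma(i)$. Gauss diagrams are considered up to orientation preserving homeomorphism of the underlying intervals. A braid Gauss diagram is a Gauss diagram whose arrows are pairwise disjoint, each connecting two different intervals, and for which the intervals can be parametrized by $I=[0,1]$ so that the two endpoints of each arrow correspond to the same $t\in I$ and different arrows correspond to different $t$'s. The Gauss diagram $G(\beta)$ of a virtual braid diagram $\beta$ has one interval for each strand of $\beta$ (in order), one arrow for each regular crossing with endpoints at the preimages of the crossing, pointing from the over-passing strand to the under-passing strand and carrying the sign of the crossing, and has the permutation associated to $\beta$. It is always a braid Gauss diagram. *)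

(* Defs.v *)
From HB Require Import structures.
From Stdlib Require Import Relation_Operators.
From mathcomp Require Import all_boot all_order all_algebra all_fingroup.
From mathcomp Require Import all_classical all_reals all_analysis.

Set Implicit Arguments.
Unset Strict Implicit.
Unset Printing Implicit Defensive.

Import Order.TTheory GRing.Theory Num.Theory.
Import numFieldNormedType.Exports.

Local Open Scope classical_set_scope.
Local Open Scope ring_scope.

Inductive sign := Plus | Minus.

Inductive crossing_value := Regular of sign | Virtual.

Definition I01 {R : realType} : set R := `[0, 1].

Definition square {R : realType} : set (R * R) := I01 `*` I01.

(** * Strand diagrams and virtual braid diagrams *)

(* The height of the [k]-th endpoint; ['I_n] counts from 0. *)
Definition height {R : realType} {n : nat} (k : 'I_n) : R :=
  k.+1%:R / n.+1%:R.

(* Curves [I -> D] are functions [R -> R * R] of which only the values on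
   [I01] are meaningful.

   [descends c i j t]: the curves [i] and [j] cross transversally at time [t],
   the curve [i] going from upper left to lower right.  The curves being graphs
   over [I], transversality of the (merely continuous) curves means that they
   exchange sides. *)
Definition descends {R : realType} {n : nat} (c : 'I_n -> R -> R * R)
    (i j : 'I_n) (t : R) : Prop :=
  [/\ c i t = c j t,
      \forall s \near t^'-, (c j s).2 < (c i s).2 &
      \forall s \near t^'+, (c i s).2 < (c j s).2].

Record strand_diagram (R : realType) (n : nat) := StrandDiagram {
  strand :> 'I_n -> R -> R * R;
  strand_perm : 'S_n;
  strand_continuous : forall k, {within I01, continuous (strand k)};
  strand_square : forall k t, I01 t -> square (strand k t);
  strand_start : forall k, strand k 0 = (0, height k);
  strand_end : forall k, strand k 1 = (1, height (strand_perm k));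
  strand_fst : forall k t, I01 t -> (strand k t).1 = t;
  strand_double : forall i j k t, I01 t -> i != j -> j != k -> i != k ->
    ~ (strand i t = strand j t /\ strand j t = strand k t);
  strand_transversal : forall i j t, I01 t -> i != j ->
    strand i t = strand j t ->
    descends strand i j t \/ descends strand j i t
}.

Definition crossing {R : realType} {n : nat} (b : strand_diagram R n) :
    set (R * R) :=
  [set p | exists i j t, [/\ I01 t, i != j, b i t = p & b j t = p]].

(* Only the values of [value] at the crossings are meaningful. *)
Record vbd (R : realType) (n : nat) := VBD {
  diagram :> strand_diagram R n;
  value : R * R -> crossing_value
}.

Definition vbd_eq {R : realType} {n : nat} (b b' : vbd R n) : Prop :=
  (forall k t, I01 t -> b k t = b' k t) /\
  (forall p, crossing b p -> value b p = value b' p).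

(* The crossings of an isotopy [H] are carried along by the continuous paths
   [c q] in the square: at each time [s] of the isotopy they enumerate the
   crossings of [H s] without repetition, and their values do not change.
   Continuity of [H] alone would let a crossing split into three. *)
Definition isotopic {R : realType} {n : nat} (b b' : vbd R n) : Prop :=
  exists H : R -> vbd R n,
  [/\ vbd_eq (H 0) b,
      vbd_eq (H 1) b',
      forall k, {within square, continuous (fun st : R * R => H st.1 k st.2)} &
      exists (m : nat) (c : 'I_m -> R -> R * R),
        (forall q, {within I01, continuous (c q)}) /\
        (forall s, I01 s ->
          [/\ injective (c^~ s),
              range (c^~ s) = crossing (H s) &
              forall q, value (H s) (c q s) = value (H 0) (c q 0)])].

(** * Virtual and mixed moves *)

(* [(i, v)] stands for a single crossing of value [v] between the strands in
   positions [i] and [i+1]; positions are numbered from 1, upwards. *)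
Definition letter : Type := nat * crossing_value.

Definition sigma (s : sign) (i : nat) : letter := (i, Regular s).
Definition tau (i : nat) : letter := (i, Virtual).

Inductive vm_rule : seq letter -> seq letter -> Prop :=
| rule_V2 i : vm_rule [:: tau i; tau i] [::]
| rule_V3 i : vm_rule [:: tau i; tau i.+1; tau i] [:: tau i.+1; tau i; tau i.+1]
| rule_M i : vm_rule [:: sigma Plus i; tau i.+1; tau i]
                [:: tau i.+1; tau i; sigma Plus i.+1]
| rule_M' i : vm_rule [:: sigma Minus i; tau i.+1; tau i]
                 [:: tau i.+1; tau i; sigma Minus i.+1].

(* The discs in which moves take place: a disc has a left and a right side
   (for the strands to enter and to leave), a lower and an upper side. *)
Record disc (R : realType) := Disc {
  left_time : R;
  right_time : R;
  lower : R -> R;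
  upper : R -> R;
  left_ge0 : 0 <= left_time;
  left_lt_right : left_time < right_time;
  right_le1 : right_time <= 1;
  lower_continuous : {within `[left_time, right_time], continuous lower};
  upper_continuous : {within `[left_time, right_time], continuous upper};
  lower_ge0 : forall t, t \in `[left_time, right_time] -> 0 <= lower t;
  lower_lt_upper :
    forall t, t \in `[left_time, right_time] -> lower t < upper t;
  upper_le1 : forall t, t \in `[left_time, right_time] -> upper t <= 1
}.

Definition disc_set {R : realType} (V : disc R) : set (R * R) :=
  [set p | left_time V <= p.1 <= right_time V /\
           lower V p.1 <= p.2 <= upper V p.1].

(* [b] meets [V] in strands going from its left side to its right side, namely
   in portions of the strands in [K]. *)
Definition runs_through {R : realType} {n : nat} (b : strand_diagram R n)
    (V : disc R) (K : {set 'I_n}) : Prop :=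
  forall k t, left_time V <= t <= right_time V ->
    (disc_set V (b k t) <-> k \in K).

(* There is at time [t] a crossing described by the letter [l] between strands
   in [K], their positions being counted inside [K]. *)
Definition crossing_letter {R : realType} {n : nat} (b : vbd R n)
    (K : {set 'I_n}) (t : R) (l : letter) : Prop :=
  exists i j, [/\ i \in K, j \in K, i != j, b i t = b j t &
    l = (#|[set k in K | (b k t).2 < (b i t).2]|.+1, value b (b i t))].

(* Inside [V] the diagram [b] is the concatenation of the letters of [w]; [u]
   lists the times of the crossings. *)
Definition reads {R : realType} {n : nat} (b : vbd R n) (V : disc R)
    (K : {set 'I_n}) (w : seq letter) : Prop :=
  exists u : seq R,
  [/\ size u = size w,
      sorted <%R (left_time V :: rcons u (right_time V)) &
      forall t l, left_time V <= t <= right_time V ->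
        (crossing_letter b K t l <->
         exists2 r, (r < size w)%N &
           t = nth 0 u r /\ l = nth (0%N, Virtual) w r)].

Definition agree_outside {R : realType} {n : nat} (V : disc R)
    (b b' : vbd R n) : Prop :=
  (forall k t, I01 t -> ~ disc_set V (b k t) \/ ~ disc_set V (b' k t) ->
     b k t = b' k t) /\
  (forall p, crossing b p -> ~ disc_set V p -> value b p = value b' p).

Definition vm_move {R : realType} {n : nat} (b b' : vbd R n) : Prop :=
  exists (w w' : seq letter) (V : disc R) (K : {set 'I_n}),
  [/\ vm_rule w w',
      runs_through b V K /\ runs_through b' V K,
      reads b V K w,
      reads b' V K w' &
      agree_outside V b b'].

Definition virtually_equivalent {R : realType} {n : nat} :
    vbd R n -> vbd R n -> Prop :=
  clos_refl_sym_trans (vbd R n) (fun b b' => isotopic b b' \/ vm_move b b').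

(** * Gauss diagrams *)

Record arrow (R : realType) (n : nat) := Arrow {
  tail_interval : 'I_n;
  tail_point : R;
  head_interval : 'I_n;
  head_point : R;
  arrow_sign : sign
}.

Definition arrow_ends {R : realType} {n : nat} (a : arrow R n) :
    set ('I_n * R) :=
  [set (tail_interval a, tail_point a); (head_interval a, head_point a)].

(* As Gauss diagrams are considered up to homeomorphism of the intervals (see
   [gauss_equiv]), each interval is taken to be [I01]. *)
Record gauss_diagram (R : realType) (n : nat) := GaussDiagram {
  arrows : set (arrow R n);
  gauss_perm : 'S_n;
  arrows_finite : finite_set arrows;
  arrows_interior : forall a, arrows a ->
    0 < tail_point a < 1 /\ 0 < head_point a < 1
}.

(* Orientation preserving homeomorphism from [I01] to [I01]. *)
Definition oriented_homeo {R : realType} (h : R -> R) : Prop :=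
  [/\ {within I01, continuous h},
      set_bij I01 I01 h &
      forall x y, I01 x -> I01 y -> x < y -> h x < h y].

Definition map_arrow {R : realType} {n : nat} (h : 'I_n -> R -> R)
    (a : arrow R n) : arrow R n :=
  Arrow (tail_interval a) (h (tail_interval a) (tail_point a))
        (head_interval a) (h (head_interval a) (head_point a))
        (arrow_sign a).

(* Equality of Gauss diagrams. *)
Definition gauss_equiv {R : realType} {n : nat} (g g' : gauss_diagram R n) :
    Prop :=
  gauss_perm g = gauss_perm g' /\
  exists h : 'I_n -> R -> R,
    (forall k, oriented_homeo (h k)) /\ map_arrow h @` arrows g = arrows g'.

(* [p k] parametrizes the [k]-th interval. *)
Definition braid_gauss_diagram {R : realType} {n : nat}
    (g : gauss_diagram R n) : Prop :=
  [/\ forall a b, arrows g a -> arrows g b -> a <> b ->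
        arrow_ends a `&` arrow_ends b = set0,
      forall a, arrows g a -> tail_interval a != head_interval a &
      exists (p : 'I_n -> R -> R) (time : arrow R n -> R),
        [/\ forall k, oriented_homeo (p k),
            forall a, arrows g a ->
              [/\ I01 (time a),
                  tail_point a = p (tail_interval a) (time a) &
                  head_point a = p (head_interval a) (time a)] &
            forall a b, arrows g a -> arrows g b -> a <> b ->
              time a <> time b]].

(** * The Gauss diagram of a virtual braid diagram *)

(* At a positive crossing the over-passing strand is the descending one, at a
   negative crossing it is the ascending one. *)
Definition crossing_arrow {R : realType} {n : nat} (i j : 'I_n) (t : R)
    (s : sign) : arrow R n :=
  match s with
  | Plus => Arrow i t j t Plus
  | Minus => Arrow j t i t Minus
  end.

Definition regular_arrows {R : realType} {n : nat} (b : vbd R n) :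
    set (arrow R n) :=
  [set a | exists i j t s,
    [/\ I01 t, descends b i j t, value b (b i t) = Regular s &
        a = crossing_arrow i j t s]].

Lemma height_inj {R : realType} {n : nat} : injective (@height R n).
Proof.
move=> i j /(mulIf _) h; apply/val_inj/eqP; rewrite -eqSS -(eqr_nat R).
by rewrite h // invr_eq0 pnatr_eq0.
Qed.

Lemma descends_irr {R : realType} {n : nat} (c : 'I_n -> R -> R * R) i t :
  ~ descends c i i t.
Proof.
case=> _ + _; move=> h.
have : \forall s \near t^'-, False by apply: filterS h => s; rewrite ltxx.
by move/filter_ex => [].
Qed.

Lemma descends_interior {R : realType} {n : nat} (b : strand_diagram R n)
    i j t : I01 t -> descends b i j t -> 0 < t < 1.
Proof.
rewrite /I01 /= in_itv /= => /andP[t0 t1] d.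
have [ij|ij] := eqVneq i j; first by move: d; rewrite ij => /descends_irr.
case: d => e _ _.
rewrite !lt_neqAle t0 t1 !andbT; apply/andP; split; apply/eqP => tE.
- move: e; rewrite -tE !strand_start => -[] /height_inj /eqP.
  by rewrite (negbTE ij).
- move: e; rewrite tE !strand_end => -[] /height_inj /perm_inj /eqP.
  by rewrite (negbTE ij).
Qed.

Lemma near_isolated_crossing {R : realType} {n : nat}
    (b : strand_diagram R n) (i j : 'I_n) t : i != j -> I01 t ->
  \forall s \near t, I01 s -> s != t -> b i s != b j s.
Proof.
move=> ij It; have [e|ne] := eqVneq (b i t) (b j t).
  have side k l : descends b k l t ->
      \forall s \near t, s != t -> b k s != b l s.
    case=> _; rewrite !near_withinE => L G.
    apply: filterS2 L G => s /= hl hg.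
    rewrite neq_lt => /orP[/hl|/hg] h; apply/eqP => E;
      by move: h; rewrite E ltxx.
  have [/side|/side] := strand_transversal It ij e.
    by apply: filterS => s h _ /h.
  by apply: filterS => s h _ /h; rewrite eq_sym.
pose d s := (b i s).2 - (b j s).2.
have d0 : d t != 0.
  rewrite subr_eq0; apply: contra ne => /eqP h.
  by rewrite [b i t]surjective_pairing [b j t]surjective_pairing !strand_fst ?h.
have c2 k : (b k s).2 @[s --> within I01 (nbhs t)] --> (b k t).2.
  have /subspace_continuousP/(_ _ It) h := @strand_continuous _ _ b k.
  by apply: cvg_comp h _; apply: cvg_snd.
have cd : d s @[s --> within I01 (nbhs t)] --> d t by apply: cvgB; exact: c2.
have dn0 : \forall s \near within I01 (nbhs t), d s != 0.
  by apply: cvgr_neq0 d0.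
have {}dn0 : \forall s \near t, I01 s -> d s != 0 by move: dn0; rewrite near_withinE.
apply: filterS dn0 => s h Is _.
by apply/eqP => E; move/eqP: (h Is); apply; rewrite /d E subrr.
Qed.

Lemma finite_crossing_times {R : realType} {n : nat}
    (b : strand_diagram R n) (i j : 'I_n) : i != j ->
  finite_set [set t | I01 t /\ b i t = b j t].
Proof.
move=> ij; apply: contrapT => inf.
have [] := infinite_bounded_limit_point_nonempty inf.
  exists 1; split; first exact: num_real.
  move=> x x1 t [] /=; rewrite /I01 /= in_itv /= => /andP[t0 t1] _.
  by rewrite ger0_norm //; exact: le_trans t1 (ltW x1).
move=> l ll.
have Il : I01 l.
  have cl : closed (@I01 R) by exact: interval_closed.
  apply: cl => U /ll[s [_ [Is _] Us]]; by exists s.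
have /ll[s [sl [Is e] /(_ Is sl)]] := near_isolated_crossing b ij Il.
by rewrite e eqxx.
Qed.

Lemma regular_arrows_finite {R : realType} {n : nat} (b : vbd R n) :
  finite_set (regular_arrows b).
Proof.
pose T (ij : 'I_n * 'I_n) : set R :=
  [set t | ij.1 != ij.2 /\ I01 t /\ b ij.1 t = b ij.2 t].
pose A (ij : 'I_n * 'I_n) (s : sign) : set (arrow R n) :=
  (crossing_arrow ij.1 ij.2)^~ s @` T ij.
apply: (@sub_finite_set _ _
    (\bigcup_(ij in [set: 'I_n * 'I_n]) (A ij Plus `|` A ij Minus))).
  move=> a [i [j [t [s [It d _ ->]]]]]; exists (i, j) => //.
  have ij : i != j by apply/eqP => ij; move: d; rewrite ij => /descends_irr.
  have Tt : T (i, j) t by case: d.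
  by case: s; [left|right]; exists t.
apply: bigcup_finite; first exact: finite_finset.
move=> [i j] _.
have fT : finite_set (T (i, j)).
  have [->|ij] := eqVneq i j.
    apply: (@sub_finite_set _ _ set0); last exact: finite_set0.
    by move=> t []; rewrite eqxx.
  by apply: sub_finite_set (finite_crossing_times b ij) => t [].
by rewrite finite_setU; split; exact: finite_image.
Qed.

Lemma regular_arrows_interior {R : realType} {n : nat} (b : vbd R n)
    (a : arrow R n) : regular_arrows b a ->
  0 < tail_point a < 1 /\ 0 < head_point a < 1.
Proof.
by case=> i [j [t [[] [It d _ ->]]]]; have := descends_interior It d.
Qed.

Definition gauss {R : realType} {n : nat} (b : vbd R n) : gauss_diagram R n :=
  GaussDiagram (strand_perm b) (@regular_arrows_finite R n b)
    (@regular_arrows_interior R n b).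

(* Main.v *)
Require Import Defs.
From HB Require Import structures.
From Stdlib Require Import Relation_Operators.
From Stdlib Require Setoid Morphisms.
From mathcomp Require Import all_boot all_order all_algebra all_fingroup.
From mathcomp Require Import all_classical all_reals all_analysis.
From mathcomp Require Import zify ring lra.

Set Implicit Arguments.
Unset Strict Implicit.
Unset Printing Implicit Defensive.

Import Order.TTheory GRing.Theory Num.Theory.
Import numFieldNormedType.Exports.

(* A word in the letters [sigma s i] and [tau i] determines a list of arrows: each
   letter [sigma s i] contributes the pair of strands that it lets cross.  Virtual
   letters generate the symmetric group modulo V2, V3 and far commutation, and the
   mixed moves conjugate a regular letter to any other position, so the list of
   arrows and the permutation determine the word up to moves; commuting letters
   allow to interchange two arrows without common strand, so it is enough to know
   the sequence of arrows along each strand.  This sequence is what the Gauss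
   diagram records.

   Conversely a diagram is determined up to isotopy by its movie, the sequence of
   the orders of the strands between consecutive crossing times: the heights of
   two diagrams with the same movie can be interpolated linearly after a
   reparametrization.  Perturbing the times of simultaneous crossings, every
   diagram becomes isotopic to one that reads a word.

   The Gauss diagram is invariant under isotopies, since the pair of strands
   through a crossing is locally constant during the isotopy, and under moves,
   since the ranks of the strands inside the disc can be traced letter by letter. *)

(** * Words of crossings *)

(** Far commutation is an isotopy of diagrams and not a move, and the isotopy passes through a
    diagram with two simultaneous crossings. Isotopies are therefore built for movies in which one
    step may exchange several disjoint adjacent pairs, by two criteria: in [isotopic_follows] all
    crossings of a step share one time and these times vary; in [isotopic_draws] the steps of a
    standard drawing stay fixed and the crossings within a step move independently. Within a step
    the standard drawing depends only on the states at its two ends and on the schedule, so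
    replacing a subword by one of the same length and permutation changes it only in a vertical
    strip. Two idle letters bring V2 into this form. A regular letter passes an arbitrary virtual
    word thanks to a normal form in which its two strands run in parallel, where M applies
    repeatedly. For the invariance of the Gauss diagram, the curves are merely continuous, so the
    strand that descends at a crossing is followed along an isotopy by local constancy; and the disc
    of a move is arbitrary, so only the ranks among the strands in [K] are available there. *)

Section Words.
Variable n : nat.
Local Open Scope group_scope.
Local Open Scope nat_scope.

(* Positions are numbered from 0 in ['I_n], so that the letter [i] exchanges the
   positions [i.-1] and [i]; a letter that is out of range does nothing. *)
Definition adj_swap (i : nat) : 'S_n :=
  if insub i.-1 is Some a then
    if insub i is Some b then tperm a b else 1%g
  else 1%g.

Lemma adj_swapE i (k : 'I_n) : adj_swap i k =
  (if i < n then
     if k == i.-1 :> nat then i else if k == i :> nat then i.-1 else k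
   else k) :> nat.
Proof.
rewrite /adj_swap; case: (ltnP i n) => hi; last first.
  case: insubP => [a _ _|_]; last by rewrite perm1.
  by rewrite insubF ?perm1 // ltnNge hi.
have hi' : i.-1 < n by lia.
rewrite !insubT /=; case: tpermP => [->|->|/eqP h1 /eqP h2] /=.
- by rewrite eqxx.
- by rewrite eqxx; case: eqP => // ->.
- by move: h1 h2; rewrite -!val_eqE /= => /negbTE -> /negbTE ->.
Qed.

Definition word_perm (w : seq letter) : 'S_n :=
  (\prod_(l <- w) adj_swap l.1)%g.

Lemma word_perm_cat u v : word_perm (u ++ v) = (word_perm u * word_perm v)%g.
Proof. exact: big_cat. Qed.

Lemma word_perm_cons l w : word_perm (l :: w) = (adj_swap l.1 * word_perm w)%g.
Proof. exact: big_cons. Qed.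

Lemma word_perm_nil : word_perm [::] = 1%g.
Proof. exact: big_nil. Qed.

Lemma word_perm1 l : word_perm [:: l] = adj_swap l.1.
Proof. exact: big_seq1. Qed.

Definition valid_letter (l : letter) : bool := 0 < l.1 < n.

(** Far commutation is a relation between words, although for diagrams it is an isotopy. Letters out
    of range are excluded because they act trivially: with [i.+1 = n], V3 would relate words with
    different permutations. *)
Inductive word_rule : seq letter -> seq letter -> Prop :=
| word_rule_vm r r' : vm_rule r r' -> all valid_letter (r ++ r') ->
    word_rule r r'
| word_rule_far l l' : valid_letter l -> valid_letter l' -> l.1.+1 < l'.1 ->
    word_rule [:: l; l'] [:: l'; l].

Inductive weq : seq letter -> seq letter -> Prop :=
| weq_refl w : weq w w
| weq_sym u v : weq u v -> weq v u
| weq_trans u v w : weq u v -> weq v w -> weq u w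
| weq_ctx a r r' c : word_rule r r' -> weq (a ++ r ++ c) (a ++ r' ++ c).

#[global] Instance weq_equiv : RelationClasses.Equivalence weq.
Proof.
split; [exact: weq_refl|exact: weq_sym|exact: weq_trans].
Qed.

Lemma weq_cat2 a u v c : weq u v -> weq (a ++ u ++ c) (a ++ v ++ c).
Proof.
elim=> [w|u' v' _ /weq_sym //|u' v' w' _ h1 _ h2|a' r r' c' h].
- exact: weq_refl.
- exact: weq_trans h1 h2.
- by rewrite -!catA !(catA a); apply: weq_ctx.
Qed.

#[global] Instance weq_cat_proper :
  Morphisms.Proper
    (Morphisms.respectful weq (Morphisms.respectful weq weq)) (@cat letter).
Proof.
move=> u u' hu v v' hv; transitivity (u' ++ v).
  exact: (@weq_cat2 [::] u u' v hu).
by have := @weq_cat2 u' v v' [::] hv; rewrite !cats0.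
Qed.

Lemma weq_rule r r' : word_rule r r' -> weq r r'.
Proof. by move=> h; have := weq_ctx [::] [::] h; rewrite !cats0. Qed.

Lemma adj_swap_tperm i : 0 < i < n -> exists a b : 'I_n,
  [/\ a = i.-1 :> nat, b = i :> nat & adj_swap i = tperm a b].
Proof.
move=> /andP[i0 hi]; have hi' : i.-1 < n by lia.
by exists (Ordinal hi'), (Ordinal hi); rewrite /adj_swap !insubT.
Qed.

Lemma adj_swapK i : (adj_swap i * adj_swap i = 1)%g.
Proof.
rewrite /adj_swap; case: (insub i.-1 : option 'I_n) => [a|]; last exact: mulg1.
by case: (insub i : option 'I_n) => [b|]; rewrite ?mulg1 ?tperm2.
Qed.

Lemma adj_swap_braid i : 0 < i -> i.+1 < n ->
  (adj_swap i * (adj_swap i.+1 * adj_swap i) =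
   adj_swap i.+1 * (adj_swap i * adj_swap i.+1))%g.
Proof.
move=> i0 hi.
have [|a [b [ha hb ab]]] := @adj_swap_tperm i; first by lia.
have [|b' [c [hb' hc bc]]] := @adj_swap_tperm i.+1; first by lia.
have /val_inj hbb : b' = b :> nat by rewrite hb hb'.
move: ab bc; rewrite {}hbb => -> ->.
have ne (x y : 'I_n) : x <> y :> nat -> x != y by move=> h; apply/eqP => /(congr1 val).
have /ne nab : a <> b :> nat by lia.
have /ne nbc : b <> c :> nat by lia.
have /ne nac : a <> c :> nat by lia.
have e (x y : 'S_n) : x^-1%g = x -> (x * (y * x) = y ^ x)%g by move=> {1}<-.
rewrite !e ?tpermV // !tpermJ tpermR tpermL.
by rewrite [tperm a b c]tpermD // [tperm b c a]tpermD // eq_sym.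
Qed.

Lemma adj_swap_far i j : 0 < i -> i.+1 < j -> j < n ->
  (adj_swap i * adj_swap j = adj_swap j * adj_swap i)%g.
Proof.
move=> i0 ij jn.
have [|a [b [ha hb ->]]] := @adj_swap_tperm i; first by lia.
have [|c [d [hc hd ->]]] := @adj_swap_tperm j; first by lia.
have ne (x y : 'I_n) : x <> y :> nat -> x != y by move=> h; apply/eqP => /(congr1 val).
apply/esym/commgP/conjg_fixP; rewrite tpermJ !tpermD // ne; lia.
Qed.

Lemma word_rule_perm r r' : word_rule r r' -> word_perm r = word_perm r'.
Proof.
case=> [{}r {}r' h va|l l' /andP[l0 _] /andP[_ ln'] ll'].
  case: h va => i; rewrite /= /valid_letter /= ?word_perm_cons word_perm_nil
    ?mulg1 => va; rewrite /= ?adj_swapK // adj_swap_braid //; lia.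
by rewrite !word_perm_cons word_perm_nil !mulg1 adj_swap_far.
Qed.

Lemma weq_perm u v : weq u v -> word_perm u = word_perm v.
Proof.
elim=> [//|? ? _ -> //|? ? ? _ -> _ -> //|a r r' c h].
by rewrite !word_perm_cat (word_rule_perm h).
Qed.

Lemma weq_far l l' : valid_letter l -> valid_letter l' ->
  (l.1.+1 < l'.1) || (l'.1.+1 < l.1) -> weq ([:: l] ++ [:: l']) ([:: l'] ++ [:: l]).
Proof.
move=> v v' /orP[] h; first by apply/weq_rule/word_rule_far.
by symmetry; apply/weq_rule/word_rule_far.
Qed.

Lemma weq_far_words l w : valid_letter l -> all valid_letter w ->
  all (fun l' => (l.1.+1 < l'.1) || (l'.1.+1 < l.1)) w ->
  weq ([:: l] ++ w) (w ++ [:: l]).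
Proof.
move=> vl; elim: w => [|x w IH]; first by move=> _ _; exact: weq_refl.
move=> /= /andP[vx vw] /andP[lx lw].
rewrite -[l :: x :: w]/([:: l] ++ [:: x] ++ w) catA (weq_far vl vx lx) -catA.
rewrite (IH vw lw); exact: weq_refl.
Qed.

Definition vw (s : seq nat) : seq letter := map tau s.

Lemma vw_cat s t : vw (s ++ t) = vw s ++ vw t.
Proof. exact: map_cat. Qed.

Lemma weq_V2 i : 0 < i < n -> weq ([:: tau i] ++ [:: tau i]) [::].
Proof.
move=> hi; apply/weq_rule/word_rule_vm; first exact: rule_V2.
by rewrite /= /valid_letter /= hi.
Qed.

Lemma weq_V3 i : 0 < i -> i.+1 < n ->
  weq ([:: tau i] ++ [:: tau i.+1] ++ [:: tau i])
      ([:: tau i.+1] ++ [:: tau i] ++ [:: tau i.+1]).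
Proof.
move=> hi hn; apply/weq_rule/word_rule_vm; first exact: rule_V3.
by rewrite /= /valid_letter /=; lia.
Qed.

Lemma weq_M s i : 0 < i -> i.+1 < n ->
  weq ([:: sigma s i] ++ [:: tau i.+1] ++ [:: tau i])
      ([:: tau i.+1] ++ [:: tau i] ++ [:: sigma s i.+1]).
Proof.
move=> hi hn; apply/weq_rule/word_rule_vm; last first.
  by rewrite /= /valid_letter /=; lia.
by case: s; [exact: rule_M|exact: rule_M'].
Qed.

Definition in_range m (s : seq nat) : bool := all (fun i => m <= i < n) s.

Lemma in_range_valid m s : 0 < m -> in_range m s -> all valid_letter (vw s).
Proof.
move=> m0; rewrite all_map; apply: sub_all => i /=.
by rewrite /valid_letter /=; lia.
Qed.

(* A word in the letters [i >= m] moves to the left all letters but those that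
   carry the strand in position [m.-1] upwards. *)
Lemma weq_peel m s : 0 < m <= n -> in_range m s ->
  exists s' d, [/\ in_range m.+1 s', m + d <= n &
    weq (vw s) (vw s' ++ vw (iota m d))].
Proof.
move=> hm; elim/last_ind: s => [|s i IH].
  by move=> _; exists [::], 0; split=> //; [lia|exact: weq_refl].
rewrite /in_range all_rcons => /andP[hi /IH[s' [d [hs' hd e]]]].
rewrite -cats1 vw_cat.
have far i0 t : 0 < i0 < n -> in_range 1 t ->
    all (fun j => (i0.+1 < j) || (j.+1 < i0)) t ->
    weq ([:: tau i0] ++ vw t) (vw t ++ [:: tau i0]).
  move=> h1 h2 h3; apply: weq_far_words => //; first exact: in_range_valid h2.
  by rewrite all_map.
have iota_range a b : 0 < a -> a + b <= n -> in_range 1 (iota a b).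
  by move=> a0 hab; rewrite /in_range; apply/allP => j; rewrite mem_iota; lia.
(* The word is [s'] followed by the run [m, ..., m + d - 1]. The new letter [i] extends the run if
   it equals [m + d], commutes with the run if it is larger, cancels the last letter by V2 if it
   equals [m + d - 1], and otherwise passes the run by V3 and becomes [i.+1]. *)
have [ie|ine] := eqVneq i (m + d).
  exists s', d.+1; split=> //; first by lia.
  by rewrite -addn1 iotaD vw_cat /= -ie catA e; exact: weq_refl.
have [ig|il] := ltnP (m + d) i.
  exists (rcons s' i), d; split => //.
  rewrite /in_range all_rcons; apply/andP; split; first by lia.
    by apply: sub_all hs' => j; lia.
  rewrite e -cats1 vw_cat -!catA /= -far //; [exact: weq_refl|lia|apply: iota_range; lia|].
  by apply/allP => j; rewrite mem_iota; lia.
case: d => [|d] in hd e ine il *; first by lia.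
have [ie|ine2] := eqVneq i (m + d).
  exists s', d; split=> //; first by lia.
  rewrite e -addn1 iotaD vw_cat -!catA -ie -[vw (iota i 1)]/[:: tau i].
  rewrite weq_V2; last by lia.
  by rewrite cats0; exact: weq_refl.
have hid : i.+1 < m + d.+1 by lia.
exists (rcons s' i.+1), d.+1; split => //.
  rewrite /in_range all_rcons; apply/andP; split; first by lia.
    by apply: sub_all hs' => j; lia.
have -> : iota m d.+1 = iota m (i - m) ++ [:: i; i.+1] ++ iota i.+2 (m + d.+1 - i.+2).
  have -> : d.+1 = (i - m) + (2 + (m + d.+1 - i.+2)) by lia.
  rewrite iotaD iotaD; congr (_ ++ (_ ++ _)).
  - by rewrite /= subnKC; last lia.
  - by congr iota; lia.
rewrite e.
have -> : iota m d.+1 = iota m (i - m) ++ [:: i; i.+1] ++ iota i.+2 (m + d.+1 - i.+2).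
  have -> : d.+1 = (i - m) + (2 + (m + d.+1 - i.+2)) by lia.
  rewrite iotaD iotaD; congr (_ ++ (_ ++ _)).
  - by rewrite /= subnKC; last lia.
  - by congr iota; lia.
(* The appended [i] commutes with [B], V3 turns [i, i.+1, i] into [i.+1, i, i.+1], and the leading
   [i.+1] commutes with [A] and so joins [s']. *)
set A := iota m (i - m); set B := iota i.+2 _.
rewrite -cats1 !vw_cat.
rewrite [vw [:: i.+1]]/= [vw [:: i; i.+1]]/= [vw [:: i]]/=.
rewrite -[[:: tau i; tau i.+1]]/([:: tau i] ++ [:: tau i.+1]) -!catA.
rewrite -(far i B); last 3 first.
- lia.
- by apply: iota_range; lia.
- by apply/allP => j; rewrite mem_iota; lia.
rewrite (catA [:: tau i.+1] (vw A)) (far i.+1 A); last 3 first.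
- lia.
- by apply: iota_range; lia.
- by apply/allP => j; rewrite mem_iota; lia.
rewrite -!catA.
have h3 : weq ([:: tau i] ++ [:: tau i.+1] ++ [:: tau i] ++ vw B)
   ([:: tau i.+1] ++ [:: tau i] ++ [:: tau i.+1] ++ vw B).
  have hi0 : 0 < i by lia.
  have hin : i.+1 < n by lia.
  by have := weq_cat2 [::] (vw B) (weq_V3 hi0 hin); rewrite -!catA.
rewrite h3; exact: weq_refl.
Qed.



Lemma adj_swap_lt m i (k : 'I_n) : m.+1 < i -> k <= m -> adj_swap i k = k.
Proof. by move=> h1 h2; apply: ord_inj; rewrite adj_swapE; repeat case: ifP; lia. Qed.

Lemma word_perm_fix m s (k : 'I_n) : in_range m.+2 s -> k <= m ->
  word_perm (vw s) k = k.
Proof.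
elim: s => [|i s IH] /=; first by rewrite word_perm_nil perm1.
move=> /andP[hi hs] km; rewrite word_perm_cons permM.
by rewrite (@adj_swap_lt m) ?IH //=; lia.
Qed.

Lemma word_perm_iota m d (k : 'I_n) : 0 < m -> m + d <= n ->
  word_perm (vw (iota m d)) k =
    (if k == m.-1 :> nat then m.-1 + d
     else if m <= k < m + d then k.-1 else k) :> nat.
Proof.
move=> m0; elim: d => [|d IH] in k * => hd.
  by rewrite word_perm_nil perm1; repeat case: ifP; lia.
rewrite -addn1 iotaD vw_cat word_perm_cat permM word_perm1 adj_swapE.
have := IH k; move: (word_perm _ k) => j /(_ ltac:(lia)) /= hj.
by have := ltn_ord k; move: hj; repeat case: ifP; lia.
Qed.

(* The Coxeter presentation of the symmetric group. *)
Lemma weq_virtual s t : in_range 1 s -> in_range 1 t ->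
  word_perm (vw s) = word_perm (vw t) -> weq (vw s) (vw t).
Proof.
(* Induction on [n - m]: peeling leaves words in the letters from [m.+1] on. *)
suff main d m s' t' : m + d = n -> 0 < m -> in_range m s' -> in_range m t' ->
    word_perm (vw s') = word_perm (vw t') -> weq (vw s') (vw t').
  move=> hs ht; have [n0|n0] := posnP n; last by apply: (main n.-1 1) => //; lia.
  move: hs ht.
  case: s => [|i s]; last by move=> /andP[? _]; lia.
  case: t => [|i t]; last by move=> _ /andP[? _]; lia.
  by move=> *; exact: weq_refl.
elim: d => [|d IH] in m s' t' * => hm m0.
  case: s' => [|i s']; last by move=> /andP[? _]; lia.
  case: t' => [|i t']; last by move=> _ /andP[? _]; lia.
  by move=> *; exact: weq_refl.
have hmn : 0 < m <= n by lia.
move=> /(weq_peel hmn)[s1 [ds [rs hds es]]] /(weq_peel hmn)[t1 [dt [rt hdt et]]].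
rewrite (weq_perm es) (weq_perm et) !word_perm_cat => E.
have hm1 : m.-1 < n by lia.
(* Neither [s1] nor [t1] moves position [m.-1], so the common permutation sends it to [m.-1 + ds]
   and to [m.-1 + dt]. *)
have dd : ds = dt.
  have fix1 u : in_range m.+1 u -> word_perm (vw u) (Ordinal hm1) = Ordinal hm1.
    by move=> hu; apply: (@word_perm_fix m.-1); rewrite ?prednK.
  have := congr1 (fun p : 'S_n => nat_of_ord (p (Ordinal hm1))) E.
  by rewrite /= !permM (fix1 s1) // (fix1 t1) // !word_perm_iota //= eqxx; lia.
rewrite es et dd (IH m.+1 s1 t1) //; first exact: weq_refl; first by lia.
by move: E; rewrite dd => /mulIg.
Qed.

(** The virtual word carries the two lowest strands in parallel [p] positions upwards. Each
    increment of [p] is one mixed move, once the letters [p.+2] and [iota 1 p] have been commuted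
    out of its way. *)
Lemma weq_block s p : p.+1 < n ->
  weq ([:: sigma s 1] ++ vw (iota 2 p) ++ vw (iota 1 p))
      (vw (iota 2 p) ++ vw (iota 1 p) ++ [:: sigma s p.+1]).
Proof.
elim: p => [|p IH] hp; first exact: weq_refl.
have -> : iota 2 p.+1 = iota 2 p ++ [:: p.+2] by rewrite -{1}[p.+1]addn1 iotaD.
have -> : iota 1 p.+1 = iota 1 p ++ [:: p.+1] by rewrite -{1}[p.+1]addn1 iotaD.
rewrite !vw_cat -!catA -[vw [:: p.+2]]/[:: tau p.+2] -[vw [:: p.+1]]/[:: tau p.+1].
have far : weq ([:: tau p.+2] ++ vw (iota 1 p)) (vw (iota 1 p) ++ [:: tau p.+2]).
  apply: weq_far_words.
  - by rewrite /valid_letter /=; lia.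
  - by apply: (@in_range_valid 1) => //; apply/allP => j; rewrite mem_iota; lia.
  - by rewrite all_map; apply/allP => j; rewrite mem_iota /=; lia.
rewrite (catA [:: tau p.+2]) far.
rewrite -!catA (catA (vw (iota 2 p))) (catA [:: sigma s 1]) IH; last by lia.
rewrite -!catA.
have M : weq ([:: sigma s p.+1] ++ [:: tau p.+2] ++ [:: tau p.+1])
    ([:: tau p.+2] ++ [:: tau p.+1] ++ [:: sigma s p.+2]) by apply: weq_M.
rewrite M (catA [:: tau p.+2] (vw (iota 1 p))) far -!catA; exact: weq_refl.
Qed.

(** Peeling [u] twice gives a word in letters from 3 on, which commutes with the letter 1, followed
    by [iota 2 d2] and [iota 1 d1]. The images of the two lowest strands force [d1 = d2 = p], which
    is the block of [weq_block]. *)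
Lemma weq_sigma0 s u p (a b : 'I_n) : in_range 1 u ->
  a = 0 :> nat -> b = 1 :> nat ->
  word_perm (vw u) a = p :> nat -> word_perm (vw u) b = p.+1 :> nat ->
  weq ([:: sigma s 1] ++ vw u) (vw u ++ [:: sigma s p.+1]).
Proof.
move=> ru a0 b1; have hb := ltn_ord b; rewrite b1 in hb.
have [|u1 [d1 [r1 h1 e1]]] := weq_peel _ ru; first by lia.
have [|u2 [d2 [r2 h2 e2]]] := weq_peel _ r1; first by lia.
rewrite (weq_perm e1) !word_perm_cat !permM (@word_perm_fix 0 u1 a) ?a0 //.
rewrite word_perm_iota // => hd1.
have d1p : d1 = p by move: hd1; repeat case: ifP; lia.
move: h1 e1; rewrite {}d1p => h1 e1 {hd1}.
rewrite (weq_perm e2) !word_perm_cat !permM (@word_perm_fix 1 u2 b) ?b1 //.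
rewrite !word_perm_iota // => hd2.
have d2p : d2 = p by move: hd2; repeat case: ifP; lia.
rewrite d2p in e2 h2.
rewrite e1 e2 -!catA (catA [:: sigma s 1]).
rewrite (@weq_far_words (sigma s 1) (vw u2)); last 3 first.
- by rewrite /valid_letter /=; lia.
- exact: in_range_valid r2.
- by rewrite all_map; apply: sub_all r2 => j /=; lia.
by rewrite -!catA weq_block //; exact: weq_refl.
Qed.

Lemma in_range_rev m s : in_range m s -> in_range m (rev s).
Proof. by rewrite /in_range all_rev. Qed.

Lemma in_range_cat m s t : in_range m (s ++ t) = in_range m s && in_range m t.
Proof. exact: all_cat. Qed.

Lemma word_perm_rev s : word_perm (vw (rev s)) = (word_perm (vw s))^-1%g.
Proof.
elim: s => [|i s IH]; first by rewrite word_perm_nil invg1.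
rewrite rev_cons -cats1 vw_cat word_perm_cat IH word_perm1 word_perm_cons invMg.
by congr (_ * _)%g; apply/eqP; rewrite eq_sym eq_invg_mul adj_swapK.
Qed.

(** Conjugation to the bottom: the block [c] carries positions 0 and 1 to [p] and [p.+1], so
    [weq_sigma0] applies both to [c] and to [c ++ u]; comparing the two and cancelling [c] gives the
    claim. *)
Lemma weq_sigma s u p q (a b : 'I_n) : in_range 1 u ->
  a = p :> nat -> b = p.+1 :> nat ->
  word_perm (vw u) a = q :> nat -> word_perm (vw u) b = q.+1 :> nat ->
  weq ([:: sigma s p.+1] ++ vw u) (vw u ++ [:: sigma s q.+1]).
Proof.
move=> ru ap bp uq uq1; have hb := ltn_ord b; rewrite bp in hb.
pose c := iota 2 p ++ iota 1 p.
have rc : in_range 1 c.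
  by rewrite /c /in_range all_cat; apply/andP; split; apply/allP => j; rewrite mem_iota; lia.
have h0 : 0 < n by lia.
have h1 : 1 < n by lia.
have c0 : word_perm (vw c) (Ordinal h0) = a.
  apply: ord_inj; rewrite vw_cat word_perm_cat permM word_perm_iota; [|lia|lia].
  have := @word_perm_iota 2 p (Ordinal h0) isT (ltac:(lia)) => /=.
  by move: (word_perm (vw (iota 2 p)) _) => j; repeat case: ifP; lia.
have c1 : word_perm (vw c) (Ordinal h1) = b.
  apply: ord_inj; rewrite vw_cat word_perm_cat permM word_perm_iota; [|lia|lia].
  have := @word_perm_iota 2 p (Ordinal h1) isT (ltac:(lia)) => /=.
  by move: (word_perm (vw (iota 2 p)) _) => j; repeat case: ifP; lia.
have k1 : weq ([:: sigma s 1] ++ vw c) (vw c ++ [:: sigma s p.+1]).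
  by apply: (@weq_sigma0 s c p (Ordinal h0) (Ordinal h1)) => //; rewrite ?c0 ?c1.
have k2 : weq ([:: sigma s 1] ++ vw (c ++ u)) (vw (c ++ u) ++ [:: sigma s q.+1]).
  apply: (@weq_sigma0 s (c ++ u) q (Ordinal h0) (Ordinal h1)) => //.
  - by rewrite in_range_cat rc.
  - by rewrite vw_cat word_perm_cat permM c0.
  - by rewrite vw_cat word_perm_cat permM c1.
have inv : weq (vw (rev c) ++ vw c) [::].
  rewrite -vw_cat; apply: (@weq_virtual _ [::]) => //.
    by rewrite in_range_cat in_range_rev.
  by rewrite vw_cat word_perm_cat word_perm_rev mulVg word_perm_nil.
have -> : [:: sigma s p.+1] ++ vw u = [::] ++ [:: sigma s p.+1] ++ vw u by [].
rewrite -{1}inv -!catA (catA (vw c)) -k1 -!catA -vw_cat k2 vw_cat -!catA.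
by rewrite (catA (vw (rev c))) inv; exact: weq_refl.
Qed.

End Words.

(** * Arrows of a word *)

Section WordArrows.
Variable n : nat.
Local Open Scope nat_scope.

(* The strand going down, the strand going up, and the sign of a regular crossing. *)
Definition arrow_data : Type := 'I_n * 'I_n * sign.

(** [p] sends a strand to its present position, whence the inverse. Counted from 0, the upper of the
    two positions is [l.1]; its strand is the one that goes down. *)
Definition event (p : 'S_n) (l : letter) : option arrow_data :=
  if l.2 is Regular s then
    if insub l.1 is Some u then
      if insub l.1.-1 is Some d then Some (p^-1%g u, p^-1%g d, s) else None
    else None
  else None.

Fixpoint events (p : 'S_n) (w : seq letter) : seq (option arrow_data) :=
  if w is l :: w' then event p l :: events (p * adj_swap n l.1)%g w' else [::].

Definition word_arrows (p : 'S_n) (w : seq letter) : seq arrow_data :=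
  pmap id (events p w).

Lemma size_events (p : 'S_n) w : size (events p w) = size w.
Proof. by elim: w p => //= l w IH p; rewrite IH. Qed.

Lemma events_cat (p : 'S_n) u v :
  events p (u ++ v) = events p u ++ events (p * word_perm n u)%g v.
Proof.
elim: u p => [|l u IH] p; first by rewrite word_perm_nil mulg1.
by rewrite /= IH word_perm_cons mulgA.
Qed.

Lemma word_arrows_cat (p : 'S_n) u v :
  word_arrows p (u ++ v) = word_arrows p u ++ word_arrows (p * word_perm n u)%g v.
Proof. by rewrite /word_arrows events_cat pmap_cat. Qed.

Lemma word_arrows_virtual (p : 'S_n) s : word_arrows p (vw s) = [::].
Proof. by rewrite /word_arrows; elim: s p => //= i s IH p; rewrite IH. Qed.

Lemma event_sigma (p : 'S_n) s i (a b : 'I_n) : p a = i :> nat -> p b = i.-1 :> nat ->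
  event p (sigma s i) = Some (a, b, s).
Proof.
move=> pa pb; rewrite /event /= -pb -pa !valK; congr (Some (_, _, _)).
  exact: permK.
exact: permK.
Qed.

Lemma eventP (p : 'S_n) l (a b : 'I_n) s : event p l = Some (a, b, s) <->
  [/\ l.2 = Regular s, p a = l.1 :> nat & p b = l.1.-1 :> nat].
Proof.
case: l => i v; split=> [|[/= -> pa pb]]; last exact: event_sigma.
rewrite /event /=; case: v => // s'.
case: insubP => // u hu eu; case: insubP => // d hd ed [<- <- <-].
by rewrite !permKV.
Qed.

Lemma event_sigma_ex (p : 'S_n) s i : 0 < i < n ->
  exists a b : 'I_n, [/\ event p (sigma s i) = Some (a, b, s),
    p a = i :> nat & p b = i.-1 :> nat].
Proof.
move=> /andP[i0 hi]; have hi' : i.-1 < n by lia.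
exists (p^-1%g (Ordinal hi)), (p^-1%g (Ordinal hi')).
by split; [apply: event_sigma| |]; rewrite permKV.
Qed.

Lemma word_arrows_sigma (p : 'S_n) s i : 0 < i < n ->
  exists a b : 'I_n, [/\ word_arrows p [:: sigma s i] = [:: (a, b, s)],
    p a = i :> nat & p b = i.-1 :> nat].
Proof.
move=> /(event_sigma_ex p s)[a [b [e pa pb]]]; exists a, b; split=> //.
by rewrite /word_arrows /= e.
Qed.

Definition proper_arrow (a : arrow_data) : bool := a.1.1 != a.1.2.

Lemma word_arrows_proper (p : 'S_n) w : all (valid_letter n) w ->
  all proper_arrow (word_arrows p w).
Proof.
elim: w p => //= l w IH p /andP[/andP[l0 ln] vw].
rewrite -cat1s word_arrows_cat all_cat IH // andbT.
case: l l0 ln => i [s|] /= l0 ln; last by [].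
have [|a [b [-> pa pb]]] := @word_arrows_sigma p s i; first by rewrite l0.
rewrite /= andbT; apply/eqP => ab /=.
by move: pa; rewrite [a]ab pb; lia.
Qed.

(** Isolates the first regular letter behind its virtual prefix, as the induction on the list of
    arrows requires. *)
Lemma word_split w : all (valid_letter n) w ->
  (exists2 s, in_range n 1 s & w = vw s) \/
  exists s sg p w1, [/\ in_range n 1 s, p.+1 < n, all (valid_letter n) w1 &
    w = vw s ++ [:: sigma sg p.+1] ++ w1].
Proof.
elim: w => [_|[i v] w IH /=]; first by left; exists [::].
case: v => [sg|] /andP[vi vw].
  right; exists [::], sg, i.-1, w; move: vi; rewrite /valid_letter /= => vi.
  by split=> //; rewrite prednK //; lia.
have [[s hs ->]|[s [sg [p [w1 [hs hp hw ->]]]]]] := IH vw.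
  by left; exists (i :: s) => //=; apply/andP; split.
right; exists (i :: s), sg, p, w1; split=> //.
by apply/andP; split.
Qed.

(** Let [s] and [t] be the virtual prefixes before the first regular letters. Both letters cross the
    same two strands, so the first one passes through [u = rev s ++ t] by [weq_sigma] and becomes
    the second. Hence [w] is equivalent to [t], the second letter, and [rev u ++ w1]; the induction
    compares this tail with [w1']. Without arrows the words are virtual and [weq_virtual]
    applies. *)
Lemma weq_arrows (p : 'S_n) w w' : all (valid_letter n) w -> all (valid_letter n) w' ->
  word_arrows p w = word_arrows p w' -> word_perm n w = word_perm n w' ->
  weq n w w'.
Proof.
move: {2}(word_arrows p w) (erefl (word_arrows p w)) => L.
elim: L => [|a L IH] in p w w' *.
  move=> aw va va'; rewrite aw => aw'.
  case: (word_split va) => [[s hs e]|[s [sg [q [w1 [hs hq _ e]]]]]]; last first.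
    move: aw; rewrite e word_arrows_cat word_arrows_virtual word_arrows_cat.
    by have [//|x [y [-> _ _]]] := @word_arrows_sigma (p * word_perm n (vw s)) sg q.+1.
  case: (word_split va') => [[t ht e']|[t [sg [q [w1 [ht hq _ e']]]]]]; last first.
    move: aw'; rewrite e' word_arrows_cat word_arrows_virtual word_arrows_cat.
    by have [//|x [y [-> _ _]]] := @word_arrows_sigma (p * word_perm n (vw t)) sg q.+1.
  by rewrite e e'; exact: weq_virtual.
move=> aw v v' aw'; rewrite aw in aw'.
case: (word_split v) => [[s hs e]|[s [sg [i [w1 [hs hi v1 e]]]]]].
  by move: aw; rewrite e word_arrows_virtual.
case: (word_split v') => [[s' hs' e']|[t [sg' [j [w1' [ht hj v1' e']]]]]].
  by move: aw'; rewrite e' word_arrows_virtual.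
move: aw aw'; rewrite e e' !word_arrows_cat !word_arrows_virtual.
have [//|x [y [-> px py]]] := @word_arrows_sigma (p * word_perm n (vw s))%g sg i.+1.
have [//|x' [y' [-> px' py']]] := @word_arrows_sigma (p * word_perm n (vw t))%g sg' j.+1.
rewrite !word_perm1; case=> axy aL; case=> axy' aL'.
move: axy'; rewrite -axy => -[xx yy ss]; subst x' y' sg'.
pose u := rev s ++ t.
have hu : in_range n 1 u by rewrite in_range_cat in_range_rev.
have wu : word_perm n (vw u) = ((word_perm n (vw s))^-1 * word_perm n (vw t))%g.
  by rewrite vw_cat word_perm_cat word_perm_rev.
have K : weq n ([:: sigma sg i.+1] ++ vw u) (vw u ++ [:: sigma sg j.+1]).
  apply: (@weq_sigma n sg u i j ((p * word_perm n (vw s))%g y) ((p * word_perm n (vw s))%g x)) => //.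
    by rewrite wu !permM permK -permM.
  by rewrite wu !permM permK -permM.
have su : weq n (vw s ++ vw u) (vw t).
  rewrite -vw_cat; apply: weq_virtual => //; first by rewrite in_range_cat hs.
  by rewrite vw_cat word_perm_cat wu mulKVg.
have inv : weq n (vw u ++ vw (rev u)) [::].
  rewrite -vw_cat; apply: (@weq_virtual n _ [::]) => //.
    by rewrite in_range_cat in_range_rev hu.
  by rewrite vw_cat word_perm_cat word_perm_rev mulgV word_perm_nil.
have E : weq n (vw s ++ [:: sigma sg i.+1] ++ w1)
    (vw t ++ [:: sigma sg j.+1] ++ (vw (rev u) ++ w1)).
  apply: (@weq_trans n _ (vw s ++ [:: sigma sg i.+1] ++ (vw u ++ vw (rev u)) ++ w1)).
    by rewrite inv; exact: weq_refl.
  rewrite -!catA (catA [:: sigma sg i.+1]) K -!catA (catA (vw s)) su.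
  exact: weq_refl.
have KP := weq_perm K; rewrite !word_perm_cat !word_perm1 /= in KP.
rewrite (weq_perm E) !word_perm_cat word_perm1 /= => W.
apply: weq_trans E _.
suff -> : weq n (vw (rev u) ++ w1) w1' by exact: weq_refl.
have AU : word_arrows (p * word_perm n (vw t) * adj_swap n j.+1)%g
    (vw (rev u) ++ w1) = L.
  rewrite word_arrows_cat word_arrows_virtual /= word_perm_rev -aL.
  have -> : word_perm n (vw t) = (word_perm n (vw s) * word_perm n (vw u))%g.
    by rewrite wu mulKVg.
  by rewrite -!mulgA (mulgA (word_perm n (vw u))) -KP mulgK.
apply: (IH _ _ _ AU) => //; last by rewrite word_perm_cat; move: W => /mulgI/mulgI.
- by rewrite all_cat v1 andbT; apply: (@in_range_valid n 1) => //; rewrite in_range_rev.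
- by rewrite AU.
Qed.

Lemma adj_swap_id i (k : 'I_n) : k != i.-1 :> nat -> k != i :> nat ->
  adj_swap n i k = k.
Proof.
by move=> /negbTE h1 /negbTE h2; apply: ord_inj; rewrite adj_swapE h1 h2; case: ifP.
Qed.

(** Provides an arrangement in which chosen strands occupy the lowest positions in a prescribed
    order. *)
Lemma exists_perm_index (l : seq 'I_n) : uniq l ->
  exists p : 'S_n, forall x, x \in l -> p x = index x l :> nat.
Proof.
move=> ul; pose r := l ++ [seq x <- enum 'I_n | x \notin l].
have mr x : x \in r.
  by rewrite mem_cat mem_filter mem_enum andbT; case: (x \in l).
have ur : uniq r.
  rewrite cat_uniq ul filter_uniq ?enum_uniq // andbT /=.
  by apply/hasPn => x; rewrite mem_filter => /andP[].
have sr : size r = n.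
  have := card_uniqP ur => <-; apply: etrans (card_ord n).
  by apply: eq_card => x; rewrite mr.
have hi x : index x r < n by rewrite -{2}sr index_mem.
have inj : injective (fun x => Ordinal (hi x)).
  by move=> x y [/(congr1 (nth x r))]; rewrite !nth_index.
exists (perm inj) => x xl.
by rewrite permE /= /r index_cat xl.
Qed.

Lemma virtual_word_perm (p : 'S_n) :
  exists2 s, in_range n 1 s & word_perm n (vw s) = p.
Proof.
suff main k (q : 'S_n) : k <= n -> exists2 s, in_range n 1 s &
    forall i : 'I_n, i < k -> word_perm n (vw s) (q i) = i.
  have [s hs h] := main n p^-1%g (leqnn n).
  exists s => //; apply/permP => i.
  by rewrite -{1}(permK p i) h ?ltn_ord.
elim: k => [|k IH] kn; first by exists [::].
have [s hs h] := IH (ltnW kn).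
pose x := word_perm n (vw s) (q (Ordinal kn)).
have kx : k <= x.
  rewrite leqNgt; apply/negP => xk; have := h _ xk.
  by move/perm_inj/perm_inj/(congr1 val) => /= e; move: xk; rewrite e ltnn.
pose t := iota k.+1 (x - k).
have ht : in_range n k.+1 t.
  by rewrite /in_range; apply/allP => j; rewrite mem_iota; have := ltn_ord x; lia.
have tk : word_perm n (vw t) (Ordinal kn) = x.
  apply: ord_inj; rewrite word_perm_iota //= ?eqxx; first by lia.
  by have := ltn_ord x; lia.
exists (s ++ rev t).
  rewrite in_range_cat hs in_range_rev //.
  by apply: sub_all ht => j; lia.
move=> i; rewrite vw_cat word_perm_cat permM word_perm_rev ltnS => ik.
apply: (@perm_inj _ (word_perm n (vw t))); rewrite permKV.
move: ik; rewrite leq_eqVlt => /orP[/eqP ik|ik].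
  by have -> : i = Ordinal kn by apply: ord_inj.
rewrite h // (@word_perm_fix n k.-1) //; last by lia.
by move: ht; rewrite prednK //; lia.
Qed.

(** Before each arrow a virtual word brings its two strands to positions 0 and 1, where the letter 1
    crosses them; a last virtual word corrects the permutation. *)
Lemma word_of_arrows L (p r : 'S_n) : all proper_arrow L ->
  exists w, [/\ all (valid_letter n) w, word_arrows p w = L &
    (p * word_perm n w)%g = r].
Proof.
elim: L p => [|[[x y] sg] L IH] p /=.
  have [s hs e] := virtual_word_perm (p^-1 * r)%g => _.
  exists (vw s); split; first exact: in_range_valid hs.
    exact: word_arrows_virtual.
  by rewrite e mulKVg.
rewrite /proper_arrow /= => /andP[xy hL].
have [|q hq] := @exists_perm_index [:: y; x].
  by rewrite /= inE eq_sym andbT.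
have qy : q y = 0 :> nat by rewrite hq ?inE ?eqxx //= eqxx.
have qx : q x = 1 :> nat.
  by rewrite hq ?inE ?eqxx ?orbT //= eqxx eq_sym (negbTE xy).
have n1 : 1 < n by have := ltn_ord (q x); rewrite qx.
have [s hs e] := virtual_word_perm (p^-1 * q)%g.
have [w [va aw pw]] := IH (q * adj_swap n 1)%g hL.
exists (vw s ++ [:: sigma sg 1] ++ w); split.
- by rewrite !all_cat (in_range_valid _ hs) //= /valid_letter /= n1.
- rewrite word_arrows_cat word_arrows_virtual word_arrows_cat e mulKVg.
  by rewrite word_perm1 aw /word_arrows /= (@event_sigma _ _ _ x y).
- by rewrite !word_perm_cat e word_perm1 !mulgA mulgV mul1g.
Qed.


Definition disjoint_arrows (a b : arrow_data) : bool :=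
  [&& a.1.1 != b.1.1, a.1.1 != b.1.2, a.1.2 != b.1.1 & a.1.2 != b.1.2].

(** With the four strands brought to the positions 0 to 3, the arrows [a] and [b] become the letters
    1 and 3, which commute. The words [W] and [W'] so obtained have the arrows of [w] and [w'], so
    [weq_arrows] identifies them with these. *)
Lemma weq_swap_arrows (p : 'S_n) w w' L1 a b L2 :
  all (valid_letter n) w -> all (valid_letter n) w' -> disjoint_arrows a b ->
  word_arrows p w = L1 ++ [:: a; b] ++ L2 ->
  word_arrows p w' = L1 ++ [:: b; a] ++ L2 ->
  word_perm n w = word_perm n w' -> weq n w w'.
Proof.
move=> va va' ab aw aw' ww'.
have := word_arrows_proper p va; rewrite aw !all_cat /= andbT.
case: a b => [[a1 a2] sa] [[b1 b2] sb] in ab aw aw' *.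
move: ab; rewrite /disjoint_arrows /proper_arrow /=.
move=> /and4P[ab1 ab2 ab3 ab4] /and3P[pL1 /andP[pa pb] pL2].
have [|q hq] := @exists_perm_index [:: a2; a1; b2; b1].
  by rewrite /= !inE !negb_or ab1 ab2 ab3 ab4 eq_sym pa eq_sym pb.
have q0 : q a2 = 0 :> nat by rewrite hq ?inE ?eqxx //= eqxx.
have q1 : q a1 = 1 :> nat.
  by rewrite hq ?inE ?eqxx ?orbT //= eqxx eq_sym (negbTE pa).
have q2 : q b2 = 2 :> nat.
  by rewrite hq ?inE ?eqxx ?orbT //= eqxx (negbTE ab4) (negbTE ab2).
have q3 : q b1 = 3 :> nat.
  rewrite hq ?inE ?eqxx ?orbT //= eqxx (negbTE ab3) (negbTE ab1).
  by rewrite eq_sym (negbTE pb).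
have n3 : 3 < n by have := ltn_ord (q b1); rewrite q3.
have [w1 [v1 aw1 pw1]] := word_of_arrows p q pL1.
have far : (adj_swap n 1 * adj_swap n 3 = adj_swap n 3 * adj_swap n 1)%g.
  exact: adj_swap_far.
have [w2 [v2 aw2 pw2]] := word_of_arrows (q * (adj_swap n 1 * adj_swap n 3))%g
  (p * word_perm n w)%g pL2.
pose W := w1 ++ ([:: sigma sa 1] ++ [:: sigma sb 3]) ++ w2.
pose W' := w1 ++ ([:: sigma sb 3] ++ [:: sigma sa 1]) ++ w2.
have aW : word_arrows p W = L1 ++ [:: (a1, a2, sa); (b1, b2, sb)] ++ L2.
  rewrite /W !word_arrows_cat aw1 pw1 !word_perm_cat !word_perm1 /= mulgA.
  rewrite -mulgA aw2 /word_arrows /= (@event_sigma _ _ _ a1 a2) //.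
  by rewrite (@event_sigma _ _ _ b1 b2) ?permM ?adj_swap_id ?q2 ?q3.
have aW' : word_arrows p W' = L1 ++ [:: (b1, b2, sb); (a1, a2, sa)] ++ L2.
  rewrite /W' !word_arrows_cat aw1 pw1 !word_perm_cat !word_perm1 /= -far.
  rewrite aw2 /word_arrows /= (@event_sigma _ _ _ b1 b2) //.
  by rewrite (@event_sigma _ _ _ a1 a2) ?permM ?adj_swap_id ?q0 ?q1.
have PW : word_perm n W = word_perm n w.
  apply: (mulgI p); rewrite -pw2 /W !word_perm_cat !word_perm1 /=.
  by rewrite mulgA pw1 mulgA.
have WW' : weq n W W'.
  rewrite /W /W' (@weq_far n (sigma sa 1) (sigma sb 3)) //; first exact: weq_refl.
    by rewrite /valid_letter /= ?(leq_trans _ n3).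
have vW : all (valid_letter n) W.
  by rewrite !all_cat v1 v2 /= /valid_letter /= ?n3 ?(leq_trans _ n3).
have vW' : all (valid_letter n) W'.
  by rewrite !all_cat v1 v2 /= /valid_letter /= ?n3 ?(leq_trans _ n3).
apply: weq_trans (@weq_arrows p _ _ va vW _ _) _ => //; first by rewrite aw aW.
apply: (weq_trans WW' (@weq_arrows p _ _ vW' va' _ _)); first by rewrite aw' aW'.
by rewrite -(weq_perm WW') PW.
Qed.

Lemma weq_move_arrow (p : 'S_n) w w' L1 P a L2 :
  all (valid_letter n) w -> all (valid_letter n) w' -> all (disjoint_arrows a) P ->
  word_arrows p w = L1 ++ P ++ a :: L2 ->
  word_arrows p w' = L1 ++ a :: P ++ L2 ->
  word_perm n w = word_perm n w' -> weq n w w'.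
Proof.
elim/last_ind: P => [|P b IH] in w L2 *.
  by move=> va va' _ aw aw'; apply: (@weq_arrows p) => //; rewrite aw aw'.
move=> va va'; rewrite all_rcons => /andP[ab aP] aw aw' ww'.
rewrite cat_rcons in aw aw'.
have [|w3 [v3 aw3 pw3]] := @word_of_arrows (L1 ++ P ++ a :: b :: L2) p (p * word_perm n w)%g.
  have := word_arrows_proper p va; rewrite aw !all_cat /=.
  by case/and5P => -> -> -> -> ->.
have {}pw3 : word_perm n w3 = word_perm n w by apply: (mulgI p).
apply: (@weq_trans n _ w3).
  apply: (@weq_swap_arrows p w w3 (L1 ++ P) b a L2) => //; rewrite -?catA //.
  by move: ab => /and4P[h1 h2 h3 h4]; apply/and4P; split; rewrite eq_sym.
by apply: (IH w3 (b :: L2)); rewrite ?pw3 // aw' cat_rcons.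
Qed.

Definition touches (k : 'I_n) (a : arrow_data) : bool :=
  (k == a.1.1) || (k == a.1.2).

Lemma filter_eq_cons (T : Type) (f : pred T) l (x : T) r : seq.filter f l = x :: r ->
  exists P S, [/\ l = P ++ x :: S, ~~ has f P & seq.filter f S = r].
Proof.
elim: l => //= y l IH; case: ifP => [fy [<- <-]|fy /IH[P [S [-> hP hS]]]].
  by exists [::], l.
by exists (y :: P), S; split=> //=; rewrite fy.
Qed.

(* The first arrow of the one word can be moved to the front in the other. *)
Lemma weq_projections (p : 'S_n) w w' :
  all (valid_letter n) w -> all (valid_letter n) w' ->
  word_perm n w = word_perm n w' ->
  (forall k, seq.filter (touches k) (word_arrows p w) =
             seq.filter (touches k) (word_arrows p w')) -> weq n w w'.
Proof.
suff main L : forall L' P0 w w', all (valid_letter n) w -> all (valid_letter n) w' ->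
    word_perm n w = word_perm n w' ->
    word_arrows p w = P0 ++ L -> word_arrows p w' = P0 ++ L' ->
    (forall k, seq.filter (touches k) L = seq.filter (touches k) L') -> weq n w w'.
  by move=> va va' ww' h; apply: (main _ _ [::] w w' va va' ww' erefl erefl h).
elim: L => [|a L IH] L' P0 {}w {}w' va va' ww' aw aw' h.
  case: L' => [|b L'] in aw' h *.
    by apply: (@weq_arrows p) => //; rewrite aw aw'.
  by have := h b.1.1; rewrite /= /touches eqxx.
have t1 : touches a.1.1 a by rewrite /touches eqxx.
have t2 : touches a.1.2 a by rewrite /touches eqxx orbT.
have := h a.1.1; rewrite /= t1 => /esym e1.
have [P [S [eL hP hS]]] := filter_eq_cons e1.
(* By the projection to [a.1.2], the first arrow of [P] on that strand would be [a], but [a] also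
   lies on [a.1.1], which [P] avoids. *)
have hP2 : ~~ has (touches a.1.2) P.
  have := h a.1.2; rewrite /= t2 eL filter_cat.
  case E: (seq.filter _ P) => [|b R].
    by rewrite has_count -size_filter E.
  have [P1 [P2 [eP _ _]]] := filter_eq_cons E.
  by move=> [ab _]; move: hP; rewrite eP has_cat /= -ab t1 orbT.
have [|w3 [v3 aw3 pw3]] := @word_of_arrows (P0 ++ a :: P ++ S) p (p * word_perm n w)%g.
  have := word_arrows_proper p va'; rewrite aw' eL !all_cat /= !all_cat.
  by case/and4P => -> -> -> ->.
have {}pw3 : word_perm n w3 = word_perm n w by apply: (mulgI p).
apply: (@weq_trans n _ w3); last first.
  apply: weq_sym; apply: (@weq_move_arrow p w' w3 P0 P a S) => //.
  - move: hP hP2; rewrite -!all_predC => hP hP2.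
    have : all (predI (predC (touches a.1.1)) (predC (touches a.1.2))) P.
      by rewrite all_predI hP.
    apply: sub_all => b /=; rewrite /touches /disjoint_arrows !negb_or.
    by move=> /andP[/andP[-> ->] /andP[-> ->]].
  - by rewrite aw' eL.
  - by rewrite pw3.
apply: (IH (P ++ S) (rcons P0 a)) => //; rewrite ?cat_rcons //.
have nil f : ~~ has f P -> seq.filter f P = [::].
  by move=> hf; apply: size0nil; rewrite size_filter; move: hf; rewrite has_count; lia.
move=> k; have := h k; rewrite eL /= !filter_cat /=.
case: ifP => // /orP[/eqP -> {k}|/eqP -> {k}]; first by rewrite nil // => -[].
by rewrite (nil _ hP2) // => -[].
Qed.

End WordArrows.

(** * Continuous functions on the unit interval *)

Section RealFunctions.
Variable R : realType.
Local Open Scope classical_set_scope.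
Local Open Scope ring_scope.
Implicit Types (t a b : R) (f g : R -> R).

Lemma I01E t : I01 t <-> 0 <= t <= 1.
Proof. by rewrite /I01 /= in_itv. Qed.

(** The retraction of the line onto [I01]: composing with it turns continuity within [I01] into
    continuity everywhere, and neighbourhoods need no side condition. *)
Definition clamp t : R := Num.max 0 (Num.min t 1).

Lemma clamp_I01 t : I01 (clamp t).
Proof.
rewrite I01E /clamp le_max lexx /= ge_max ler01 /=.
by rewrite ge_min lexx orbT.
Qed.

Lemma clamp_id t : 0 <= t <= 1 -> clamp t = t.
Proof. by case/andP=> t0 t1; rewrite /clamp (min_idPl t1) (max_idPr t0). Qed.

Lemma clamp_le0 t : t <= 0 -> clamp t = 0.
Proof.
move=> t0; rewrite /clamp; apply/max_idPl.
by rewrite ge_min t0.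
Qed.

Lemma clamp_ge1 t : 1 <= t -> clamp t = 1.
Proof. by move=> t1; rewrite /clamp (min_idPr t1); apply/max_idPr. Qed.

Lemma continuous_clamp : continuous clamp.
Proof.
move=> t; apply: (@continuous_max R R (cst 0) (fun t => Num.min t 1)).
  exact: cst_continuous.
apply: (@continuous_min R R id (cst 1)); first exact: cvg_id.
exact: cst_continuous.
Qed.

Lemma within_clamp (T : topologicalType) (f : R -> T) :
  {within I01, continuous f} -> continuous (f \o clamp).
Proof.
move=> /subspace_continuousP cf t.
apply: cvg_comp (cf _ (clamp_I01 t)).
move=> A hA; have := continuous_clamp hA.
rewrite !nbhs_filterE; apply: (@filterS _ (nbhs t)) => s /= h.
by apply: h; exact: clamp_I01.
Qed.

Lemma clamp_within (T : topologicalType) (f : R -> T) :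
  continuous (f \o clamp) -> {within I01, continuous f}.
Proof.
move=> cf; apply: (@subspace_eq_continuous _ _ _ (f \o clamp)).
  by move=> t; rewrite inE => /I01E h; rewrite /= clamp_id.
exact: continuous_subspaceT.
Qed.

(** By the intermediate value theorem. Applied to differences of heights, or of crossing times, it
    says that an order can change only at a coincidence. *)
Lemma nonzero_pos f a b : a <= b -> continuous f ->
  (forall t, a <= t <= b -> f t != 0) -> (0 < f a) = (0 < f b).
Proof.
move=> ab cf nz.
have cab : {within `[a, b], continuous f} by exact: continuous_subspaceT.
have hab : ~ (Num.min (f a) (f b) <= 0 <= Num.max (f a) (f b)).
  move=> h; have [c cin fc] := IVT ab cab h.
  by move: cin; rewrite in_itv /= => /nz; rewrite fc eqxx.
have nza : f a != 0 by apply: nz; rewrite lexx.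
have nzb : f b != 0 by apply: nz; rewrite lexx andbT.
move: nza nzb; rewrite !neq_lt => /orP[fa|fa] /orP[fb|fb].
- by rewrite !ltNge !ltW.
- by exfalso; apply: hab; rewrite ge_min le_max (ltW fa) (ltW fb) ?orbT.
- by exfalso; apply: hab; rewrite ge_min le_max (ltW fa) (ltW fb) ?orbT.
- by rewrite fa fb.
Qed.

(** Connectedness of [I01], through a function [g] with values -1 and 1 that records whether [f] has
    its initial value: it is locally constant, hence continuous, and never vanishes, so its sign is
    constant. *)
Lemma locally_constant (T : Type) (f : R -> T) :
  (forall s, I01 s -> \forall s' \near s, I01 s' -> f s' = f s) ->
  forall s, I01 s -> f s = f 0.
Proof.
move=> lc s Is; apply: contrapT => ne.
pose g t : R := if `[< f (clamp t) = f 0 >] then -1 else 1.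
have cg : continuous g.
  move=> t; apply: (@near_cst_continuous _ _ (g t)).
  have h : nbhs t (clamp @^-1` [set s' | I01 s' -> f s' = f (clamp t)]).
    exact: continuous_clamp (lc _ (clamp_I01 t)).
  apply: (@filterS _ (nbhs t)) h => s' /= h.
  by rewrite /g h //; exact: clamp_I01.
have nz t : g t != 0.
  by rewrite /g; case: ifP => _; rewrite ?oppr_eq0 oner_eq0.
have s0 : 0 <= s by case/I01E/andP: Is.
have := nonzero_pos s0 cg (fun t _ => nz t).
have cs : clamp s = s by apply: clamp_id; apply/I01E.
have c0 : clamp 0 = 0 by apply: clamp_le0.
rewrite /g cs c0 asboolT // asboolF // ltr01 ltr0N1 //.
Qed.

Lemma near_leftP t (P : R -> Prop) :
  (\forall s \near t^'-, P s) <-> exists2 a, a < t & forall s, a < s < t -> P s.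
Proof.
split=> [|[a at_ h]].
  rewrite near_withinE => /nbhs_ballP[e /= e0 h].
  exists (t - e); first by rewrite ltrBlDr ltrDl.
  move=> s /andP[h1 h2]; apply: h => //.
  by rewrite /ball /= ger0_norm ?subr_ge0 ?ltW // ltrBlDr -ltrBlDl.
near=> s; apply: h; apply/andP; split; near: s; first exact: nbhs_left_gt.
exact: nbhs_left_lt.
Unshelve. all: by end_near. Qed.

Lemma near_rightP t (P : R -> Prop) :
  (\forall s \near t^'+, P s) <-> exists2 b, t < b & forall s, t < s < b -> P s.
Proof.
split=> [|[a at_ h]].
  rewrite near_withinE => /nbhs_ballP[e /= e0 h].
  exists (t + e); first by rewrite ltrDl.
  move=> s /andP[h1 h2]; apply: h => //.
  by rewrite /ball /= distrC ger0_norm ?subr_ge0 ?ltW // ltrBlDl.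
near=> s; apply: h; apply/andP; split; near: s; first exact: nbhs_right_gt.
exact: nbhs_right_lt.
Unshelve. all: by end_near. Qed.

End RealFunctions.

(** * Reparametrizations *)

Section PiecewiseLinear.
Variable R : realType.
Local Open Scope classical_set_scope.
Local Open Scope ring_scope.
Implicit Types (t a b : R) (x y : nat -> R).

Definition ramp a b t : R := clamp ((t - a) / (b - a)).

Lemma ramp_le a b t : a < b -> t <= a -> ramp a b t = 0.
Proof.
move=> ab ta; rewrite /ramp clamp_le0 //.
by rewrite ler_pdivrMr ?subr_gt0 // mul0r subr_le0.
Qed.

Lemma ramp_ge a b t : a < b -> b <= t -> ramp a b t = 1.
Proof.
move=> ab tb; rewrite /ramp clamp_ge1 //.
by rewrite ler_pdivlMr ?subr_gt0 // mul1r lerD2r.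
Qed.

Lemma ramp_in a b t : a < b -> a <= t <= b -> ramp a b t = (t - a) / (b - a).
Proof.
move=> ab /andP[at_ tb]; rewrite /ramp clamp_id //.
by rewrite ler_pdivrMr ?subr_gt0 // ler_pdivlMr ?subr_gt0 // mul0r mul1r subr_ge0 at_ lerD2r.
Qed.

Lemma clamp_mono (s t : R) : s <= t -> clamp s <= clamp t.
Proof.
move=> st; have h : Num.min s 1 <= Num.min t 1.
  by rewrite le_min !ge_min lexx st orbT.
by rewrite /clamp ge_max !le_max lexx h orbT.
Qed.

Lemma ramp_mono a b s t : a < b -> s <= t -> ramp a b s <= ramp a b t.
Proof.
move=> ab st; apply: clamp_mono.
by rewrite ler_pM2r ?invr_gt0 ?subr_gt0 // lerD2r.
Qed.

Lemma cvg_ramp (T : Type) (F : set_system T) (FF : Filter F) (a b t : T -> R)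
    (la lb lt : R) : la != lb -> a @ F --> la -> b @ F --> lb -> t @ F --> lt ->
  ramp (a z) (b z) (t z) @[z --> F] --> ramp la lb lt.
Proof.
move=> ab ha hb ht; apply: (@cvg_comp _ _ _ (fun z => (t z - a z) / (b z - a z)) (@clamp R)).
  2: exact: continuous_clamp.
apply: cvgM; first exact: cvgB.
by apply: cvgV; [rewrite subr_eq0 eq_sym|exact: cvgB].
Qed.

(** The piecewise linear function through the points [(x r, y r)]. As a sum of ramps it is visibly
    continuous in the nodes as well as in [t]. *)
Definition pl (N : nat) x y t : R :=
  y 0%N + \sum_(r < N) (y r.+1 - y r) * ramp (x r) (x r.+1) t.

Definition increasing_upto (N : nat) x : Prop :=
  forall r, (r < N)%N -> x r < x r.+1.

Lemma increasing_le N x r q : increasing_upto N x -> (r <= q <= N)%N -> x r <= x q.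
Proof.
move=> hx; elim: q => [|q IH] /andP[rq qN]; first by move: rq; rewrite leqn0 => /eqP ->.
move: rq; rewrite leq_eqVlt => /orP[/eqP -> //|rq].
by apply: le_trans (ltW (hx _ qN)); apply: IH; lia.
Qed.

Lemma increasing_lt N x r q : increasing_upto N x -> (r < q <= N)%N -> x r < x q.
Proof.
move=> hx /andP[rq qN]; apply: lt_le_trans (hx r _) _; first by lia.
by apply: (increasing_le hx); lia.
Qed.

Lemma increasing_upto_leq N M x : (M <= N)%N -> increasing_upto N x -> increasing_upto M x.
Proof. by move=> MN hx r rM; apply: hx; lia. Qed.

Lemma pl_recr N x y t :
  pl N.+1 x y t = pl N x y t + (y N.+1 - y N) * ramp (x N) (x N.+1) t.
Proof. by rewrite /pl big_ord_recr /= addrA. Qed.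

Lemma pl_ge N x y t : increasing_upto N x -> x N <= t -> pl N x y t = y N.
Proof.
elim: N => [|N IH] hx xt; first by rewrite /pl big_ord0 addr0.
rewrite pl_recr IH; last 2 first.
- exact: increasing_upto_leq hx.
- by apply: le_trans xt; apply/ltW/hx.
by rewrite ramp_ge ?hx // mulr1 addrC subrK.
Qed.

Lemma pl_piece N x y r t : increasing_upto N x -> (r < N)%N -> x r <= t <= x r.+1 ->
  pl N x y t = y r + (y r.+1 - y r) * ((t - x r) / (x r.+1 - x r)).
Proof.
elim: N => [//|N IH] hx rN xt; rewrite pl_recr.
have hx' := increasing_upto_leq (leqnSn N) hx.
move: rN; rewrite ltnS leq_eqVlt => /orP[/eqP rN|rN].
  subst r; case/andP: (xt) => h _.
  by rewrite pl_ge // ramp_in // hx.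
rewrite IH // ramp_le ?mulr0 ?addr0 ?hx //.
by case/andP: xt => _ h; apply: le_trans h _; apply: (increasing_le hx'); lia.
Qed.

Lemma pl_node N x y r : increasing_upto N x -> (r <= N)%N -> pl N x y (x r) = y r.
Proof.
move=> hx; rewrite leq_eqVlt => /orP[/eqP ->|rN]; first exact: pl_ge.
by rewrite (pl_piece _ hx rN) ?lexx ?ltW ?hx // subrr mul0r mulr0 addr0.
Qed.

Lemma locate_lt N x t : x 0%N <= t < x N ->
  exists2 r, (r < N)%N & x r <= t < x r.+1.
Proof.
elim: N => [|N IH] /andP[h0 hN]; first by move: (le_lt_trans h0 hN); rewrite ltxx.
case: (ltP t (x N)) => h; last by exists N; rewrite // h hN.
by have [|r rN hr] := IH; [rewrite h0 h|exists r => //; lia].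
Qed.

Lemma locate N x t : (0 < N)%N -> x 0%N <= t <= x N ->
  exists2 r, (r < N)%N & x r <= t <= x r.+1.
Proof.
move=> N0 /andP[h0]; rewrite le_eqVlt => /orP[/eqP hN|hN]; last first.
  have [|r rN /andP[h1 h2]] := @locate_lt N x t; first by rewrite h0.
  by exists r; rewrite // h1 ltW.
case: (lerP (x N.-1) t) => h; first by exists N.-1; rewrite ?prednK // h hN lexx.
have [|r rN /andP[h1 h2]] := @locate_lt N.-1 x t; first by rewrite h0.
by exists r; [lia|rewrite h1 ltW].
Qed.

Lemma pl_lt N x y s t : increasing_upto N x -> increasing_upto N y ->
  x 0%N <= s -> s < t -> t <= x N -> pl N x y s < pl N x y t.
Proof.
move=> hx hy hs st ht.
have [|r rN /andP[h1 h2]] := @locate_lt N x s; first by rewrite hs (lt_le_trans st).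
apply: (@lt_le_trans _ _ (pl N x y (Num.min t (x r.+1)))).
  have stt : s < Num.min t (x r.+1) by rewrite lt_min st h2.
  rewrite (pl_piece _ hx rN); last by rewrite h1 ltW.
  rewrite (pl_piece _ hx rN); last first.
    by rewrite (le_trans h1 (ltW stt)) ge_min lexx orbT.
  rewrite ltrD2l ltr_pM2l ?subr_gt0 ?hy //.
  by rewrite ltr_pM2r ?invr_gt0 ?subr_gt0 ?hx // ltrD2r.
rewrite /pl lerD2l; apply: ler_sum => q _.
rewrite ler_pM2l ?subr_gt0 ?hy //; apply: ramp_mono; first exact: hx.
by rewrite ge_min lexx.
Qed.

Lemma pl_id N x t : increasing_upto N x -> x 0%N <= t <= x N -> pl N x x t = t.
Proof.
case: N => [|N] hx ht.
  by rewrite /pl big_ord0 addr0; apply/eqP; rewrite eq_le.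
have [r rN hr] := locate (ltn0Sn N) ht.
have d0 : x r.+1 - x r != 0 by rewrite subr_eq0 gt_eqF // hx.
by rewrite (pl_piece _ hx rN hr) mulrCA divff // mulr1 addrC subrK.
Qed.

(** The nodes vary too, because the crossing times move during an isotopy. *)
Lemma cvg_pl (T : Type) (F : set_system T) (FF : Filter F) (N : nat)
    (x y : nat -> T -> R) (t : T -> R) (lx ly : nat -> R) (lt : R) :
  increasing_upto N lx -> (forall r, (r <= N)%N -> x r @ F --> lx r) ->
  (forall r, (r <= N)%N -> y r @ F --> ly r) -> t @ F --> lt ->
  pl N (x^~ z) (y^~ z) (t z) @[z --> F] --> pl N lx ly lt.
Proof.
move=> hx cx cy ct; rewrite /pl; apply: cvgD; first exact: cy.
have cadd : continuous (fun u : R * R => u.1 + u.2).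
  by move=> u; apply: cvgD; [exact: cvg_fst|exact: cvg_snd].
apply: (@cvg_big R _ +%R 0 xpredT cadd T F _
  (fun (r : 'I_N) z => (y r.+1 z - y r z) * ramp (x r z) (x r.+1 z) (t z))) => r _.
apply: cvgM; first by apply: cvgB; apply: cy => //; exact: ltnW.
apply: cvg_ramp => //; [|by apply: cx; exact: ltnW|exact: cx].
by rewrite lt_eqF // hx.
Qed.

Lemma increasing_homeo (h : R -> R) : continuous h -> h 0 = 0 -> h 1 = 1 ->
  (forall s t, 0 <= s -> s < t -> t <= 1 -> h s < h t) -> oriented_homeo h.
Proof.
move=> ch h0 h1 mono; split.
- exact: continuous_subspaceT.
- split.
  + move=> t /I01E/andP[t0 t1]; apply/I01E; apply/andP; split.
      by move: t0; rewrite le_eqVlt => /orP[/eqP <-|t0]; rewrite ?h0 // -h0 ltW // mono.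
    by move: t1; rewrite le_eqVlt => /orP[/eqP ->|t1]; rewrite ?h1 // -h1 ltW // mono.
  + move=> s t; rewrite !inE => /I01E/andP[s0 s1] /I01E/andP[t0 t1] e.
    by case: (ltgtP s t) => // st; [have := mono _ _ s0 st t1|have := mono _ _ t0 st s1];
      rewrite e ltxx.
  + move=> v /I01E/andP[v0 v1].
    have c01 : {within `[0, 1], continuous h} by exact: continuous_subspaceT.
    have [|c cin <-] := @IVT R h 0 1 v ler01 c01.
      by rewrite h0 h1 ge_min le_max v0 v1 orbT.
    by exists c.
- by move=> s t /I01E/andP[s0 _] /I01E/andP[_ t1] st; apply: mono.
Qed.

Lemma extend_homeo (s : seq R) (f : R -> R) :
  (forall t, t \in s -> 0 < t < 1 /\ 0 < f t < 1) ->
  (forall t u, t \in s -> u \in s -> t < u -> f t < f u) ->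
  exists2 h, oriented_homeo h & forall t, t \in s -> h t = f t.
Proof.
move=> hs hf; pose s' := sort <=%R (undup s).
have ms t : (t \in s') = (t \in s) by rewrite mem_sort mem_undup.
have so : sorted <%R s'.
  rewrite lt_sorted_uniq_le sort_uniq undup_uniq /=.
  exact: (sort_sorted (@le_total _ R)).
pose N := size s'.
have sN : size s' = N by [].
(* The endpoints 0 and 1 are added as nodes, the latter as the default value of [nth] at index
   [N.+1]. *)
pose x r := nth 1 (0 :: s') r; pose y r := nth 1 (0 :: map f s') r.
have hx : increasing_upto N.+1 x.
  move=> r; rewrite ltnS leq_eqVlt => /orP[/eqP ->|rN].
    rewrite /x [X in _ < X]nth_default //=.
    case E : N => [|M] /=; first exact: ltr01.
    have /hs[/andP[]//] : nth 1 s' M \in s by rewrite -ms mem_nth // sN E.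
  case: r rN => [|r] rN.
    by rewrite /x /=; have /hs[/andP[]//] : nth 1 s' 0 \in s by rewrite -ms mem_nth.
  by rewrite /x /=; apply: (sorted_ltn_nth lt_trans) => //; rewrite inE sN; lia.
have fs' r : (r < N)%N -> nth 1 (map f s') r = f (nth 1 s' r).
  by move=> rN; rewrite (nth_map 1).
have hy : increasing_upto N.+1 y.
  move=> r; rewrite ltnS leq_eqVlt => /orP[/eqP ->|rN].
    rewrite /y [X in _ < X]nth_default //= ?size_map //.
    case E : N => [|M] /=; first exact: ltr01.
    rewrite fs' ?E //.
    have /hs[_ /andP[]//] : nth 1 s' M \in s by rewrite -ms mem_nth // sN E.
  case: r rN => [|r] rN.
    rewrite /y /= fs' //.
    by have /hs[_ /andP[]//] : nth 1 s' 0 \in s by rewrite -ms mem_nth.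
  rewrite /y /= !fs' //; last by lia.
  apply: hf; rewrite -?ms ?mem_nth ?sN //; first by lia.
  by apply: (sorted_ltn_nth lt_trans) => //; rewrite inE sN; lia.
have x1 : x N.+1 = 1 by rewrite /x nth_default.
have y1 : y N.+1 = 1 by rewrite /y nth_default //= size_map.
exists (pl N.+1 x y).
  apply: increasing_homeo.
  - move=> t; apply: (@cvg_pl R (nbhs t) _ N.+1 (fun r _ => x r) (fun r _ => y r) id) => //.
    + by move=> r _; exact: cvg_cst.
    + by move=> r _; exact: cvg_cst.
  - by rewrite -[X in pl _ _ _ X]/(x 0%N) pl_node.
  - by rewrite -x1 pl_node // y1.
  - by move=> u t u0 ut t1; apply: pl_lt => //; rewrite x1.
move=> t; rewrite -ms => ts; pose r := index t s'.
have rN : (r < N)%N by rewrite index_mem.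
have -> : t = x r.+1 by rewrite /x /= nth_index.
by rewrite pl_node ?(leqW rN) //; exact: fs'.
Qed.

End PiecewiseLinear.

(** * Equality of Gauss diagrams is an equivalence relation *)

Section GaussEquivalence.
Variables (R : realType) (n : nat).
Local Open Scope classical_set_scope.
Local Open Scope ring_scope.
Implicit Types (g : gauss_diagram R n) (k : 'I_n) (t : R).

Definition arrow_time g k t : Prop := exists2 a, arrows g a & arrow_ends a (k, t).

Lemma arrow_endsP (a : arrow R n) k t : arrow_ends a (k, t) <->
  (k = tail_interval a /\ t = tail_point a) \/
  (k = head_interval a /\ t = head_point a).
Proof.
split=> [[/= [-> ->]|/= [-> ->]]|[[-> ->]|[-> ->]]]; by [left|right].
Qed.

Lemma arrow_ends_tail (a : arrow R n) : arrow_ends a (tail_interval a, tail_point a).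
Proof. by left. Qed.

Lemma arrow_ends_head (a : arrow R n) : arrow_ends a (head_interval a, head_point a).
Proof. by right. Qed.

Lemma arrow_time_interior g k t : arrow_time g k t -> 0 < t < 1.
Proof. by case=> a /arrows_interior[h1 h2] /arrow_endsP[[_ ->]|[_ ->]]. Qed.

Lemma finite_arrow_times g k : exists s : seq R, forall t, t \in s <-> arrow_time g k t.
Proof.
have /finite_seqP[s hs] : finite_set [set t | arrow_time g k t].
  apply: (@sub_finite_set _ _ ((@tail_point R n) @` arrows g `|` (@head_point R n) @` arrows g)).
    by move=> t [a ga /arrow_endsP[[_ ->]|[_ ->]]]; [left|right]; exists a.
  by rewrite finite_setU; split; apply: finite_image; exact: arrows_finite.
by exists s => t; rewrite -[arrow_time g k t]/([set t | arrow_time g k t] t) hs.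
Qed.

(** Each interval carries finitely many arrow ends, so a map that is increasing on these already
    extends to an oriented homeomorphism. All equalities of Gauss diagrams that move arrow ends are
    obtained in this way. *)
Lemma gauss_equiv_increasing g g' (f : 'I_n -> R -> R) :
  gauss_perm g = gauss_perm g' ->
  (forall k t, arrow_time g k t -> 0 < f k t < 1) ->
  (forall k s t, arrow_time g k s -> arrow_time g k t -> s < t -> f k s < f k t) ->
  map_arrow f @` arrows g = arrows g' -> gauss_equiv g g'.
Proof.
move=> gg' f01 fmono fg; split=> //.
have /choice[h hh] : forall k, exists h, oriented_homeo h /\
    forall t, arrow_time g k t -> h t = f k t.
  move=> k; have [s hs] := finite_arrow_times g k.
  have [||h hh e] := @extend_homeo R s (f k).
  - by move=> t /hs kt; split; [exact: arrow_time_interior kt|exact: f01].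
  - by move=> t u /hs kt /hs ku; exact: fmono.
  - by exists h; split=> // t /hs; exact: e.
exists h; split; first by move=> k; case: (hh k).
rewrite -fg; apply: eq_imagel => a ga; rewrite /map_arrow.
congr Arrow; [have [_ ->//] := hh (tail_interval a)|have [_ ->//] := hh (head_interval a)].
  by exists a => //; exact: arrow_ends_tail.
by exists a => //; exact: arrow_ends_head.
Qed.

Lemma oriented_homeo_comp (h h' : R -> R) :
  oriented_homeo h -> oriented_homeo h' -> oriented_homeo (h' \o h).
Proof.
move=> [ch [h1 h2 h3] mh] [ch' [h1' h2' h3'] mh']; split.
- apply: clamp_within.
  have -> : (h' \o h) \o clamp (R := R) = (h' \o @clamp R) \o (h \o @clamp R).
    apply/funext => t /=; rewrite [clamp (h _)]clamp_id //.
    by apply/I01E; apply: h1; exact: clamp_I01.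
  by move=> t; apply: continuous_comp; exact: within_clamp.
- by apply: (set_bij_comp (B := I01)).
- move=> x y Ix Iy xy; apply: mh'; [exact: h1|exact: h1|exact: mh].
Qed.

Lemma gauss_equiv_refl g : gauss_equiv g g.
Proof.
apply: (@gauss_equiv_increasing _ _ (fun _ t => t)) => //.
  by move=> k t; exact: arrow_time_interior.
rewrite (_ : map_arrow _ = id) ?image_id //.
by apply/funext => -[].
Qed.

Lemma gauss_equiv_trans g1 g2 g3 :
  gauss_equiv g1 g2 -> gauss_equiv g2 g3 -> gauss_equiv g1 g3.
Proof.
move=> [p12 [h [hh e]]] [p23 [h' [hh' e']]]; split; first by rewrite p12.
exists (fun k => h' k \o h k); split=> [k|]; first exact: oriented_homeo_comp.
by rewrite -e' -e image_comp.
Qed.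

Lemma gauss_equiv_sym g1 g2 : gauss_equiv g1 g2 -> gauss_equiv g2 g1.
Proof.
move=> [p12 [h [hh e]]].
(* The inverse of [h k]; only its values at the arrow ends count. *)
pose f k t := xget 0 [set x | I01 x /\ h k x = t].
have I k t : arrow_time g1 k t -> I01 t.
  by move=> /arrow_time_interior/andP[t0 t1]; apply/I01E; rewrite !ltW.
have fh k t : I01 t -> f k (h k t) = t.
  have [_ [_ inj _] _] := hh k => It.
  rewrite /f; case: xgetP => [x _ [Ix hx]|/(_ t)]; last by case.
  by apply: inj; rewrite ?inE.
have time2 k t : arrow_time g2 k t -> exists2 u, arrow_time g1 k u & h k u = t.
  move=> [b]; rewrite -e => -[a ga <-] /arrow_endsP[[-> ->]|[-> ->]] /=.
    by exists (tail_point a) => //; exists a => //; exact: arrow_ends_tail.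
  by exists (head_point a) => //; exists a => //; exact: arrow_ends_head.
apply: (@gauss_equiv_increasing _ _ f) => //.
- by move=> k t /time2[u ku <-]; rewrite fh; [exact: arrow_time_interior ku|exact: I ku].
- move=> k s t /time2[u ku <-] /time2[v kv <-].
  rewrite !fh; [|exact: I kv|exact: I ku]; have [_ _ mono] := hh k.
  move=> huv; rewrite ltNge; apply/negP; rewrite le_eqVlt => /orP[/eqP vu|vu].
    by move: huv; rewrite vu ltxx.
  by have := lt_trans huv (mono _ _ (I _ _ kv) (I _ _ ku) vu); rewrite ltxx.
- rewrite -e image_comp -[RHS]image_id; apply: eq_imagel => a ga.
  rewrite /map_arrow /= !fh; first by case: a ga.
    by apply: I; exists a => //; exact: arrow_ends_head.
  by apply: I; exists a => //; exact: arrow_ends_tail.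
Qed.

End GaussEquivalence.

(** * Heights of the strands *)

Section Heights.
Variables (R : realType) (n : nat).
Local Open Scope classical_set_scope.
Local Open Scope ring_scope.
Implicit Types (b : strand_diagram R n) (i j k : 'I_n) (s t : R).

(** Clamping makes the height continuous on the whole line, and constant outside [I01]. *)
Definition ht b k t : R := (b k (clamp t)).2.

Lemma strandE b k t : I01 t -> b k t = (t, ht b k t).
Proof.
move=> It; rewrite /ht clamp_id; last exact/I01E.
by rewrite [b k t]surjective_pairing strand_fst.
Qed.

Lemma strand_eqP b i j t : I01 t -> b i t = b j t <-> ht b i t = ht b j t.
Proof. by move=> It; rewrite !strandE //; split=> [[]|->]. Qed.

Lemma continuous_ht b k : continuous (ht b k).
Proof.
move=> t; have h := within_clamp (@strand_continuous _ _ b k) (x := t).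
by apply: cvg_comp h _; apply: cvg_snd.
Qed.

Lemma ht0 b k : ht b k 0 = height k.
Proof. by rewrite /ht clamp_le0 // strand_start. Qed.

Lemma ht1 b k : ht b k 1 = height (strand_perm b k).
Proof. by rewrite /ht clamp_ge1 // strand_end. Qed.

Lemma ht_01 b k t : 0 <= ht b k t <= 1.
Proof. by have [_ /I01E] := strand_square b k (clamp_I01 t). Qed.

Lemma cvg_to_pair (T : Type) (U V : topologicalType) (F : set_system T)
    (FF : Filter F) (f : T -> U) (g : T -> V) (x : U) (y : V) :
  f @ F --> x -> g @ F --> y -> (f z, g z) @[z --> F] --> (x, y).
Proof. by move=> hf hg; exact: cvg_pair hf hg. Qed.

(** The two side conditions of [descends], for arbitrary functions and with explicit intervals in
    place of one-sided neighbourhoods. *)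
Definition crosses (f : 'I_n -> R -> R) i j t : Prop :=
  exists a c, [/\ a < t, t < c, forall s, a < s < t -> f j s < f i s &
    forall s, t < s < c -> f i s < f j s].

Lemma descends_ht b i j t : 0 < t < 1 ->
  descends b i j t <-> ht b i t = ht b j t /\ crosses (ht b) i j t.
Proof.
move=> t01; have It : I01 t by apply/I01E; case/andP: t01 => *; rewrite !ltW.
have I s : 0 < s < 1 -> (b i s).2 = ht b i s /\ (b j s).2 = ht b j s.
  by move=> /andP[*]; rewrite !strandE //; apply/I01E; rewrite !ltW.
case/andP: t01 => t0 t1; split=> [[/(strand_eqP _ _ _ It) e]|[e [a [c [at_ tc ha hc]]]]].
  move=> /near_leftP[a at_ ha] /near_rightP[c tc hc]; split=> //.
  exists (Num.max a 0), (Num.min c 1); rewrite gt_max lt_min at_ tc t0 t1.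
  split=> // s; rewrite ?gt_max ?lt_min => /andP[].
    move=> /andP[h1 h2] h3; have [|<- <-] := I s; last by apply: ha; rewrite h1.
    by rewrite h2 (lt_trans h3).
  move=> h3 /andP[h1 h2]; have [|<- <-] := I s; last by apply: hc; rewrite h3.
  by rewrite h2 (lt_trans t0).
split; first exact/strand_eqP.
- apply/near_leftP; exists (Num.max a 0); rewrite ?gt_max ?at_ // => s.
  rewrite gt_max => /andP[/andP[h1 h2] h3].
  by have [|-> ->] := I s; [rewrite h2 (lt_trans h3)|apply: ha; rewrite h1].
- apply/near_rightP; exists (Num.min c 1); rewrite ?lt_min ?tc // => s.
  rewrite lt_min => /andP[h3 /andP[h1 h2]].
  by have [|-> ->] := I s; [rewrite h2 (lt_trans t0)|apply: hc; rewrite h1 h3].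
Qed.

Lemma ht_meet_interior b i j t : I01 t -> i != j -> ht b i t = ht b j t -> 0 < t < 1.
Proof.
move=> It ij /(strand_eqP _ _ _ It) e.
by have [] := strand_transversal It ij e; exact: descends_interior.
Qed.

Lemma ht_crosses b i j t : I01 t -> i != j -> ht b i t = ht b j t ->
  crosses (ht b) i j t \/ crosses (ht b) j i t.
Proof.
move=> It ij e; have t01 := ht_meet_interior It ij e.
have /(strand_eqP _ _ _ It) e' := e.
by have [/(descends_ht _ _ _ t01)[]|/(descends_ht _ _ _ t01)[]] :=
  strand_transversal It ij e'; [left|right].
Qed.

Lemma crosses_asym (f : 'I_n -> R -> R) i j t : crosses f i j t -> ~ crosses f j i t.
Proof.
move=> [a [c [at_ tc ha hc]]] [a' [c' [at' tc' ha' hc']]].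
pose s := (Num.max a a' + t) / 2.
have m : Num.max a a' < t by rewrite gt_max at_ at'.
have hs : Num.max a a' < s < t.
  by apply/andP; split; rewrite /s; move: m; move: (Num.max a a') => u; lra.
move: hs; rewrite gt_max => /andP[/andP[h1 h2] h3].
by have := lt_trans (ha s _) (ha' s _); rewrite h1 h2 h3 ltxx => /(_ isT isT).
Qed.

Lemma no_triple b i j k t : I01 t -> i != j -> j != k -> i != k ->
  ~ (ht b i t = ht b j t /\ ht b j t = ht b k t).
Proof.
move=> It ij jk ik [e1 e2]; apply: (@strand_double _ _ b i j k t) => //.
by split; apply/strand_eqP.
Qed.

Record height_functions (f : 'I_n -> R -> R) (p : 'S_n) : Prop := HeightFunctions {
  hf_continuous : forall k, continuous (f k);
  hf_01 : forall k t, I01 t -> 0 <= f k t <= 1;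
  hf_start : forall k, f k 0 = height k;
  hf_end : forall k, f k 1 = height (p k);
  hf_double : forall i j k t, I01 t -> i != j -> j != k -> i != k ->
    ~ (f i t = f j t /\ f j t = f k t);
  hf_crosses : forall i j t, I01 t -> i != j -> f i t = f j t ->
    crosses f i j t \/ crosses f j i t
}.

Lemma height_functions_diagram f p : height_functions f p ->
  exists2 b, strand_perm b = p & forall k t, b k t = (t, f k t).
Proof.
move=> [fc f01 f0 f1 fd fx].
have h1 k : {within I01, continuous (fun t => (t, f k t))}.
  apply: continuous_subspaceT => t; apply: cvg_to_pair; first exact: cvg_id.
  exact: fc.
have h2 k t : I01 t -> square (t, f k t).
  by move=> It; split=> //=; apply/I01E; exact: f01.
have h3 k : (0, f k 0) = (0, height k) :> R * R by rewrite f0.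
have h4 k : (1, f k 1) = (1, height (p k)) :> R * R by rewrite f1.
have h6 i j k t : I01 t -> i != j -> j != k -> i != k ->
    ~ ((t, f i t) = (t, f j t) /\ (t, f j t) = (t, f k t)).
  by move=> It ij jk ik [[e1] [e2]]; apply: (fd i j k t).
have h7 i j t : I01 t -> i != j -> (t, f i t) = (t, f j t) ->
    descends (fun k t => (t, f k t)) i j t \/ descends (fun k t => (t, f k t)) j i t.
  move=> It ij [e]; have [[a [c [at_ tc ha hc]]]|[a [c [at_ tc ha hc]]]] := fx i j t It ij e.
    left; split; first by rewrite e.
      by apply/(near_leftP t (fun s => f j s < f i s)); exists a.
    by apply/(near_rightP t (fun s => f i s < f j s)); exists c.
  right; split; first by rewrite e.
    by apply/(near_leftP t (fun s => f i s < f j s)); exists a.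
  by apply/(near_rightP t (fun s => f j s < f i s)); exists c.
by exists (@StrandDiagram R n (fun k t => (t, f k t)) p h1 h2 h3 h4
  (fun k t _ => erefl) h6 h7).
Qed.

End Heights.

(** * Isotopies from deformations of the heights with tracked crossings *)

Section Isotopy.
Variables (R : realType) (n : nat).
Local Open Scope classical_set_scope.
Local Open Scope ring_scope.

(* The crossings of the deformation [f] from [b] to [b'] are followed by the
   tracks [q]: the crossing of the strands [pr q] at time [z q s]. *)
Lemma isotopic_tracks (b b' : vbd R n) (p : 'S_n) (f : R -> 'I_n -> R -> R)
    (Q : finType) (pr : Q -> 'I_n * 'I_n) (z : Q -> R -> R) :
  (forall k t, I01 t -> ht b k t = f 0 k t) ->
  (forall k t, I01 t -> ht b' k t = f 1 k t) ->
  (forall k s t, I01 s -> I01 t -> f u.1 k u.2 @[u --> (s, t)] --> f s k t) ->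
  (forall s, I01 s -> height_functions (f s) p) ->
  (forall q, continuous (z q)) ->
  (forall q s, I01 s -> I01 (z q s)) ->
  (forall q, (pr q).1 != (pr q).2) ->
  (forall q s, I01 s -> f s (pr q).1 (z q s) = f s (pr q).2 (z q s)) ->
  (forall s t i j, I01 s -> I01 t -> i != j -> f s i t = f s j t ->
     exists2 q, t = z q s & pr q = (i, j) \/ pr q = (j, i)) ->
  (forall q q' s, I01 s -> z q s = z q' s ->
     pr q = pr q' \/ pr q = ((pr q').2, (pr q').1) -> q = q') ->
  (forall q, value b (z q 0, f 0 (pr q).1 (z q 0)) =
             value b' (z q 1, f 1 (pr q).1 (z q 1))) ->
  isotopic b b'.
Proof.
move=> f0 f1 fc ok zc z01 prn zq zall zinj zval.
pose c q s := (z q s, f s (pr q).1 (z q s)).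
have hd s : {d : strand_diagram R n | strand_perm d = p /\
    forall k t, d k t = (t, f (clamp s) k t)}.
  apply: cid; have [d d1 d2] := height_functions_diagram (ok _ (clamp_I01 s)).
  by exists d.
pose d s := sval (hd s).
have dE s k t : d s k t = (t, f (clamp s) k t) by rewrite /d; case: (hd s) => x [].
have I0 : I01 (0 : R) by apply/I01E; rewrite lexx ler01.
have I1 : I01 (1 : R) by apply/I01E; rewrite lexx ler01.
have clampS (s : R) : I01 s -> clamp s = s by move=> /I01E; exact: clamp_id.
(* If two tracks met, the strands of both pairs would pass through one point; without triple points
   the pairs coincide up to order. *)
have cinj s : I01 s -> injective (c^~ s).
  move=> Is q q' [zz ff]; apply: (zinj q q' s) => //.
  have Iz := z01 q s Is; have e1 := zq q s Is; have e2 := zq q' s Is.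
  rewrite -zz in e2 ff.
  have tri := hf_double (ok s Is).
  move: (prn q) (prn q') e1 e2 ff tri.
  case: (pr q) => i j; case: (pr q') => i' j' /= ij ij' e1 e2 ff tri.
  have [ii|ii] := eqVneq i i'; have [jj|jj] := eqVneq j j'.
  - by left; rewrite ii jj.
  - by exfalso; apply: (tri j i j' (z q s)) => //; rewrite ?ii // 1?eq_sym // -?ii -?e2 -?ff.
  - exfalso; apply: (tri i j i' (z q s)) => //; rewrite ?jj // 1?eq_sym //.
    by rewrite -jj -e1 ff.
  have [ij2|ij2] := eqVneq i j'; have [ji|ji] := eqVneq j i'.
  - by right; rewrite ij2 ji.
  - exfalso; apply: (tri i j i' (z q s)) => //; first by rewrite -e1 ff.
  - exfalso; apply: (tri j i j' (z q s)) => //; first by rewrite eq_sym.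
    by rewrite -e1 ff e2.
  - by exfalso; apply: (tri i j i' (z q s)) => //; rewrite -e1 ff.
(* A crossing inherits its value from the track through it, which is unique by [cinj]; the value
   elsewhere is irrelevant. *)
pose val s pt := if pselect (exists q, c q (clamp s) = pt) is left e
  then value b (c (sval (boolp.cid e)) 0) else Virtual.
have valE s q : I01 s -> val s (c q s) = value b (c q 0).
  move=> Is; rewrite /val; case: pselect => [e|[]]; last by exists q; rewrite clampS.
  case: (boolp.cid e) => q' /=; rewrite [clamp s]clampS //.
  by move=> /(cinj s Is) ->.
pose H s := VBD (d s) (val s).
have Hcr s pt : I01 s -> crossing (H s) pt <-> exists q, c q s = pt.
  move=> Is; split.
    move=> [i [j [t [It ij <-]]]]; rewrite /= !dE clampS // => -[e].
    have [q tq [] pq] := zall s t i j Is It ij (esym e).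
      by exists q; rewrite /c pq /= -tq.
    by exists q; rewrite /c pq /= -tq e.
  move=> [q <-]; exists (pr q).1, (pr q).2, (z q s).
  by split; rewrite ?dE ?[clamp s]clampS //; [exact: z01|rewrite -zq].
exists H; split.
- split=> [k t It|pt].
    by rewrite /= dE clampS // strandE // f0.
  move=> /(Hcr 0 pt I0)[q <-]; rewrite /= valE //.
- split=> [k t It|pt].
    by rewrite /= dE clampS // strandE // f1.
  by move=> /(Hcr 1 pt I1)[q <-]; rewrite /= valE // zval.
- move=> k; apply: continuous_in_subspaceT => -[s t]; rewrite inE => -[/= Is It].
  have -> : (fun st : R * R => H st.1 k st.2) = (fun st => (st.2, f (clamp st.1) k st.2)).
    by apply/funext => st /=; rewrite dE.
  apply: cvg_to_pair; first exact: cvg_snd.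
  rewrite /= clampS //.
  apply: (@cvg_comp _ _ _ (fun u : R * R => (clamp u.1, u.2)) (fun u : R * R => f u.1 k u.2)
    _ (nbhs (s, t))); last exact: fc.
  apply: cvg_to_pair; last exact: cvg_snd.
  have cs := @continuous_clamp R s; rewrite /continuous_at clampS // in cs.
  by apply: cvg_comp cs; exact: cvg_fst.
- exists #|Q|, (fun q => c (enum_val q)); split.
    move=> q; apply: continuous_in_subspaceT => s; rewrite inE => Is.
    apply: cvg_to_pair; first exact: zc.
    apply: (@cvg_comp _ _ _ (fun u : R => (u, z (enum_val q) u))
      (fun u : R * R => f u.1 (pr (enum_val q)).1 u.2) _ (nbhs (s, z (enum_val q) s))).
      by apply: cvg_to_pair; [exact: cvg_id|exact: zc].
    by apply: fc => //; exact: z01.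
  move=> s Is; split.
  + by move=> q q' /(cinj s Is)/enum_val_inj.
  + apply/seteqP; split=> pt.
      by move=> [q _ <-]; apply/Hcr => //; exists (enum_val q).
    by move=> /(Hcr s pt Is)[q <-]; exists (enum_rank q); rewrite ?enum_rankK.
  + by move=> q; rewrite /= !valE.
Qed.

End Isotopy.

Section PermOrder.
Variable n : nat.
Local Open Scope nat_scope.

Lemma card_perm_lt (p : 'S_n) m : m <= n -> #|[set k | p k < m]| = m.
Proof.
move=> mn; rewrite -[RHS](size_iota 0) -[RHS]/(size (iota 0 m)).
rewrite cardE -(size_map (fun k => nat_of_ord (p k))).
apply/perm_size/uniq_perm; rewrite ?iota_uniq //.
  rewrite map_inj_uniq ?enum_uniq // => i j /ord_inj; exact: perm_inj.
move=> q; rewrite mem_iota /= add0n; apply/mapP/idP.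
  by move=> [k]; rewrite mem_enum inE => h ->.
move=> qm; have qn : q < n by exact: leq_trans qm mn.
exists (p^-1%g (Ordinal qn)); last by rewrite permKV.
by rewrite mem_enum inE permKV.
Qed.

(** The position [p k] is the number of strands below [k], so the order of the strands determines
    the permutation. *)
Lemma perm_lt_eq (p q : 'S_n) :
  (forall i j, (p i < p j) = (q i < q j)) -> p = q.
Proof.
move=> h; apply/permP => k; apply: ord_inj.
rewrite -(card_perm_lt p (ltnW (ltn_ord (p k)))).
rewrite -(card_perm_lt q (ltnW (ltn_ord (q k)))).
by apply: eq_card => l; rewrite !inE h.
Qed.

Lemma perm_neq (p : 'S_n) i j : i != j -> (p i < p j) = ~~ (p j < p i).
Proof.
move=> ij; rewrite -leqNgt ltn_neqAle; case: eqP => // /ord_inj/perm_inj e.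
by rewrite e eqxx in ij.
Qed.

End PermOrder.

(** * Diagrams with the same movie are isotopic *)

Section Follows.
Variables (R : realType) (n : nat).
Local Open Scope classical_set_scope.
Local Open Scope ring_scope.
Implicit Types (b : vbd R n) (i j k : 'I_n) (s t : R) (st : nat -> 'S_n)
  (val : nat -> nat -> crossing_value) (x : nat -> R).

Lemma height_lt i j : ((height i : R) < height j) = (i < j)%N.
Proof. by rewrite ltr_pM2r ?invr_gt0 ?ltr0n // ltr_nat ltnS. Qed.

Definition before (f : 'I_n -> R -> R) i j t : Prop :=
  exists2 a, a < t & forall s, a < s < t -> f i s < f j s.

Definition after (f : 'I_n -> R -> R) i j t : Prop :=
  exists2 c, t < c & forall s, t < s < c -> f i s < f j s.

Lemma crossesE (f : 'I_n -> R -> R) i j t :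
  crosses f i j t <-> before f j i t /\ after f i j t.
Proof.
split=> [[a [c [at_ tc ha hc]]]|[[a at_ ha] [c tc hc]]].
  by split; [exists a|exists c].
by exists a, c.
Qed.

Lemma mid_lt (a c : R) : a < c -> a < (a + c) / 2 < c.
Proof. by move=> ac; apply/andP; split; lra. Qed.

Lemma before_asym f i j t : before f i j t -> ~ before f j i t.
Proof.
move=> [a at_ ha] [c ct hc].
have m : Num.max a c < t by rewrite gt_max at_ ct.
have := mid_lt m; set u := _ / 2; rewrite gt_max => /andP[/andP[h1 h2] h3].
by have := lt_trans (ha u _) (hc u _); rewrite h1 h2 h3 ltxx => /(_ isT isT).
Qed.

Lemma after_asym f i j t : after f i j t -> ~ after f j i t.
Proof.
move=> [a at_ ha] [c ct hc].
have m : t < Num.min a c by rewrite lt_min at_ ct.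
have := mid_lt m; set u := _ / 2; rewrite lt_min => /andP[h3 /andP[h1 h2]].
by have := lt_trans (ha u _) (hc u _); rewrite h1 h2 h3 ltxx => /(_ isT isT).
Qed.

Lemma lt_before_after (f : 'I_n -> R -> R) i j t :
  (forall k, continuous (f k)) -> f i t < f j t -> before f i j t /\ after f i j t.
Proof.
move=> fc lt_ij.
have : \forall s \near t, f i s < f j s.
  have : 0 < f j t - f i t by rewrite subr_gt0.
  have cd : (fun s => f j s - f i s) @ t --> f j t - f i t.
    by apply: cvgB; exact: fc.
  by move=> /(cvgr_gt _ cd); apply: filterS => s; rewrite subr_gt0.
move=> h; split.
  by apply/(near_leftP t (fun s => f i s < f j s)); apply: cvg_within h.
by apply/(near_rightP t (fun s => f i s < f j s)); apply: cvg_within h.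
Qed.

(* The order of the strands in the gap between the [r]-th and the [r.+1]-th
   crossing time is given by the permutation [st r], and [val r q] is the value
   of the crossing at time [x r.+1] of the strands in positions [q], [q.+1]. *)
Record follows b (N : nat) st val x : Prop := Follows {
  follows_incr : increasing_upto N.+1 x;
  follows_0 : x 0%N = 0;
  follows_1 : x N.+1 = 1;
  follows_gap : forall r t i j, (r <= N)%N -> x r < t < x r.+1 ->
    (ht b i t < ht b j t) = (st r i < st r j)%N;
  follows_value : forall r i j, (r < N)%N -> i != j ->
    ht b i (x r.+1) = ht b j (x r.+1) ->
    value b (b i (x r.+1)) = val r (minn (st r i) (st r j))
}.

Inductive location := AtStart | AtEnd | InGap of nat | AtNode of nat.

Definition located (N : nat) x t (l : location) : Prop :=
  match l with
  | AtStart => t = 0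
  | AtEnd => t = 1
  | InGap r => (r <= N)%N /\ x r < t < x r.+1
  | AtNode r => (r < N)%N /\ t = x r.+1
  end.

(** At a crossing time two strands are strictly ordered exactly if their order is the same in both
    adjacent gaps; otherwise they meet there. *)
Definition location_lt (N : nat) st (l : location) i j : bool :=
  match l with
  | AtStart => (i < j)%N
  | AtEnd => (st N i < st N j)%N
  | InGap r => (st r i < st r j)%N
  | AtNode r => (st r i < st r j)%N && (st r.+1 i < st r.+1 j)%N
  end.

Lemma exists_location N x t : increasing_upto N.+1 x -> x 0%N = 0 -> x N.+1 = 1 ->
  I01 t -> exists l, located N x t l.
Proof.
move=> hx x0 x1 /I01E/andP[t0 t1].
have [t_1|t_1] := eqVneq t 1; first by exists AtEnd.
have [|r rN /andP[h1 h2]] := @locate_lt R N.+1 x t.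
  by rewrite x0 t0 x1 lt_neqAle t_1.
have [e|ne] := eqVneq t (x r); last first.
  by exists (InGap r); split=> //; rewrite h2 andbT lt_neqAle eq_sym ne.
case: r => [|r] in rN h1 h2 e *; first by exists AtStart; rewrite /= e x0.
by exists (AtNode r); split.
Qed.

Lemma located_I01 N x t l : increasing_upto N.+1 x -> x 0%N = 0 -> x N.+1 = 1 ->
  located N x t l -> I01 t.
Proof.
move=> hx x0 x1; case: l => [->|->|r [rN /andP[h1 h2]]|r [rN ->]];
  apply/I01E; rewrite ?lexx ?ler01 // -x0 -x1.
  apply/andP; split.
    by apply: le_trans (ltW h1); apply: (increasing_le hx); lia.
  by apply: le_trans (ltW h2) _; apply: (increasing_le hx); lia.
by apply/andP; split; apply: (increasing_le hx); lia.
Qed.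

Lemma located_pl N x y t l : increasing_upto N.+1 x -> x 0%N = 0 -> x N.+1 = 1 ->
  increasing_upto N.+1 y -> y 0%N = 0 -> y N.+1 = 1 ->
  located N x t l -> located N y (pl N.+1 x y t) l.
Proof.
move=> hx x0 x1 hy y0 y1; case: l => /=.
- by move=> ->; rewrite -[X in pl _ _ _ X]x0 pl_node.
- by move=> ->; rewrite -[X in pl _ _ _ X]x1 pl_node.
- move=> r [rN /andP[h1 h2]]; split=> //.
  have x0r : x 0%N <= x r by apply: (increasing_le hx); lia.
  have xrN : x r.+1 <= x N.+1 by apply: (increasing_le hx); lia.
  rewrite -(pl_node y hx (leqW rN)) -(pl_node y hx (_ : r.+1 <= N.+1)%N) //.
  apply/andP; split; apply: pl_lt => //.
    exact: le_trans (ltW h2) xrN.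
  exact: le_trans x0r (ltW h1).
- move=> r [rN ->]; split=> //; rewrite pl_node //; exact: ltnW.
Qed.

Lemma follows_before b N st val x r i j : follows b N st val x -> (r <= N)%N ->
  (st r i < st r j)%N -> before (ht b) i j (x r.+1).
Proof.
move=> F rN h; exists (x r); first exact: (follows_incr F).
by move=> s hs; rewrite (follows_gap F i j rN hs).
Qed.

Lemma follows_after b N st val x r i j : follows b N st val x -> (r <= N)%N ->
  (st r i < st r j)%N -> after (ht b) i j (x r).
Proof.
move=> F rN h; exists (x r.+1); first exact: (follows_incr F).
by move=> s hs; rewrite (follows_gap F i j rN hs).
Qed.

Lemma follows_before_lt b N st val x r i j : follows b N st val x -> (r <= N)%N ->
  i != j -> before (ht b) i j (x r.+1) -> (st r i < st r j)%N.
Proof.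
move=> F rN ij h; rewrite perm_neq //; apply/negP.
by move=> /(follows_before F rN); exact: before_asym.
Qed.

Lemma follows_after_lt b N st val x r i j : follows b N st val x -> (r <= N)%N ->
  i != j -> after (ht b) i j (x r) -> (st r i < st r j)%N.
Proof.
move=> F rN ij h; rewrite perm_neq //; apply/negP.
by move=> /(follows_after F rN); exact: after_asym.
Qed.

Lemma follows_node_I01 b N st val x r : follows b N st val x -> (r <= N.+1)%N ->
  I01 (x r).
Proof.
move=> F rN; apply/I01E; rewrite -(follows_0 F) -(follows_1 F).
by apply/andP; split; apply: (increasing_le (follows_incr F)); lia.
Qed.

Lemma follows_node_crosses b N st val x r i j : follows b N st val x -> (r < N)%N ->
  crosses (ht b) i j (x r.+1) <-> (st r j < st r i)%N && (st r.+1 i < st r.+1 j)%N.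
Proof.
move=> F rN; rewrite crossesE; split=> [[h1 h2]|/andP[h1 h2]].
  have [ij|ij] := eqVneq i j; first by move: h1; rewrite ij => h1; case: (before_asym h1 h1).
  apply/andP; split; first by apply: (follows_before_lt F (ltnW rN)); rewrite // eq_sym.
  exact: (follows_after_lt F rN).
by split; [exact: (follows_before F (ltnW rN))|exact: (follows_after F rN)].
Qed.

(** A strict inequality persists on both sides by continuity, whereas strands that meet exchange
    sides by transversality. *)
Lemma follows_node b N st val x r i j : follows b N st val x -> (r < N)%N -> i != j ->
  (ht b i (x r.+1) < ht b j (x r.+1)) = (st r i < st r j)%N && (st r.+1 i < st r.+1 j)%N.
Proof.
move=> F rN ij.
have lt k l : k != l -> ht b k (x r.+1) < ht b l (x r.+1) ->
    (st r k < st r l)%N && (st r.+1 k < st r.+1 l)%N.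
  move=> kl /(lt_before_after (@continuous_ht R n b))[h1 h2].
  by rewrite (follows_before_lt F (ltnW rN) kl h1) (follows_after_lt F rN kl h2).
have [h|h|h] := ltgtP (ht b i (x r.+1)) (ht b j (x r.+1)).
- by rewrite lt.
- by have := lt j i; rewrite eq_sym => /(_ ij h)/andP[h1 h2]; apply/esym/negP; lia.
- have Ix := follows_node_I01 F (leqW rN : r.+1 <= N.+1)%N.
  by have [/(follows_node_crosses _ _ F rN)|/(follows_node_crosses _ _ F rN)] :=
    ht_crosses Ix ij h => /andP[h1 h2]; apply/esym/negP; lia.
Qed.

Lemma follows_end b N st val x : follows b N st val x -> strand_perm b = st N.
Proof.
move=> F; apply: perm_lt_eq => i j.
have [->|ij] := eqVneq i j; first by rewrite !ltnn.
have lt k l : k != l -> (strand_perm b k < strand_perm b l)%N -> (st N k < st N l)%N.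
  rewrite -height_lt -!ht1 => kl /(lt_before_after (@continuous_ht R n b))[h _].
  by apply: (follows_before_lt F (leqnn N)); rewrite // (follows_1 F).
apply/idP/idP; first exact: lt.
move=> h; rewrite perm_neq //; apply/negP => h'.
by have := lt j i; rewrite eq_sym => /(_ ij h'); lia.
Qed.

Lemma follows_location b N st val x t l i j : follows b N st val x ->
  located N x t l -> i != j -> (ht b i t < ht b j t) = location_lt N st l i j.
Proof.
move=> F; case: l => [->|->|r [rN h]|r [rN ->]] ij /=.
- by rewrite !ht0 height_lt.
- by rewrite !ht1 height_lt (follows_end F).
- exact: (follows_gap F).
- exact: (follows_node F).
Qed.

(** Linear interpolation between equally ordered pairs preserves the order, ties included, so that
    it neither creates nor destroys a crossing. *)
Lemma lt_mix (s u v u' v' : R) : 0 <= s <= 1 ->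
  (u < v) = (u' < v') -> (v < u) = (v' < u') ->
  ((1 - s) * u + s * u' < (1 - s) * v + s * v') = (u < v).
Proof.
move=> /andP[s0 s1] e1 e2; have [h|h] := ltP u v.
  move: (h); rewrite e1 => h'.
  move: s0; rewrite le_eqVlt => /orP[/eqP <-|s0].
    by rewrite subr0 !mul1r !mul0r !addr0.
  by apply: ler_ltD; [rewrite ler_wpM2l ?subr_ge0 // ltW|rewrite ltr_pM2l].
apply/negbTE; rewrite -leNgt.
have h' : v' <= u'.
  move: h; rewrite !le_eqVlt -e2 => /orP[/eqP vu|->]; last by rewrite orbT.
  apply/orP; left; move: e1 e2; rewrite vu ltxx => e1 e2.
  by rewrite eq_le !leNgt -e1 -e2.
by apply: lerD; rewrite ler_wpM2l // subr_ge0.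
Qed.

Lemma eq_of_lt (u v u' v' : R) :
  (u < v) = (u' < v') -> (v < u) = (v' < u') -> u = v -> u' = v'.
Proof.
by move=> e1 e2 e; apply/eqP; rewrite eq_le !leNgt -e1 -e2 e ltxx.
Qed.

Lemma increasing_mix N (x x' : nat -> R) s : 0 <= s <= 1 ->
  increasing_upto N x -> increasing_upto N x' ->
  increasing_upto N (fun r => (1 - s) * x r + s * x' r).
Proof.
move=> s01 hx hx' r rN.
rewrite lt_mix ?hx ?hx' //; by rewrite !ltNge !ltW ?hx ?hx'.
Qed.

(** At stage [s] the crossings take place at the interpolated times [Y s]. The piecewise linear maps
    [A s] and [B s] send these to the times of [b] and [b'], so at every location both
    reparametrized diagrams have their strands in the same order, and so has the mixture [f s]. *)
Lemma isotopic_follows (b b' : vbd R n) N st val x x' :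
  follows b N st val x -> follows b' N st val x' -> isotopic b b'.
Proof.
move=> F F'.
have hx := follows_incr F; have hx' := follows_incr F'.
have [x0 x1 x0' x1'] := And4 (follows_0 F) (follows_1 F) (follows_0 F') (follows_1 F').
pose Y s r := (1 - s) * x r + s * x' r.
have hY s : I01 s -> increasing_upto N.+1 (Y s) by move=> /I01E Is; exact: increasing_mix.
have Y0 s : Y s 0%N = 0 by rewrite /Y x0 x0' !mulr0 addr0.
have Y1 s : Y s N.+1 = 1 by rewrite /Y x1 x1' !mulr1 subrK.
pose A s t := pl N.+1 (Y s) x t; pose B s t := pl N.+1 (Y s) x' t.
pose f s k t := (1 - s) * ht b k (A s t) + s * ht b' k (B s t).
have lA s t l : I01 s -> located N (Y s) t l -> located N x (A s t) l.
  by move=> Is; apply: located_pl => //; exact: hY.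
have lB s t l : I01 s -> located N (Y s) t l -> located N x' (B s t) l.
  by move=> Is; apply: located_pl => //; exact: hY.
have AI s t : I01 s -> I01 t -> I01 (A s t).
  move=> Is It; have [l hl] := exists_location (hY s Is) (Y0 s) (Y1 s) It.
  exact: located_I01 (lA _ _ _ Is hl).
have ltb s t l i j : I01 s -> located N (Y s) t l -> i != j ->
    (ht b i (A s t) < ht b j (A s t)) = location_lt N st l i j.
  by move=> Is hl ij; apply: (follows_location F) => //; exact: lA.
have ltb' s t l i j : I01 s -> located N (Y s) t l -> i != j ->
    (ht b' i (B s t) < ht b' j (B s t)) = location_lt N st l i j.
  by move=> Is hl ij; apply: (follows_location F') => //; exact: lB.
have ltf s t l i j : I01 s -> located N (Y s) t l -> i != j ->
    (f s i t < f s j t) = location_lt N st l i j.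
  move=> Is hl ij; have ji : j != i by rewrite eq_sym.
  rewrite /f lt_mix; first exact: ltb.
  - exact/I01E.
  - by rewrite (ltb _ _ l) // (ltb' _ _ l).
  - by rewrite (ltb _ _ l) // (ltb' _ _ l).
have eqf s t i j : I01 s -> I01 t -> f s i t = f s j t -> ht b i (A s t) = ht b j (A s t).
  move=> Is It; have [->//|ij] := eqVneq i j; have ji : j != i by rewrite eq_sym.
  have [l hl] := exists_location (hY s Is) (Y0 s) (Y1 s) It.
  by apply: eq_of_lt; rewrite (ltf _ _ l) // (ltb _ _ l).
have node s t i j : I01 s -> I01 t -> i != j -> f s i t = f s j t ->
    exists r : 'I_N, t = Y s r.+1 /\
      ((st r j < st r i)%N && (st r.+1 i < st r.+1 j)%N \/
       (st r i < st r j)%N && (st r.+1 j < st r.+1 i)%N).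
  move=> Is It ij e; have ji : j != i by rewrite eq_sym.
  have [l hl] := exists_location (hY s Is) (Y0 s) (Y1 s) It.
  have := ltf s t l i j Is hl ij; have := ltf s t l j i Is hl ji.
  rewrite e ltxx; case: l hl => [->|->|r [rN h]|r [rN ->]] /=.
  - by move: ij; rewrite -(inj_eq val_inj) /=; case: ltngtP.
  - by rewrite (perm_neq _ ij); case: (_ < _)%N.
  - by rewrite (perm_neq _ ij); case: (_ < _)%N.
  - move=> h1 h2; exists (Ordinal rN); split=> //=; move: h1 h2.
    rewrite (perm_neq (st r) ij) (perm_neq (st r.+1) ij).
    by case: (st r j < st r i)%N; case: (st r.+1 j < st r.+1 i)%N => //= _ _; [left|right].
have gapf s r t i j : I01 s -> (r <= N)%N -> Y s r < t < Y s r.+1 ->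
    (f s i t < f s j t) = (st r i < st r j)%N.
  move=> Is rN h; have [->|ij] := eqVneq i j; first by rewrite ltxx ltnn.
  exact: (ltf s t (InGap r)).
have crossf s r i j : I01 s -> (r < N)%N -> (st r j < st r i)%N && (st r.+1 i < st r.+1 j)%N ->
    crosses (f s) i j (Y s r.+1).
  move=> Is rN /andP[h1 h2]; exists (Y s r), (Y s r.+2); split.
  - by apply: (hY s Is); exact: leqW.
  - by apply: (hY s Is).
  - by move=> t ht; rewrite (gapf s r) // ltnW.
  - by move=> t ht; rewrite (gapf s r.+1).
have cf k s t : I01 s -> f u.1 k u.2 @[u --> (s, t)] --> f s k t.
  move=> Is; have cfst : (u.1 @[u --> (s, t)] --> s) by exact: cvg_fst.
  have csnd : (u.2 @[u --> (s, t)] --> t) by exact: cvg_snd.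
  have cY r : Y u.1 r @[u --> (s, t)] --> Y s r.
    by apply: cvgD; apply: cvgM; (try exact: cvg_cst) => //; apply: cvgB => //; exact: cvg_cst.
  apply: cvgD; apply: cvgM => //.
  - by apply: cvgB => //; exact: cvg_cst.
  - apply: continuous_cvg; first exact: continuous_ht.
    apply: (@cvg_pl R _ _ _ N.+1 (fun r u => Y u.1 r) (fun r _ => x r) snd) => //.
      exact: hY.
    by move=> r _; exact: cvg_cst.
  - apply: continuous_cvg; first exact: continuous_ht.
    apply: (@cvg_pl R _ _ _ N.+1 (fun r u => Y u.1 r) (fun r _ => x' r) snd) => //.
      exact: hY.
    by move=> r _; exact: cvg_cst.
have A0 t : I01 t -> A 0 t = t.
  move=> /I01E It; rewrite /A (_ : Y 0 = x) ?pl_id ?x0 ?x1 //.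
  by apply/funext => r; rewrite /Y subr0 mul1r mul0r addr0.
have B1 t : I01 t -> B 1 t = t.
  move=> /I01E It; rewrite /B (_ : Y 1 = x') ?pl_id ?x0' ?x1' //.
  by apply/funext => r; rewrite /Y subrr mul1r mul0r add0r.
have f0 k t : I01 t -> ht b k t = f 0 k t.
  by move=> It; rewrite /f A0 // subr0 mul1r mul0r addr0.
have f1 k t : I01 t -> ht b' k t = f 1 k t.
  by move=> It; rewrite /f B1 // subrr mul1r mul0r add0r.
(* A track is a step together with a pair exchanged in it, the descending strand first, so that each
   crossing is counted once. *)
pose cond (q : 'I_N * ('I_n * 'I_n)) :=
  (st q.1 q.2.2 < st q.1 q.2.1)%N && (st q.1.+1 q.2.1 < st q.1.+1 q.2.2)%N.
pose Q := {q : 'I_N * ('I_n * 'I_n) | cond q}.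
have Yinj s : I01 s -> forall r q : 'I_N, Y s r.+1 = Y s q.+1 -> r = q.
  move=> Is r q e; apply: ord_inj; apply/eqP; case: ltngtP => // h.
    have : Y s r.+1 < Y s q.+1.
      by apply: (increasing_lt (hY s Is)); rewrite !ltnS h ltnW.
    by rewrite e ltxx.
  have : Y s q.+1 < Y s r.+1.
    by apply: (increasing_lt (hY s Is)); rewrite !ltnS h ltnW.
  by rewrite e ltxx.
have YI s (r : 'I_N) : I01 s -> I01 (Y s r.+1).
  move=> Is; apply: (@located_I01 N (Y s) _ (AtNode r)) => //; exact: hY.
have eqnode s (r : 'I_N) i j : I01 s -> cond (r, (i, j)) ->
    f s i (Y s r.+1) = f s j (Y s r.+1).
  move=> Is /andP[/= h1 h2]; have ij : i != j by apply/eqP => ij; rewrite ij ltnn in h1.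
  have ji : j != i by rewrite eq_sym.
  have hl : located N (Y s) (Y s r.+1) (AtNode r) by [].
  apply/eqP; rewrite eq_le !leNgt (ltf s _ _ i j Is hl ij) (ltf s _ _ j i Is hl ji) /=.
  by apply/andP; split; apply/negP; lia.
apply: (@isotopic_tracks R n b b' (st N) f Q (fun q => (sval q).2)
   (fun q s => Y s (sval q).1.+1)) => //.
- by move=> k s t Is _; exact: cf.
- move=> s Is; split.
  + move=> k t; apply: (@cvg_comp _ _ _ (fun u : R => (s, u)) (fun u : R * R => f u.1 k u.2)
      _ (nbhs (s, t))); last exact: cf.
    by apply: cvg_to_pair; [exact: cvg_cst|exact: cvg_id].
  + move=> k t It; have /andP[a1 a2] := ht_01 b k (A s t).
    have /andP[b1 b2] := ht_01 b' k (B s t).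
    move/I01E: Is => /andP[s0 s1].
    rewrite addr_ge0 ?mulr_ge0 ?subr_ge0 //=.
    rewrite -[leRHS](subrK s) lerD //; first by rewrite ler_piMr // subr_ge0.
    by rewrite ler_piMr.
  + have a0 : A s 0 = 0 by rewrite /A -[X in pl _ _ _ X](Y0 s) pl_node //; exact: hY.
    have b0 : B s 0 = 0 by rewrite /B -[X in pl _ _ _ X](Y0 s) pl_node //; exact: hY.
    by move=> k; rewrite /f a0 b0 !ht0 -mulrDl subrK mul1r.
  + have a1 : A s 1 = 1 by rewrite /A -[X in pl _ _ _ X](Y1 s) pl_node //; exact: hY.
    have b1 : B s 1 = 1 by rewrite /B -[X in pl _ _ _ X](Y1 s) pl_node //; exact: hY.
    move=> k; rewrite /f a1 b1 !ht1 (follows_end F) (follows_end F').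
    by rewrite -mulrDl subrK mul1r.
  + move=> i j k t It ij jk ik [e1 e2].
    apply: (@no_triple _ _ b i j k (A s t)) => //; first exact: AI.
    by split; exact: eqf.
  + move=> i j t It ij e.
    by have [r [-> [h|h]]] := node s t i j Is It ij e; [left|right]; apply: crossf.
- move=> q s; apply: cvgD; apply: cvgM; try exact: cvg_cst; try exact: cvg_id.
  by apply: cvgB; [exact: cvg_cst|exact: cvg_id].
- by move=> q s Is; exact: YI.
- by move=> [[r [i j]] /= /andP[/= h _]]; apply/eqP => ij; rewrite ij ltnn in h.
- by move=> [[r [i j]] /= h] s Is; exact: eqnode.
- move=> s t i j Is It ij e; have [r [-> [h|h]]] := node s t i j Is It ij e.
    by exists (exist _ (r, (i, j)) h) => //; left.
  by exists (exist _ (r, (j, i)) h) => //; right.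
- move=> [[r [i j]] /= h] [[r' [i' j']] /= h'] s Is /(Yinj s Is) rr.
  subst r'; move=> [[ii jj]|[ij ji]]; subst i' j'; first exact: val_inj.
  have /andP[/= h1 _] := h; have /andP[/= h2 _] := h'.
  by move: (ltn_trans h1 h2); rewrite ltnn.
- move=> [[r [i j]] /= h].
  have I0 : I01 (0 : R) by apply/I01E; rewrite lexx ler01.
  have I1 : I01 (1 : R) by apply/I01E; rewrite lexx ler01.
  have ij : i != j by case/andP: h => /= h _; apply/eqP => ij; rewrite ij ltnn in h.
  have e0 : Y 0 r.+1 = x r.+1 by rewrite /Y subr0 mul1r mul0r addr0.
  have e1 : Y 1 r.+1 = x' r.+1 by rewrite /Y subrr mul1r mul0r add0r.
  have Ix := YI 0 r I0; have Ix' := YI 1 r I1.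
  have m0 := eqnode 0 r i j I0 h; have m1 := eqnode 1 r i j I1 h.
  rewrite -!f0 // in m0; rewrite -!f1 // in m1.
  rewrite -f0 // -f1 // -!strandE //; move: Ix Ix' m0 m1; rewrite e0 e1 => Ix Ix' m0 m1.
  by rewrite (follows_value F _ ij m0) // (follows_value F' _ ij m1).
Qed.

End Follows.

(** * Drawings of movies of permutations *)

Section Movies.
Variable n : nat.
Local Open Scope nat_scope.
Implicit Types (p q : 'S_n) (i j k : 'I_n).

Definition swapped p q i j : bool := (p j < p i) && (q i < q j).

(** The change is a product of disjoint adjacent transpositions: several crossings may take place in
    one step, but no strand takes part in two of them. *)
Definition movie_step p q : Prop := forall k, q k = p k :> nat \/
  exists l, [/\ q k = p l, q l = p k & (p l == (p k).+1 :> nat) || (p k == (p l).+1 :> nat)].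

Lemma movie_step_near p q k : movie_step p q -> q k <= (p k).+1 /\ p k <= (q k).+1.
Proof.
move=> /(_ k)[->|[l [-> _ /orP[/eqP ->|/eqP ->]]]]; lia.
Qed.

Lemma swapped_pos p q i j : movie_step p q -> swapped p q i j ->
  [/\ p i = (p j).+1 :> nat, q i = p j :> nat & q j = p i :> nat].
Proof.
move=> pq /andP[h1 h2].
by have [] := movie_step_near i pq; have [] := movie_step_near j pq; split; lia.
Qed.

(** Positions change by at most one, and a strand that takes the place of another is exchanged with
    it. Hence the ranges swept by the two strands during the step are disjoint. *)
Lemma movie_step_keep p q i j : movie_step p q -> p i < p j -> q i < q j ->
  p i < q j /\ q i < p j.
Proof.
move=> pq h1 h2.
have [a1 a2] := movie_step_near i pq; have [b1 b2] := movie_step_near j pq.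
have ne1 : q j <> p i :> nat.
  move=> e; have [e2|[l [e2 e3 _]]] := pq j; first by lia.
  have il : i = l by apply: (@perm_inj _ p); apply: ord_inj; rewrite -e e2.
  by subst l; move: e3 e => /(congr1 val) /=; lia.
have ne2 : q i <> p j :> nat.
  move=> e; have [e2|[l [e2 e3 _]]] := pq i; first by lia.
  have jl : j = l by apply: (@perm_inj _ p); apply: ord_inj; rewrite -e e2.
  by subst l; move: e3 e => /(congr1 val) /=; lia.
by split; lia.
Qed.

Lemma not_swapped p q i j : i != j -> ~~ swapped p q i j -> ~~ swapped p q j i ->
  (q i < q j) = (p i < p j).
Proof.
move=> ij; rewrite /swapped (perm_neq q ij) (perm_neq p ij).
by case: (p j < p i); case: (q j < q i).
Qed.

End Movies.

Section Drawings.
Variables (R : realType) (n : nat).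
Local Open Scope classical_set_scope.
Local Open Scope ring_scope.
Implicit Types (i j k : 'I_n) (s t : R) (st : nat -> 'S_n)
  (val : nat -> nat -> crossing_value) (x : nat -> R) (m : nat -> nat -> R).

(** Rises from 0 at [a] through 1/2 at [c] to 1 at [d]. Two strands that exchange positions along
    the same half ramp meet exactly at time [c]. *)
Definition half_ramp (a c d t : R) : R := (ramp a c t + ramp c d t) / 2.

Lemma ramp01 (a c t : R) : 0 <= ramp a c t <= 1.
Proof. by have /I01E := clamp_I01 ((t - a) / (c - a)). Qed.

Lemma half_ramp01 a c d t : 0 <= half_ramp a c d t <= 1.
Proof.
have /andP[h1 h2] := ramp01 a c t; have /andP[h3 h4] := ramp01 c d t.
by rewrite /half_ramp; apply/andP; split; lra.
Qed.

Lemma half_ramp_le a c d t : a < c < d -> t <= a -> half_ramp a c d t = 0.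
Proof.
move=> /andP[ac cd] ta; rewrite /half_ramp !ramp_le ?addr0 ?mul0r //.
by rewrite (le_trans ta) // ltW.
Qed.

Lemma half_ramp_ge a c d t : a < c < d -> d <= t -> half_ramp a c d t = 1.
Proof.
move=> /andP[ac cd] td; rewrite /half_ramp !ramp_ge //; first by lra.
by apply: le_trans td; rewrite ltW.
Qed.

Lemma half_ramp_mid a c d : a < c < d -> half_ramp a c d c = 1 / 2.
Proof. by move=> /andP[ac cd]; rewrite /half_ramp ramp_ge // ramp_le // addr0. Qed.

Lemma half_ramp_lt a c d t : a < c < d -> a <= t < c -> half_ramp a c d t < 1 / 2.
Proof.
move=> /andP[ac cd] /andP[at_ tc].
rewrite /half_ramp [ramp c d t]ramp_le ?(ltW tc) // addr0 ltr_pM2r ?invr_gt0 //.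
by rewrite ramp_in ?at_ ?ltW // ltr_pdivrMr ?subr_gt0 // mul1r ltrD2r.
Qed.

Lemma half_ramp_gt a c d t : a < c < d -> c < t <= d -> 1 / 2 < half_ramp a c d t.
Proof.
move=> /andP[ac cd] /andP[ct td].
rewrite /half_ramp [ramp a c t]ramp_ge ?(ltW ct) // ltr_pM2r ?invr_gt0 // ltrDl.
by rewrite ramp_in ?td ?ltW // divr_gt0 // subr_gt0.
Qed.

Lemma sum_steps N (y c : nat -> R) r : (r < N)%N ->
  (forall q, (q < r)%N -> c q = 1) -> (forall q, (r < q < N)%N -> c q = 0) ->
  y 0%N + \sum_(q < N) (y q.+1 - y q) * c q = y r + (y r.+1 - y r) * c r.
Proof.
move=> rN c1 c0.
have tele M : (M <= r)%N -> y 0%N + \sum_(q < M) (y q.+1 - y q) * c q = y M.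
  elim: M => [|M IH] Mr; first by rewrite big_ord0 addr0.
  by rewrite big_ord_recr /= addrA IH 1?ltnW // c1 // mulr1 addrC subrK.
elim: N rN c0 => [//|N IH]; rewrite ltnS leq_eqVlt => /orP[/eqP <-|rN] c0.
  by rewrite big_ord_recr /= addrA tele.
have cN : c N = 0 by apply: c0; rewrite rN ltnSn.
rewrite big_ord_recr /= addrA IH // ?cN ?mulr0 ?addr0 //.
by move=> q /andP[h1 h2]; rewrite c0 // h1 leqW.
Qed.

Variable N : nat.
Hypothesis N0 : (0 < N)%N.

Definition node (r : nat) : R := r%:R / N%:R.

Lemma node_lt r : node r < node r.+1.
Proof. by rewrite ltr_pM2r ?invr_gt0 ?ltr0n // ltr_nat. Qed.

Lemma node_le r q : (r <= q)%N -> node r <= node q.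
Proof. by move=> rq; rewrite ler_pM2r ?invr_gt0 ?ltr0n // ler_nat. Qed.

Lemma node_0 : node 0 = 0. Proof. by rewrite /node mul0r. Qed.

Lemma node_N : node N = 1. Proof. by rewrite /node divff // pnatr_eq0 -lt0n. Qed.

Lemma locate_node t : I01 t -> exists2 r, (r < N)%N & node r <= t <= node r.+1.
Proof. by move=> /I01E It; apply: locate => //; rewrite node_0 node_N. Qed.

Definition schedule m : Prop :=
  forall r p, (r < N)%N -> (p < n)%N -> node r < m r p < node r.+1.

(** The two strands of an exchanged pair have the same smaller position, so the minimum picks the
    same crossing time for both. For a strand at rest the ramp is multiplied by 0 in [position]. *)
Definition step_ramp st m r k t : R :=
  half_ramp (node r) (m r (minn (st r k) (st r.+1 k))) (node r.+1) t.

Definition position st m k t : R :=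
  (st 0%N k)%:R + \sum_(r < N) ((st r.+1 k)%:R - (st r k)%:R) * step_ramp st m r k t.

Definition drawn_height st m k t : R := (position st m k t + 1) / n.+1%:R.

Lemma minn_perm_lt (p q : 'S_n) k : (minn (p k) (q k) < n)%N.
Proof. by rewrite (leq_ltn_trans (geq_minl _ _)). Qed.

Lemma position_step st m k r t : schedule m -> (r < N)%N ->
  node r <= t <= node r.+1 -> position st m k t =
  (st r k)%:R + ((st r.+1 k)%:R - (st r k)%:R) * step_ramp st m r k t.
Proof.
move=> hm rN /andP[h1 h2].
apply: (@sum_steps N (fun r => (st r k)%:R) (fun r => step_ramp st m r k t)) => //.
- move=> q qr; rewrite /step_ramp half_ramp_ge //.
    by apply: hm; [exact: ltn_trans qr rN|exact: minn_perm_lt].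
  exact: le_trans (node_le qr) h1.
- move=> q /andP[rq qN]; rewrite /step_ramp half_ramp_le //.
    by apply: hm => //; exact: minn_perm_lt.
  exact: le_trans h2 (node_le rq).
Qed.

Definition movie st : Prop :=
  st 0%N = 1%g /\ forall r, (r < N)%N -> movie_step (st r) (st r.+1).

Lemma drawn_lt st m i j t :
  (drawn_height st m i t < drawn_height st m j t) = (position st m i t < position st m j t).
Proof. by rewrite ltr_pM2r ?invr_gt0 ?ltr0n // ltrD2r. Qed.

Lemma position_between st m k r t : schedule m -> (r < N)%N ->
  node r <= t <= node r.+1 ->
  (minn (st r k) (st r.+1 k))%:R <= position st m k t <= (maxn (st r k) (st r.+1 k))%:R.
Proof.
move=> hm rN ht; rewrite (position_step _ _ hm rN ht).
have /andP[h1 h2] := half_ramp01 (node r) (m r (minn (st r k) (st r.+1 k))) (node r.+1) t.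
rewrite -/(step_ramp st m r k t) in h1 h2.
have [h|h] := leqP (st r k) (st r.+1 k).
  have h' : (st r k)%:R <= (st r.+1 k)%:R :> R by rewrite ler_nat.
  by apply/andP; split; nra.
have h' : (st r.+1 k)%:R <= (st r k)%:R :> R by rewrite ler_nat ltnW.
by apply/andP; split; nra.
Qed.

Lemma drawn_keep st m i j r t : movie st -> schedule m -> (r < N)%N ->
  node r <= t <= node r.+1 -> (st r i < st r j)%N -> (st r.+1 i < st r.+1 j)%N ->
  drawn_height st m i t < drawn_height st m j t.
Proof.
move=> [_ hst] hm rN ht h1 h2; rewrite drawn_lt.
have [h3 h4] := movie_step_keep (hst r rN) h1 h2.
have /andP[_ a] := @position_between st m i r t hm rN ht.
have /andP[b _] := @position_between st m j r t hm rN ht.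
by apply: le_lt_trans a _; apply: lt_le_trans b; rewrite ltr_nat; lia.
Qed.

Lemma drawn_swapped st m i j r t : movie st -> schedule m -> (r < N)%N ->
  node r <= t <= node r.+1 -> swapped (st r) (st r.+1) i j ->
  (drawn_height st m i t < drawn_height st m j t) = (m r (st r j) < t) /\
  (drawn_height st m j t < drawn_height st m i t) = (t < m r (st r j)).
Proof.
move=> [_ hst] hm rN /andP[t1 t2] sw; rewrite !drawn_lt.
have ht : node r <= t <= node r.+1 by rewrite t1.
have [e1 e2 e3] := swapped_pos (hst r rN) sw.
rewrite !(position_step _ _ hm rN ht) /step_ramp.
have -> : minn (st r i) (st r.+1 i) = st r j by lia.
have -> : minn (st r j) (st r.+1 j) = st r j by lia.
have hmr := hm r (st r j) rN (ltn_ord _).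
set l := half_ramp _ _ _ _; rewrite e2 e3 e1 -addn1 natrD.
set c := (st r j)%:R.
have -> : (c + 1%:R + (c - (c + 1%:R)) * l < c + (c + 1%:R - c) * l) = (1 / 2 < l).
  by apply/idP/idP => h; lra.
have -> : (c + (c + 1%:R - c) * l < c + 1%:R + (c - (c + 1%:R)) * l) = (l < 1 / 2).
  by apply/idP/idP => h; lra.
have [h|h|h] := ltgtP t (m r (st r j)).
- have hl : l < 1 / 2 by rewrite half_ramp_lt // t1.
  by rewrite hl ltNge ltW.
- have hl : 1 / 2 < l by rewrite half_ramp_gt // h.
  by rewrite hl [l < _]ltNge ltW.
- have hl : l = 1 / 2 by rewrite /l h half_ramp_mid.
  by rewrite hl ltxx.
Qed.

Lemma drawn_before st m i j r t : movie st -> schedule m -> (r < N)%N ->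
  node r <= t <= node r.+1 ->
  (forall k l, swapped (st r) (st r.+1) k l -> t < m r (st r l)) ->
  (drawn_height st m i t < drawn_height st m j t) = (st r i < st r j)%N.
Proof.
move=> hst hm rN ht hlt; have [->|ij] := eqVneq i j; first by rewrite ltxx ltnn.
have [sw|nsw] := boolP (swapped (st r) (st r.+1) i j).
  have [-> _] := drawn_swapped hst hm rN ht sw.
  by case/andP: (sw) => h _; rewrite [RHS]ltnNge (ltnW h) ltNge ltW // (hlt _ _ sw).
have [sw|nsw'] := boolP (swapped (st r) (st r.+1) j i).
  have [_ ->] := drawn_swapped hst hm rN ht sw.
  by rewrite (hlt _ _ sw); case/andP: sw.
have e := not_swapped ij nsw nsw'; have [h|h] := boolP (st r i < st r j)%N.
  by apply: (drawn_keep hst hm rN ht) => //; rewrite e.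
apply/negbTE; rewrite -leNgt ltW //; apply: (drawn_keep hst hm rN ht).
  by rewrite (perm_neq (st r)) // eq_sym.
by rewrite (perm_neq (st r.+1)) ?e // eq_sym.
Qed.

Lemma drawn_after st m i j r t : movie st -> schedule m -> (r < N)%N ->
  node r <= t <= node r.+1 ->
  (forall k l, swapped (st r) (st r.+1) k l -> m r (st r l) < t) ->
  (drawn_height st m i t < drawn_height st m j t) = (st r.+1 i < st r.+1 j)%N.
Proof.
move=> hst hm rN ht hlt; have [->|ij] := eqVneq i j; first by rewrite ltxx ltnn.
have [sw|nsw] := boolP (swapped (st r) (st r.+1) i j).
  have [-> _] := drawn_swapped hst hm rN ht sw.
  by rewrite (hlt _ _ sw); case/andP: sw.
have [sw|nsw'] := boolP (swapped (st r) (st r.+1) j i).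
  have [_ ->] := drawn_swapped hst hm rN ht sw.
  by case/andP: (sw) => _ h; rewrite [RHS]ltnNge (ltnW h) ltNge ltW // (hlt _ _ sw).
have e := not_swapped ij nsw nsw'; rewrite e; have [h|h] := boolP (st r i < st r j)%N.
  by apply: (drawn_keep hst hm rN ht) => //; rewrite e.
apply/negbTE; rewrite -leNgt ltW //; apply: (drawn_keep hst hm rN ht).
  by rewrite (perm_neq (st r)) // eq_sym.
by rewrite (perm_neq (st r.+1)) ?e // eq_sym.
Qed.

Lemma drawn_meet_step st m i j r t : movie st -> schedule m -> (r < N)%N ->
  node r <= t <= node r.+1 -> i != j ->
  drawn_height st m i t = drawn_height st m j t ->
  swapped (st r) (st r.+1) i j /\ t = m r (st r j) \/
  swapped (st r) (st r.+1) j i /\ t = m r (st r i).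
Proof.
move=> hst hm rN ht ij e.
have [sw|nsw] := boolP (swapped (st r) (st r.+1) i j).
  left; split=> //; have [h1 h2] := drawn_swapped hst hm rN ht sw.
  by apply/eqP; rewrite eq_le !leNgt -h1 -h2 e ltxx.
have [sw|nsw'] := boolP (swapped (st r) (st r.+1) j i).
  right; split=> //; have [h1 h2] := drawn_swapped hst hm rN ht sw.
  by apply/eqP; rewrite eq_le !leNgt -h1 -h2 e ltxx.
have e' := not_swapped ij nsw nsw'; exfalso.
have [h|h] := boolP (st r i < st r j)%N.
  have := drawn_keep hst hm rN ht h; rewrite e' e ltxx => /(_ h).
  by [].
have h' : (st r j < st r i)%N by rewrite (perm_neq (st r)) // eq_sym.
have h'' : (st r.+1 j < st r.+1 i)%N by rewrite (perm_neq (st r.+1)) ?e' // eq_sym.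
by have := drawn_keep hst hm rN ht h' h''; rewrite e ltxx.
Qed.

Lemma drawn_meet st m i j t : movie st -> schedule m -> I01 t -> i != j ->
  drawn_height st m i t = drawn_height st m j t -> exists2 r, (r < N)%N &
  swapped (st r) (st r.+1) i j /\ t = m r (st r j) \/
  swapped (st r) (st r.+1) j i /\ t = m r (st r i).
Proof.
move=> hst hm It ij e; have [r rN ht] := locate_node It.
by exists r => //; apply: drawn_meet_step.
Qed.

Lemma schedule_in m r p : schedule m -> (r < N)%N -> (p < n)%N ->
  node r <= m r p <= node r.+1.
Proof. by move=> hm rN pn; have /andP[h1 h2] := hm r p rN pn; rewrite !ltW. Qed.

Lemma node_I01 r t : (r < N)%N -> node r <= t <= node r.+1 -> I01 t.
Proof.
move=> rN /andP[h1 h2]; apply/I01E; rewrite -node_0 -node_N.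
by rewrite (le_trans (node_le (leq0n r)) h1) (le_trans h2) // node_le.
Qed.

Lemma drawn_swapped_eq st m i j r : movie st -> schedule m -> (r < N)%N ->
  swapped (st r) (st r.+1) i j ->
  drawn_height st m i (m r (st r j)) = drawn_height st m j (m r (st r j)).
Proof.
move=> hst hm rN sw; have ht := schedule_in hm rN (ltn_ord (st r j)).
have [h1 h2] := drawn_swapped hst hm rN ht sw.
by apply/eqP; rewrite eq_le !leNgt h1 h2 ltxx.
Qed.

Lemma drawn_crosses st m i j r : movie st -> schedule m -> (r < N)%N ->
  swapped (st r) (st r.+1) i j -> crosses (drawn_height st m) i j (m r (st r j)).
Proof.
move=> hst hm rN sw; have /andP[h1 h2] := hm r (st r j) rN (ltn_ord _).
exists (node r), (node r.+1); split=> // t /andP[h3 h4].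
  have ht : node r <= t <= node r.+1 by rewrite (ltW h3) ltW // (lt_trans h4).
  by have [_ ->] := drawn_swapped hst hm rN ht sw.
have ht : node r <= t <= node r.+1 by rewrite (ltW h4) ltW // (lt_trans h1).
by have [-> _] := drawn_swapped hst hm rN ht sw.
Qed.

Lemma cvg_drawn (T : Type) (F : set_system T) (FF : Filter F) st
    (m : T -> nat -> nat -> R) (m0 : nat -> nat -> R) (t : T -> R) (t0 : R) k :
  schedule m0 -> (forall r p, m u r p @[u --> F] --> m0 r p) -> t @ F --> t0 ->
  drawn_height st (m u) k (t u) @[u --> F] --> drawn_height st m0 k t0.
Proof.
move=> hm cm ct; rewrite /drawn_height; apply: cvgM; last exact: cvg_cst.
apply: cvgD; last exact: cvg_cst.
rewrite /position; apply: cvgD; first exact: cvg_cst.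
have cadd : continuous (fun u : R * R => u.1 + u.2).
  by move=> u; apply: cvgD; [exact: cvg_fst|exact: cvg_snd].
apply: (@cvg_big R _ +%R 0 xpredT cadd T F _ (fun (r : 'I_N) u =>
  ((st r.+1 k)%:R - (st r k)%:R) * step_ramp st (m u) r k (t u))) => r _.
apply: cvgM; first exact: cvg_cst.
rewrite /step_ramp /half_ramp; apply: cvgM; last exact: cvg_cst.
have /andP[h1 h2] := hm r _ (ltn_ord r) (minn_perm_lt (st r) (st r.+1) k).
by apply: cvgD; apply: cvg_ramp; rewrite ?lt_eqF //; exact: cvg_cst.
Qed.

Lemma drawn_height_functions st m : movie st -> schedule m ->
  height_functions (drawn_height st m) (st N).
Proof.
move=> hst hm.
have start k : drawn_height st m k 0 = height k.
  rewrite /drawn_height (@position_step _ _ _ 0) //; last first.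
    by rewrite node_0 lexx /= divr_ge0.
  rewrite /step_ramp half_ramp_le ?node_0 ?mulr0 ?addr0 //; last first.
    by rewrite -{1}node_0; apply: hm => //; exact: minn_perm_lt.
  by case: hst => -> _; rewrite perm1 /height natr1.
have final k : drawn_height st m k 1 = height (st N k).
  have eN : N = N.-1.+1 by rewrite prednK.
  have hN : (N.-1 < N)%N by rewrite {2}eN.
  have hn : node N.-1 <= 1 <= node N.-1.+1.
    by rewrite -eN node_N lexx andbT -node_N node_le // leq_pred.
  rewrite /drawn_height (@position_step _ _ _ N.-1) // /step_ramp half_ramp_ge.
  - by rewrite mulr1 [X in X + 1]addrC subrK -eN /height natr1.
  - by apply: hm => //; exact: minn_perm_lt.
  - by rewrite -eN node_N.
split.
- move=> k t; apply: (@cvg_drawn _ _ _ st (fun _ => m) m id) => //.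
  by move=> r p; exact: cvg_cst.
- move=> k t It; have [r rN ht] := locate_node It.
  have /andP[h1 h2] := @position_between st m k r t hm rN ht.
  rewrite /drawn_height ler_pdivlMr ?ltr0n // ler_pdivrMr ?ltr0n // mul0r mul1r.
  rewrite addr_ge0 //=; last by apply: le_trans h1.
  rewrite -addn1 natrD lerD2r (le_trans h2) // ler_nat.
  by rewrite geq_max; apply/andP; split; apply: ltnW.
- exact: start.
- exact: final.
(* A strand is exchanged with at most one other strand in a step, so both partners of [j]
   coincide. *)
- move=> i j k t It ij jk ik [e1 e2]; have [r rN ht] := locate_node It.
  have sp := swapped_pos (proj2 hst r rN).
  case: (drawn_meet_step hst hm rN ht ij e1) => -[/sp[a1 a2 a3] _];
    case: (drawn_meet_step hst hm rN ht jk e2) => -[/sp[b1 b2 b3] _];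
    move/eqP: ik; apply; apply: (@perm_inj _ (st r)); apply: ord_inj; lia.
- move=> i j t It ij e; have [r rN [[sw ->]|[sw ->]]] := drawn_meet hst hm It ij e.
    by left; exact: drawn_crosses.
  by right; exact: drawn_crosses.
Qed.

(* [b] is the drawing of the movie [st] in which the crossing at position [p] of
   the [r]-th step takes place at time [m r p] and has the value [val r p]. *)
Record draws (b : vbd R n) st val m : Prop := Draws {
  draws_movie : movie st;
  draws_schedule : schedule m;
  draws_ht : forall k t, I01 t -> ht b k t = drawn_height st m k t;
  draws_value : forall r i j, (r < N)%N -> swapped (st r) (st r.+1) i j ->
    value b (m r (st r j), drawn_height st m i (m r (st r j))) = val r (st r j)
}.

Lemma exists_drawing st val m : movie st -> schedule m ->
  exists b, draws b st val m.
Proof.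
move=> hst hm; have [d _ dE] := height_functions_diagram (drawn_height_functions hst hm).
(* The value at a point is taken from any crossing found there. The choice does not matter: the time
   determines the step, because the windows of the schedule are disjoint, and the absence of triple
   points determines the pair. *)
pose P (pt : R * R) (x : nat * ('I_n * 'I_n)) := [/\ (x.1 < N)%N,
  swapped (st x.1) (st x.1.+1) x.2.1 x.2.2 &
  pt = (m x.1 (st x.1 x.2.2), drawn_height st m x.2.1 (m x.1 (st x.1 x.2.2)))].
pose v pt := if pselect (exists y, P pt y) is left e then
  val (sval (cid e)).1 (st (sval (cid e)).1 (sval (cid e)).2.2) else Virtual.
exists (VBD d v); split=> //.
  by move=> k t It; rewrite /ht clamp_id ?dE //; exact/I01E.
move=> r i j rN sw; rewrite /= /v; case: pselect => [e|[]]; last first.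
  by exists (r, (i, j)).
case: (cid e) => -[r' [i' j']] [/= rN' sw' [em eh]].
have rr : r' = r.
  have /andP[h1 h2] := hm r _ rN (ltn_ord (st r j)).
  have /andP[h3 h4] := hm r' _ rN' (ltn_ord (st r' j')).
  apply/eqP; case: ltngtP => // rr.
    by have := lt_le_trans h4 (node_le rr); rewrite -em => h; have := lt_trans h h1; rewrite ltxx.
  by have := lt_le_trans h2 (node_le rr); rewrite em => h; have := lt_trans h h3; rewrite ltxx.
subst r'; congr val; congr nat_of_ord.
have Im : I01 (m r (st r j)) := node_I01 rN (schedule_in hm rN (ltn_ord (st r j))).
have ij : i != j by apply/eqP => ij; move: sw; rewrite ij /swapped ltnNge ltnn andbF.
have [jj|jj] := eqVneq j' j; first by rewrite jj.
have meet : drawn_height st m i (m r (st r j)) = drawn_height st m j' (m r (st r j)).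
  by rewrite eh em drawn_swapped_eq.
have eij := drawn_swapped_eq hst hm rN sw.
have tri := hf_double (drawn_height_functions hst hm) Im.
have [ii|ii] := eqVneq i j'; last first.
  by case: (tri j' i j) => //; rewrite eq_sym.
subst j'; have [ij'|ij'] := eqVneq i' j.
  by subst i'; move: sw sw'; rewrite /swapped => /andP[h1 _] /andP[h2 _]; lia.
case: (tri i' i j) => //.
  by apply/eqP => e'; move: sw'; rewrite e' /swapped ltnn.
by split=> //; rewrite eh em.
Qed.

End Drawings.

(** * Isotopies between drawings, and diagrams that read words *)

Section DrawingIsotopy.
Variables (R : realType) (n : nat).
Local Open Scope classical_set_scope.
Local Open Scope ring_scope.
Implicit Types (b : vbd R n) (i j k : 'I_n) (s t : R) (st : nat -> 'S_n)
  (val : nat -> nat -> crossing_value) (x : nat -> R) (m : nat -> nat -> R).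

Section Fixed.
Variable N : nat.
Hypothesis N0 : (0 < N)%N.
Local Notation node := (@node R N).

Lemma node_unique r r' t : node r < t < node r.+1 -> node r' <= t <= node r'.+1 -> r = r'.
Proof.
move=> /andP[h1 h2] /andP[h3 h4]; apply/eqP; case: ltngtP => // rr.
  by have := lt_le_trans h2 (le_trans (node_le R N0 rr) h3); rewrite ltxx.
by have := lt_le_trans (le_lt_trans h4 (le_lt_trans (node_le R N0 rr) h1)) (lexx _); rewrite ltxx.
Qed.

Lemma swapped_neq (p q : 'S_n) i j : swapped p q i j -> i != j.
Proof. by move=> /andP[h _]; apply/eqP => ij; rewrite ij ltnn in h. Qed.

(** Schedules form a convex set, and the drawing depends continuously on the schedule. Crossings
    within one step may overtake each other, so this isotopy is not covered by
    [isotopic_follows]. *)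
Lemma isotopic_draws b b' st val m m' : draws N b st val m -> draws N b' st val m' ->
  isotopic b b'.
Proof.
move=> [hst hm hb vb] [_ hm' hb' vb'].
pose M s r p := (1 - s) * m r p + s * m' r p.
have M0 : M 0 = m.
  by apply/funext => r; apply/funext => p; rewrite /M subr0 mul1r mul0r addr0.
have M1 : M 1 = m'.
  by apply/funext => r; apply/funext => p; rewrite /M subrr mul1r mul0r add0r.
have hM s : I01 s -> schedule n N (M s).
  move=> /I01E/andP[s0 s1] r p rN pn.
  have /andP[a1 a2] := hm r p rN pn; have /andP[a3 a4] := hm' r p rN pn.
  have mixx (u : R) : u = (1 - s) * u + s * u by rewrite -mulrDl subrK mul1r.
  apply/andP; split; first rewrite [X in X < _]mixx; last rewrite [X in _ < X]mixx.
    by rewrite /M lt_mix ?s0 ?a1 ?a3 ?(lt_gtF a1) ?(lt_gtF a3).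
  by rewrite /M lt_mix ?s0 ?a2 ?a4 ?(lt_gtF a2) ?(lt_gtF a4).
have I0 : I01 (0 : R) by apply/I01E; rewrite lexx ler01.
have I1 : I01 (1 : R) by apply/I01E; rewrite lexx ler01.
pose cond (q : 'I_N * ('I_n * 'I_n)) := swapped (st q.1) (st q.1.+1) q.2.1 q.2.2.
have win s (r : 'I_N) (j : 'I_n) : I01 s -> node r < M s r (st r j) < node r.+1.
  by move=> Is; apply: (hM s Is).
have winI s (r : 'I_N) (j : 'I_n) : I01 s -> node r <= M s r (st r j) <= node r.+1.
  by move=> /(win s r j)/andP[h1 h2]; rewrite !ltW.
apply: (@isotopic_tracks R n b b' (st N) (fun s => drawn_height N st (M s))
  {q : 'I_N * ('I_n * 'I_n) | cond q} (fun q => (sval q).2)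
  (fun q s => M s (sval q).1 (st (sval q).1 (sval q).2.2))).
- by move=> k t It; rewrite hb // M0.
- by move=> k t It; rewrite hb' // M1.
- move=> k s t Is It; apply: cvg_drawn; [exact: hM| |exact: cvg_snd].
  have cs : (u.1 @[u --> (s, t)] --> s) by exact: cvg_fst.
  move=> r p; apply: cvgD; apply: cvgM; (try exact: cvg_cst) => //.
  by apply: cvgB => //; exact: cvg_cst.
- by move=> s Is; apply: drawn_height_functions => //; exact: hM.
- move=> q s; apply: cvgD; apply: cvgM; try exact: cvg_cst; try exact: cvg_id.
  by apply: cvgB; [exact: cvg_cst|exact: cvg_id].
- by move=> [[r [i j]] /= h] s Is; apply: (node_I01 N0 (ltn_ord r)); exact: winI.
- by move=> [[r [i j]] /= h]; exact: swapped_neq h.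
- by move=> [[r [i j]] /= h] s Is; apply: drawn_swapped_eq => //; exact: hM.
- move=> s t i j Is It ij e.
  have [r rN [[sw ->]|[sw ->]]] := drawn_meet N0 hst (hM s Is) It ij e.
    by exists (exist _ (Ordinal rN, (i, j)) sw); [|left].
  by exists (exist _ (Ordinal rN, (j, i)) sw); [|right].
- move=> [[r [i j]] /= h] [[r' [i' j']] /= h'] s Is e.
  have rr : r = r'.
    apply: ord_inj; apply: (@node_unique _ _ (M s r (st r j))); first exact: win.
    by rewrite e; exact: winI.
  subst r' => -[[ii jj]|[ij ji]]; subst i' j'; first exact: val_inj.
  have /andP[/= h1 _] := h; have /andP[/= h2 _] := h'.
  by move: (ltn_trans h1 h2); rewrite ltnn.
- move=> [[r [i j]] /= h]; rewrite M0 M1.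
  by rewrite (vb r i j (ltn_ord r) h) (vb' r i j (ltn_ord r) h).
Qed.

(** The times [c 0, ..., c (N - 1)] between 0 and 1, with the index shift of [follows]: the
    crossings of step [q] are at index [q.+1]. *)
Definition crossing_nodes (c : nat -> R) (q : nat) : R :=
  if q is q'.+1 then (if (q' < N)%N then c q' else 1) else 0.

Lemma draws_follows b st val m (c : nat -> R) : draws N b st val m ->
  (forall r, (r < N)%N -> node r < c r < node r.+1) ->
  (forall r p, (r < N)%N -> (p < n)%N -> m r p = c r) ->
  follows b N st val (crossing_nodes c).
Proof.
move=> [hst hm hb vb] hc mc.
have cI r : (r < N)%N -> I01 (c r).
  by move=> rN; apply: (node_I01 N0 rN); have /andP[h1 h2] := hc r rN; rewrite !ltW.
have inc : increasing_upto N.+1 (crossing_nodes c).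
  move=> [|r] rN /=.
    by rewrite N0; have /andP[h1 _] := hc 0%N N0; rewrite -(node_0 R N).
  rewrite ltnS in rN; rewrite rN; have /andP[_ h2] := hc r rN.
  case: ifP => rN'; first by have /andP[h3 _] := hc _ rN'; exact: lt_trans h2 h3.
  rewrite -(node_N R N0); apply: lt_le_trans h2 _; exact: node_le.
have cN : crossing_nodes c N.+1 = 1 by rewrite /= ltnn.
split=> //.
- move=> r t i j rN /andP[t1 t2].
  have It : I01 t.
    apply/I01E; rewrite -cN -[X in X <= t]/(crossing_nodes c 0%N).
    rewrite (le_trans _ (ltW t1)) ?(le_trans (ltW t2)) //; apply: (increasing_le inc);
      lia.
  rewrite !hb //.
  (* The gap [r] contains the node [r]: from the node on it is the part of step [r] before its
     crossings, up to the node the part of step [r - 1] after its crossings. *)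
  have [/andP[rN' h]|h] := boolP ((r < N)%N && (node r <= t)).
    have tc : t < c r by move: t2; rewrite /= rN'.
    have /andP[_ h2] := hc r rN'.
    apply: (drawn_before N0 _ _ hst hm rN'); first by rewrite h ltW // (lt_trans tc).
    by move=> k l sw; rewrite mc.
  case: r => [|r] in rN t1 t2 h *.
    by move: h; rewrite N0 node_0; case/I01E/andP: It => ->.
  have tc : c r < t by move: t1; rewrite /= rN.
  have /andP[h1 _] := hc r rN.
  apply: (drawn_after N0 _ _ hst hm rN); last by move=> k l sw; rewrite mc.
  rewrite (ltW (lt_trans h1 tc)) /=; move: h; rewrite negb_and -ltNge => /orP[|/ltW //].
  rewrite -leqNgt => Nr; have -> : r.+1 = N by apply/eqP; rewrite eqn_leq rN.
  by rewrite node_N //; case/I01E/andP: It.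
- move=> r i j rN ij; rewrite /= rN => e.
  have Ic := cI r rN; rewrite strandE //; move: e; rewrite !hb // => e.
  have hc' : node r <= c r <= node r.+1 by have /andP[h1 h2] := hc r rN; rewrite !ltW.
  have mr k : m r (st r k) = c r by apply: mc.
  have [[sw _]|[sw _]] := drawn_meet_step N0 hst hm rN hc' ij e.
    have := vb r i j rN sw; rewrite mr => ->.
    by case/andP: sw => h _; rewrite (minn_idPr (ltnW h)).
  have := vb r j i rN sw; rewrite mr -e => ->.
  by case/andP: sw => h _; rewrite (minn_idPl (ltnW h)).
Qed.

Definition mid_time (r : nat) : R := (node r + node r.+1) / 2.

Lemma mid_time_in r : node r < mid_time r < node r.+1.
Proof. by apply: mid_lt; exact: node_lt. Qed.

Lemma schedule_mid : schedule n N (fun r _ => mid_time r).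
Proof. by move=> r p _ _; exact: mid_time_in. Qed.

Lemma draws_mid_follows b st val : draws N b st val (fun r _ => mid_time r) ->
  follows b N st val (crossing_nodes mid_time).
Proof. by move=> d; apply: (draws_follows d) => // r _; exact: mid_time_in. Qed.

End Fixed.

Lemma follows_ext b N st st' val val' x : (forall r, (r <= N)%N -> st r = st' r) ->
  (forall r p, (r < N)%N -> val r p = val' r p) ->
  follows b N st val x -> follows b N st' val' x.
Proof.
move=> est eval [h1 h2 h3 h4 h5]; split=> //.
  by move=> r t i j rN ht; rewrite -est //; exact: h4.
by move=> r i j rN ij e; rewrite -est ?(ltnW rN) // -eval //; exact: h5.
Qed.

(** A node at which no pair is exchanged carries no crossing, so the two adjacent gaps merge, the
    order at the node itself being that of [st r0]. The bumps omit the state and the node with index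
    [r0.+1] and the value with index [r0]. *)
Lemma follows_skip b N st val x r0 : follows b N.+1 st val x -> (r0 <= N)%N ->
  st r0.+1 = st r0 ->
  follows b N (fun q => st (bump r0.+1 q)) (fun q => val (bump r0 q)) (fun q => x (bump r0.+1 q)).
Proof.
move=> F r0N e; have inc := follows_incr F.
have bl q : (q <= r0)%N -> bump r0.+1 q = q by rewrite /bump; case: ltnP; lia.
have bg q : (r0 < q)%N -> bump r0.+1 q = q.+1 by rewrite /bump; case: ltnP; lia.
have bl' q : (q < r0)%N -> bump r0 q = q by rewrite /bump; case: leqP; lia.
have bg' q : (r0 <= q)%N -> bump r0 q = q.+1 by rewrite /bump; case: leqP; lia.
split.
- move=> q qN; have [h|h|h] := ltngtP q r0.
  + by rewrite (bl q) ?(ltnW h) // (bl q.+1) //; apply: inc; lia.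
  + by rewrite (bg q) // (bg q.+1); [apply: inc; lia|lia].
  + rewrite h (bl r0) // (bg r0.+1) //; apply: (increasing_lt inc); lia.
- by rewrite (bl 0%N) // (follows_0 F).
- by rewrite (bg N.+1) // (follows_1 F).
- move=> q t i j qN; have [h|h|h] := ltngtP q r0.
  + by rewrite (bl q) ?(ltnW h) // (bl q.+1) // => ht; apply: (follows_gap F) => //; lia.
  + rewrite (bg q) // (bg q.+1); last by lia.
    by move=> ht; apply: (follows_gap F).
  + rewrite h (bl r0) // (bg r0.+1) // => /andP[t1 t2].
    have [->|ij] := eqVneq i j; first by rewrite ltxx ltnn.
    have [tx|tx|tx] := ltgtP t (x r0.+1).
    * by apply: (follows_gap F); rewrite ?t1 //; lia.
    * by rewrite -e; apply: (follows_gap F); rewrite ?t2 ?tx //; lia.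
    * by rewrite tx (follows_node F) // e andbb.
- move=> q i j qN ij; have [h|h|h] := ltngtP q r0.
  + rewrite bl' // (bl q) ?(ltnW h) // (bl q.+1) //; apply: (follows_value F) => //; lia.
  + rewrite bg' ?(ltnW h) // (bg q) // (bg q.+1) ?(ltnW h) //; last by lia.
    by apply: (follows_value F).
  + by rewrite h (bg' r0) // (bl r0) // (bg r0.+1) // -e; apply: (follows_value F); rewrite // -h; lia.
Qed.

Definition word_state (w : seq letter) (r : nat) : 'S_n := word_perm n (take r w).

Definition word_value (w : seq letter) (r p : nat) : crossing_value :=
  (nth (0%N, Virtual) w r).2.

Lemma word_stateS w r : (r < size w)%N ->
  word_state w r.+1 = (word_state w r * adj_swap n (nth (0%N, Virtual) w r).1)%g.
Proof.
by move=> rw; rewrite /word_state (take_nth (0%N, Virtual)) // -cats1 word_perm_cat word_perm1.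
Qed.

Lemma adj_swap_step (p : 'S_n) (i : nat) : movie_step p (p * adj_swap n i)%g.
Proof.
move=> k; rewrite permM; have [hi|hi] := boolP (0 < i < n)%N; last first.
  left; rewrite adj_swapE; case: ifP => // hin; have -> : i = 0%N by lia.
  by case: eqP => // ->.
have [a [c [ha hc ->]]] := adj_swap_tperm hi.
case: tpermP => [pa|pc|_ _]; [right|right|by left].
  exists (p^-1%g c); rewrite permM permKV tpermR -pa; split=> //.
  by apply/orP; left; apply/eqP; rewrite pa; lia.
exists (p^-1%g a); rewrite permM permKV tpermL -pc; split=> //.
by apply/orP; right; apply/eqP; rewrite pc; lia.
Qed.

Lemma word_movie w N : (N <= size w)%N -> movie N (word_state w).
Proof.
move=> Nw; split; first by rewrite /word_state take0 word_perm_nil.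
by move=> r rN; rewrite word_stateS ?(leq_trans rN) //; exact: adj_swap_step.
Qed.

Definition reads_word b w : Prop :=
  exists x, follows b (size w) (word_state w) (word_value w) x.

Lemma isotopic_reads_word b b' w : reads_word b w -> reads_word b' w -> isotopic b b'.
Proof. by move=> [x F] [x' F']; exact: isotopic_follows F F'. Qed.

Lemma reads_word_perm b w : reads_word b w -> strand_perm b = word_perm n w.
Proof. by move=> [x /follows_end ->]; rewrite /word_state take_size. Qed.

Lemma draws_word_reads b w : (0 < size w)%N ->
  draws (size w) b (word_state w) (word_value w) (fun r _ => @mid_time (size w) r) ->
  reads_word b w.
Proof. by move=> w0 d; eexists; exact: draws_mid_follows d. Qed.

Lemma reads_word_idle b w1 l w2 : adj_swap n l.1 = 1%g ->
  reads_word b (w1 ++ l :: w2) -> reads_word b (w1 ++ w2).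
Proof.
move=> l1 [x]; have -> : size (w1 ++ l :: w2) = (size (w1 ++ w2)).+1.
  by rewrite !size_cat /= addnS.
move=> F; eexists; apply: follows_ext (follows_skip (r0 := size w1) F _ _).
- move=> r rw; rewrite /word_state; case: (leqP r (size w1)) => h.
    have -> : bump (size w1).+1 r = r by rewrite /bump; case: ltnP; lia.
    rewrite !take_cat; case: ltnP => // h'.
    have -> : (r - size w1 = 0)%N by lia.
    by rewrite !take0.
  have -> : bump (size w1).+1 r = r.+1 by rewrite /bump h.
  rewrite !take_cat ltnNge leqW ?(ltnW h) //= ltnNge ltnW //=.
  by rewrite subSn ?(ltnW h) //= !word_perm_cat word_perm_cons l1 mul1g.
- move=> r p rw; rewrite /word_value !nth_cat; case: (ltnP r (size w1)) => h.
    have -> : bump (size w1) r = r by rewrite /bump leqNgt h.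
    by rewrite h.
  have -> : bump (size w1) r = r.+1 by rewrite /bump h.
  by rewrite ltnNge leqW //= subSn.
- by rewrite size_cat leq_addr.
- rewrite word_stateS; last by rewrite size_cat /= addnS ltnS leq_addr.
  by rewrite nth_cat ltnn subnn /= l1 mulg1.
Qed.

Lemma exists_reads_word w : exists b, reads_word b w.
Proof.
(* A drawing needs at least one step; the idle letter [tau 0] ensures this for the empty word and is
   erased afterwards. *)
have [b hb] : exists b, reads_word b (rcons w (tau 0)).
  have w0 : (0 < size (rcons w (tau 0)))%N by rewrite size_rcons.
  have [b hb] := exists_drawing w0 (word_value (rcons w (tau 0)))
    (word_movie (leqnn _)) (@schedule_mid _ w0).
  by exists b; apply: draws_word_reads.
exists b; rewrite -[w]cats0; apply: (@reads_word_idle _ w (tau 0)); last by rewrite cats1.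
apply/permP => k; apply: ord_inj; rewrite perm1 adj_swapE.
by case: ifP => //= _; case: eqP => // ->.
Qed.

End DrawingIsotopy.

(** * Every diagram is equivalent to one that reads a word *)

Section Ranks.
Variables (R : realType) (n : nat).
Local Open Scope ring_scope.
Implicit Types (i j k l : 'I_n) (s t : R).

Lemma ht_order_const (b : strand_diagram R n) i j a c : a <= c ->
  (forall s, a <= s <= c -> ht b i s <> ht b j s) ->
  (ht b i a < ht b j a) = (ht b i c < ht b j c).
Proof.
move=> ac h; rewrite -[LHS]subr_gt0 -[RHS]subr_gt0.
apply: (@nonzero_pos R (fun s => ht b j s - ht b i s)) => //.
  by move=> s; apply: cvgB; exact: continuous_ht.
by move=> s hs; rewrite subr_eq0; apply/eqP => e; apply: (h s hs).
Qed.

Variables (b : strand_diagram R n) (K : {set 'I_n}).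

Definition rank t k : nat := #|[set l in K | ht b l t < ht b k t]|.

Lemma rank_eq s t k : (forall l, l \in K -> (ht b l s < ht b k s) = (ht b l t < ht b k t)) ->
  rank s k = rank t k.
Proof. by move=> h; apply: eq_card => l; rewrite !inE; case lK: (l \in K) => //=; rewrite h. Qed.

Variables (a t c : R).
Hypothesis at_ : a < t.
Hypothesis tc : t < c.
Hypothesis only : forall s i j, i \in K -> j \in K -> i != j -> a <= s <= c -> s != t ->
  ht b i s <> ht b j s.

Let order_side i j s : i \in K -> j \in K -> a <= s <= c -> ht b i t < ht b j t ->
  ht b i s < ht b j s.
Proof.
move=> iK jK /andP[as_ sc] ltij.
have ij : i != j by apply/eqP => e; rewrite e ltxx in ltij.
have nomeet u : a <= u <= c -> ht b i u <> ht b j u.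
  have [->|ut] := eqVneq u t; last by move=> hu; exact: only.
  by move=> _ e; rewrite e ltxx in ltij.
case: (leP s t) => st.
  rewrite (ht_order_const st) // => u /andP[su ut]; apply: nomeet.
  by rewrite (le_trans as_ su) (le_trans ut) // ltW.
rewrite -(ht_order_const (ltW st)) // => u /andP[tu us]; apply: nomeet.
by rewrite (le_trans (ltW at_) tu) (le_trans us).
Qed.

Lemma rank_step_alone k s : k \in K -> a <= s <= c ->
  (forall l, l \in K -> l != k -> ht b l t <> ht b k t) -> rank s k = rank t k.
Proof.
move=> kK hs alone; apply: rank_eq => l lK.
have [->|lk] := eqVneq l k; first by rewrite !ltxx.
have [h|h|h] := ltgtP (ht b l t) (ht b k t).
- by rewrite order_side.
- by apply/negbTE; rewrite -leNgt ltW // order_side.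
- by case: (alone l lK lk).
Qed.

Variables i j : 'I_n.
Hypothesis iK : i \in K.
Hypothesis jK : j \in K.
Hypothesis ij : i != j.
Hypothesis It : I01 t.
Hypothesis meet : ht b i t = ht b j t.

(** Every strand of [K] that is not at the crossing stays on its side of it during the whole
    interval. Compared with time [t], the count of strands below can thus only grow by the
    partner. *)
Let rank_side k s : k \in [set i; j] -> a <= s <= c ->
  rank s k = (rank t i + [exists l in [set i; j], (ht b l s < ht b k s)%R])%N.
Proof.
move=> kij hs; have kK : k \in K by move: kij; rewrite !inE => /orP[]/eqP->.
have kt : ht b k t = ht b i t by move: kij; rewrite !inE => /orP[]/eqP->.
case: existsP => [[l /andP[lij hl]]|no].
  rewrite addn1 /rank (cardsD1 l) !inE hl andbT.
  have -> : l \in K by move: lij; rewrite !inE => /orP[]/eqP->.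
  rewrite add1n; congr S; apply: eq_card => m; rewrite !inE -kt.
  have [->|ml] := eqVneq m l.
    apply/esym/negbTE; rewrite negb_and -leNgt orbC.
    by move: lij; rewrite kt !inE => /orP[]/eqP->; rewrite ?meet lexx.
  rewrite /=; case mK: (m \in K) => //=.
  have [->|mk] := eqVneq m k; first by rewrite !ltxx.
  have [h|h|h] := ltgtP (ht b m t) (ht b k t).
  - by rewrite order_side.
  - by apply/negbTE; rewrite -leNgt ltW // order_side.
  exfalso; have lk : l != k by apply/eqP => e; rewrite e ltxx in hl.
  have lt : ht b l t = ht b k t.
    by move: lij; rewrite kt !inE => /orP[]/eqP->; rewrite ?meet.
  by apply: (@no_triple _ _ b m l k t) => //; split=> //; rewrite h lt.
rewrite addn0; apply: eq_card => m; rewrite !inE -kt; case mK: (m \in K) => //=.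
have [h|h|h] := ltgtP (ht b m t) (ht b k t).
- by rewrite order_side.
- by apply/negbTE; rewrite -leNgt ltW // order_side.
apply/negbTE/negP => hm; apply: no; exists m; rewrite hm andbT.
apply: contraT => mij.
have [mk kij2] : m != k /\ exists2 l, l \in [set i; j] & l != k.
  split; first by apply/eqP => e; rewrite e ltxx in hm.
  by have [<-|ik] := eqVneq i k; [exists j; rewrite ?inE ?eqxx ?orbT // eq_sym|exists i; rewrite ?inE ?eqxx].
have [l lij lk] := kij2.
have lt : ht b l t = ht b k t.
  by move: lij; rewrite kt !inE => /orP[]/eqP->; rewrite ?meet.
have ml : m != l by apply/eqP => e; rewrite e lij in mij.
by case: (@no_triple _ _ b m l k t) => //; split=> //; rewrite h lt.
Qed.

Hypothesis cross : crosses (ht b) i j t.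

Lemma rank_step_lt : ht b j a < ht b i a /\ ht b i c < ht b j c.
Proof.
have /crossesE[[a' a't ha] [c' tc' hc]] := cross.
have no s : a <= s <= c -> s != t -> ht b i s <> ht b j s by apply: only.
split.
  have m : Num.max a a' < t by rewrite gt_max at_ a't.
  have := mid_lt m; set u := _ / 2; rewrite gt_max => /andP[/andP[h1 h2] h3].
  rewrite (ht_order_const (ltW h1)); first by apply: ha; rewrite h2.
  move=> s /andP[as_ su] /esym; apply: no.
    by rewrite as_ (le_trans su) // ltW // (lt_trans h3).
  by rewrite lt_eqF // (le_lt_trans su).
have m : t < Num.min c c' by rewrite lt_min tc tc'.
have := mid_lt m; set u := _ / 2; rewrite lt_min => /andP[h3 /andP[h1 h2]].
rewrite -(ht_order_const (ltW h1)); first by apply: hc; rewrite h3.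
move=> s /andP[us sc]; apply: no.
  by rewrite sc andbT (le_trans _ us) // ltW // (lt_trans at_).
by rewrite gt_eqF // (lt_le_trans h3).
Qed.

Lemma rank_step_cross : [/\ rank a i = (rank t i).+1, rank a j = rank t i,
  rank c i = rank t i & rank c j = (rank t i).+1].
Proof.
have [ha hc] := rank_step_lt.
have acin : a <= a <= c by rewrite lexx ltW // (lt_trans at_).
have ccin : a <= c <= c by rewrite lexx ltW // (lt_trans at_).
have ii : i \in [set i; j] by rewrite !inE eqxx.
have jj : j \in [set i; j] by rewrite !inE eqxx orbT.
split; rewrite rank_side //.
- rewrite (_ : [exists l in _, _]) ?addn1 //.
  by apply/existsP; exists j; rewrite jj.
- rewrite (_ : [exists l in _, _] = false) ?addn0 //.
  by apply/existsP => -[l]; rewrite !inE => /andP[/orP[]/eqP-> h];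
    [have := lt_trans h ha|move: h]; rewrite ltxx.
- rewrite (_ : [exists l in _, _] = false) ?addn0 //.
  by apply/existsP => -[l]; rewrite !inE => /andP[/orP[]/eqP-> h];
    [move: h|have := lt_trans h hc]; rewrite ltxx.
- rewrite (_ : [exists l in _, _]) ?addn1 //.
  by apply/existsP; exists i; rewrite ii.
Qed.

End Ranks.

Section MovieOfDiagram.
Variables (R : realType) (n : nat).
Local Open Scope ring_scope.
Implicit Types (b : vbd R n) (i j k l : 'I_n) (s t : R).

Lemma crossing_times (b : strand_diagram R n) : exists s : seq R, sorted <%R s /\
  forall t, t \in s <-> I01 t /\ exists i j, i != j /\ ht b i t = ht b j t.
Proof.
pose T (ij : 'I_n * 'I_n) : set R :=
  [set t | ij.1 != ij.2 /\ I01 t /\ b ij.1 t = b ij.2 t]%classic.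
have /finite_seqP[s hs] : finite_set (\bigcup_(ij in [set: 'I_n * 'I_n]) T ij)%classic.
  apply: bigcup_finite; first exact: finite_finset.
  move=> [i j] _; have [->|ij] := eqVneq i j.
    apply: (@sub_finite_set _ _ set0); last exact: finite_set0.
    by move=> t []; rewrite eqxx.
  by apply: sub_finite_set (finite_crossing_times b ij) => t [].
exists (sort <=%R (undup s)); split.
  rewrite lt_sorted_uniq_le sort_uniq undup_uniq /=.
  exact: (sort_sorted (@le_total _ R)).
move=> t; rewrite mem_sort mem_undup.
have -> : (t \in s) = ([set` s]%classic t) :> Prop by [].
rewrite -hs; split=> [[[i j] _ [ij [It e]]]|[It [i [j [ij e]]]]].
  by split=> //; exists i, j; split=> //; apply/strand_eqP.
by exists (i, j) => //; split=> //; split=> //; apply/strand_eqP.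
Qed.

Lemma rank_lt (b : strand_diagram R n) (K : {set 'I_n}) t i j : i \in K ->
  ht b i t < ht b j t -> (rank b K t i < rank b K t j)%N.
Proof.
move=> iK h; apply/proper_card/properP; split.
  by apply/fintype.subsetP => l; rewrite !inE => /andP[-> h']; exact: lt_trans h' h.
by exists i; rewrite !inE iK ?h // ltxx.
Qed.

Lemma rank_perm (b : strand_diagram R n) t :
  (forall i j, i != j -> ht b i t <> ht b j t) ->
  exists p : 'S_n, forall i j, (ht b i t < ht b j t) = (p i < p j)%N.
Proof.
move=> no; pose r k := rank b [set: 'I_n]%SET t k.
have rn k : (r k < n)%N.
  rewrite /r /rank; have := ltnSn #|[set l in [set: 'I_n]%SET | (ht b l t < ht b k t)%R]|.
  move=> h; apply: leq_trans h _; apply: leq_trans (_ : #|[set: 'I_n]%SET| <= _)%N; last by rewrite cardsT card_ord.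
  apply/proper_card/properP; split; first exact: finset.subsetT.
  by exists k; rewrite !inE // ltxx.
have lt i j : ht b i t < ht b j t -> (r i < r j)%N by move=> h; apply: rank_lt; rewrite ?finset.in_setT.
have inj : injective (fun k => Ordinal (rn k)).
  move=> i j [e]; apply/eqP/contraT => ij.
  by have [/lt|/lt|/(no i j ij)//] := ltgtP (ht b i t) (ht b j t); rewrite e ltnn.
exists (perm inj) => i j; rewrite !permE /=; have [->|ij] := eqVneq i j.
  by rewrite ltxx ltnn.
have [h|h|/(no i j ij)//] := ltgtP (ht b i t) (ht b j t); first by rewrite lt.
by apply/esym/negbTE; rewrite -leqNgt ltnW // lt.
Qed.

(** Between consecutive crossing times no strands meet, so the order is constant and is read off in
    the middle of the gap. Across a crossing time the ranks of a meeting pair are exchanged and all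
    others stay, which gives a step of a movie. *)
Lemma exists_movie b : exists N st val x, [/\ follows b N st val x, movie N st &
  forall r, (r < N)%N -> exists i j, swapped (st r) (st r.+1) i j].
Proof.
have [s [so hs]] := crossing_times b.
pose N := size s; pose x r := nth 1 (0 :: s) r.
have sN : size s = N by [].
have meet_in t i j : I01 t -> i != j -> ht b i t = ht b j t -> 0 < t < 1 by exact: ht_meet_interior.
have s01 t : t \in s -> 0 < t < 1 by move=> /hs[It [i [j [ij e]]]]; exact: meet_in e.
have inc : increasing_upto N.+1 x.
  move=> r; rewrite ltnS leq_eqVlt => /orP[/eqP ->|rN].
    rewrite /x [X in _ < X]nth_default //=.
    case E : N => [|M] /=; first exact: ltr01.
    have /s01/andP[] // : nth 1 s M \in s by rewrite mem_nth // sN E.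
  case: r rN => [|r] rN.
    by rewrite /x /=; have /s01/andP[] // : nth 1 s 0 \in s by rewrite mem_nth.
  by rewrite /x /=; apply: (sorted_ltn_nth lt_trans) => //; rewrite inE sN; lia.
have x0 : x 0%N = 0 by [].
have x1 : x N.+1 = 1 by rewrite /x nth_default.
have gapI r t : (r <= N)%N -> x r < t < x r.+1 -> 0 < t < 1.
  move=> rN /andP[h1 h2]; rewrite -x0 -x1; apply/andP; split.
    by apply: le_lt_trans h1; apply: (increasing_le inc); lia.
  by apply: lt_le_trans h2 _; apply: (increasing_le inc); lia.
have gap r t : (r <= N)%N -> x r < t < x r.+1 -> forall i j, i != j -> ht b i t <> ht b j t.
  move=> rN ht i j ij e; have /andP[t0 t1] := gapI r t rN ht.
  have ts : t \in s by apply/hs; split; [apply/I01E; rewrite !ltW|exists i, j].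
  case/andP: ht => h1 h2.
  have xq : t = x (index t s).+1 by rewrite /x /= nth_index.
  have qN : (index t s < N)%N by rewrite -sN index_mem.
  have [h|h] := leqP (index t s).+1 r.
    have := increasing_le inc (_ : (index t s).+1 <= r <= N.+1)%N; rewrite -xq h leqW //.
    by move=> /(_ isT) h3; have := lt_le_trans h1 h3; rewrite ltxx.
  have := increasing_le inc (_ : r.+1 <= (index t s).+1 <= N.+1)%N; rewrite -xq h ltnW //.
  by move=> /(_ isT) h3; have := lt_le_trans h2 h3; rewrite ltxx.
pose mid r := (x r + x r.+1) / 2.
have midP r : (r <= N)%N -> x r < mid r < x r.+1 by move=> rN; apply/mid_lt/inc.
have /choice[st hst] : forall r, exists p : 'S_n, (r <= N)%N -> forall t i j,
    x r < t < x r.+1 -> (ht b i t < ht b j t) = (p i < p j)%N.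
  move=> r; have [rN|_] := leqP r N; last by exists 1%g.
  have [p hp] := rank_perm (gap r _ rN (midP r rN)); exists p => _ t i j ht.
  rewrite -hp; have [->|ij] := eqVneq i j; first by rewrite !ltxx.
  have /andP[h1 h2] := midP r rN; case/andP: ht => h3 h4.
  have [h|/ltW h] := leP t (mid r).
    apply: ht_order_const => // u /andP[u1 u2]; apply: (gap r) => //.
    by rewrite (lt_le_trans h3) // (le_lt_trans u2).
  apply/esym; apply: ht_order_const => // u /andP[u1 u2]; apply: (gap r) => //.
  by rewrite (lt_le_trans h1) // (le_lt_trans u2).
(* The value at the point reached by the strand in position [p]; [follows] asks for it at the lower
   strand of a crossing. *)
pose val r p := if insub p is Some q then value b (b ((st r)^-1%g q) (x r.+1)) else Virtual.
have F : follows b N st val x.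
  split=> //; first by move=> r t i j rN; exact: hst.
  move=> r i j rN ij e.
  have Ix : I01 (x r.+1).
    by apply/I01E; rewrite -x0 -x1; apply/andP; split; apply: (increasing_le inc); lia.
  have valk k : val r (st r k) = value b (b k (x r.+1)) by rewrite /val valK permK.
  case: (leqP (st r i) (st r j)) => h; rewrite valk //.
  by congr value; apply/strand_eqP.
have rkst r k : (r <= N)%N -> rank b [set: 'I_n]%SET (mid r) k = st r k.
  move=> rN; rewrite -[RHS](card_perm_lt (st r) (ltnW (ltn_ord (st r k)))).
  by apply: eq_card => l; rewrite !inE /= (hst r) // midP.
have xr r : (r < N)%N -> x r.+1 \in s by move=> rN; rewrite /x /= mem_nth.
exists N, st, val, x; split=> //.
- split.
    apply: perm_lt_eq => i j; rewrite !perm1.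
    have [->|ij] := eqVneq i j; first by rewrite !ltnn.
    have lt k l : k != l -> (k < l)%N -> (st 0%N k < st 0%N l)%N.
      move=> kl; rewrite -(@height_lt R) -!(@ht0 R n b).
      move=> /(lt_before_after (@continuous_ht R n b))[_ h].
      by apply: (follows_after_lt F (leq0n N)).
    apply/idP/idP; last exact: lt.
    move=> h; have := lt j i; rewrite eq_sym => /(_ ij) h'.
    rewrite ltnNge; apply/negP; rewrite leq_eqVlt => /orP[/eqP/ord_inj ji|/h'].
      by rewrite ji eqxx in ij.
    by lia.
  move=> r rN k; have rN' := ltnW rN.
  have /andP[a1 a2] := midP r rN'; have /andP[c1 c2] := midP r.+1 rN.
  have /hs[Ix _] := xr r rN.
  have only u i j : i \in [set: 'I_n]%SET -> j \in [set: 'I_n]%SET -> i != j ->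
      mid r <= u <= mid r.+1 -> u != x r.+1 -> ht b i u <> ht b j u.
    move=> _ _ ij /andP[u1 u2]; rewrite neq_lt => /orP[h|h].
      by apply: (gap r) => //; rewrite h (lt_le_trans a1).
    by apply: (gap r.+1) => //; rewrite h (le_lt_trans u2).
  have ac1 : mid r <= mid r <= mid r.+1 by rewrite lexx ltW // (lt_trans a2).
  have ac2 : mid r <= mid r.+1 <= mid r.+1 by rewrite lexx andbT ltW // (lt_trans a2).
  have [[l [lk e]]|alone] := pselect (exists l, l != k /\ ht b l (x r.+1) = ht b k (x r.+1)).
    right; exists l; have [cr|cr] := ht_crosses Ix lk e.
      have [] := rank_step_cross a2 c1 only (finset.in_setT l) (finset.in_setT k) lk Ix e cr.
      by rewrite !rkst // => e1 e2 e3 e4; split; [apply: ord_inj|apply: ord_inj|]; rewrite ?e1 ?e2 ?e3 ?e4 ?eqxx ?orbT.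
    rewrite eq_sym in lk; have [] := rank_step_cross a2 c1 only (finset.in_setT k) (finset.in_setT l) lk Ix (esym e) cr.
    by rewrite !rkst // => e1 e2 e3 e4; split; [apply: ord_inj|apply: ord_inj|]; rewrite ?e1 ?e2 ?e3 ?e4 ?eqxx ?orbT.
  have al l : l \in [set: 'I_n]%SET -> l != k -> ht b l (x r.+1) <> ht b k (x r.+1).
    by move=> _ lk e; apply: alone; exists l.
  left; rewrite -!rkst // (rank_step_alone a2 c1 only (finset.in_setT k) ac1 al).
  by rewrite (rank_step_alone a2 c1 only (finset.in_setT k) ac2 al).
- move=> r rN; have /hs[Ix [i [j [ij e]]]] := xr r rN.
  by have [/(follows_node_crosses _ _ F rN) h|/(follows_node_crosses _ _ F rN) h] :=
    ht_crosses Ix ij e; [exists i, j|exists j, i].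
Qed.

(** The hypothesis allows one crossing at a time, so every step of the movie is a single adjacent
    transposition and becomes a letter. With the lower position [p] counted from 0, the letter is
    [p.+1]. *)
Lemma generic_reads_word b :
  (forall t i j i' j', I01 t -> i != j -> i' != j' -> ht b i t = ht b j t ->
     ht b i' t = ht b j' t -> i' = i \/ i' = j) ->
  exists2 w, all (valid_letter n) w & reads_word b w.
Proof.
move=> gen; have [N [st [val [x [F [st0 mst] hex]]]]] := exists_movie b.
have Ix r : (r < N)%N -> I01 (x r.+1) by move=> rN; apply: (follows_node_I01 F); lia.
have meet r i j : (r < N)%N -> swapped (st r) (st r.+1) i j ->
    ht b i (x r.+1) = ht b j (x r.+1).
  move=> rN sw; have ij := swapped_neq sw; have ji : j != i by rewrite eq_sym.
  apply/eqP; rewrite eq_le !leNgt (follows_node F rN ij) (follows_node F rN ji).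
  by case/andP: sw => h1 h2; apply/andP; split; apply/negP; lia.
have /choice[P hP] : forall r, exists p, (r < N)%N -> [/\ (p.+1 < n)%N,
    st r.+1 = (st r * adj_swap n p.+1)%g & forall i j, i != j ->
    ht b i (x r.+1) = ht b j (x r.+1) -> minn (st r i) (st r j) = p].
  move=> r; have [rN|_] := ltnP r N; last by exists 0%N.
  have [i [j sw]] := hex r rN; exists (st r j) => _.
  have ij := swapped_neq sw; have e := meet r i j rN sw.
  have [e1 e2 e3] := swapped_pos (mst r rN) sw.
  have pn : ((st r j).+1 < n)%N by rewrite -e1.
  have pair k l : k != l -> ht b k (x r.+1) = ht b l (x r.+1) -> k = i \/ k = j.
    by move=> kl e'; exact: (gen (x r.+1) i j k l (Ix r rN) ij kl e e').
  split=> //.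
    apply/permP => k; apply: ord_inj; rewrite permM adj_swapE pn /=.
    have [->|ki] := eqVneq k i; first by rewrite e1 e2 eqxx gtn_eqF.
    have [->|kj] := eqVneq k j; first by rewrite eqxx e3 e1.
    have ne m : k != m -> (st r k == st r m :> nat) = false.
      by move=> km; apply/negP => /eqP/ord_inj/perm_inj e'; rewrite e' eqxx in km.
    rewrite -e1 !ne //; have [//|[l [q1 q2 q3]]] := mst r rN k.
    have kl : k != l by apply/eqP => kl; subst l; move: q3; lia.
    have e' : ht b k (x r.+1) = ht b l (x r.+1).
      case/orP: q3 => /eqP q3; last by apply: meet => //; apply/andP; rewrite q1 q2 q3; split.
      by apply/esym/meet => //; apply/andP; rewrite q1 q2 q3; split.
    by case: (pair k l kl e') => h; rewrite h eqxx in ki kj.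
  move=> k l kl e'; have lk : l != k by rewrite eq_sym.
  have [ek|ek] := pair k l kl e'; have [el|el] := pair l k lk (esym e').
  - by rewrite ek el eqxx in kl.
  - by rewrite ek el e1; lia.
  - by rewrite ek el e1; lia.
  - by rewrite ek el eqxx in kl.
pose w : seq letter := mkseq (fun r => ((P r).+1, val r (P r))) N.
have sw : size w = N by rewrite size_mkseq.
have wst r : (r <= N)%N -> word_state n w r = st r.
  elim: r => [|r IH] rN; first by rewrite /word_state take0 word_perm_nil st0.
  rewrite word_stateS ?sw // IH ?(ltnW rN) // nth_mkseq //=.
  by have [_ -> _] := hP r rN.
exists w; first by apply/(all_nthP (0%N, Virtual)) => r; rewrite sw => rN; rewrite nth_mkseq //;
  have [h _ _] := hP r rN.
exists x; rewrite sw; case: F => h1 h2 h3 h4 h5; split=> //.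
  by move=> r t i j rN ht; rewrite wst //; exact: h4.
move=> r i j rN ij e; rewrite (h5 r i j rN ij e) /word_value nth_mkseq //=.
by have [_ _ h] := hP r rN; rewrite (h i j ij e).
Qed.

Lemma exists_word b : exists w b', [/\ all (valid_letter n) w, reads_word b' w &
  virtually_equivalent b b'].
Proof.
have [N [st [val [x [F hst _]]]]] := exists_movie b.
have [N0|N0] := posnP N.
  exists [::], b; split=> //; last exact: rst_refl.
  exists x; subst N; apply: follows_ext F; last by [].
  by move=> r; rewrite leqn0 => /eqP ->; case: hst => -> _; rewrite /word_state word_perm_nil.
have [d0 h0] := exists_drawing N0 val hst (@schedule_mid R n N N0).
(* Perturbed times: the crossing in position [p] takes place at the fraction [(p + 1) / (n + 1)] of
   its step, so different positions get different times, all inside the step. *)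
pose m r p : R := node R N r + (p.+1%:R / n.+1%:R) * (node R N r.+1 - node R N r).
have hm : schedule n N m.
  move=> r p rN pn; have h := node_lt R N0 r.
  have q0 : 0 < p.+1%:R / n.+1%:R :> R by rewrite divr_gt0 ?ltr0n.
  have q1 : p.+1%:R / n.+1%:R < 1 :> R by rewrite ltr_pdivrMr ?ltr0n // mul1r ltr_nat.
  rewrite /m ltrDl mulr_gt0 ?subr_gt0 //= -ltrBrDl.
  by rewrite -[X in _ < X]mul1r ltr_pM2r ?subr_gt0.
have minj r p q : m r p = m r q -> p = q.
  move=> /addrI/mulIf; rewrite subr_eq0 gt_eqF ?node_lt // => /(_ isT).
  move=> /mulIf; rewrite invr_eq0 pnatr_eq0 => /(_ isT)/eqP.
  by rewrite eqr_nat eqSS => /eqP.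
have [d1 h1] := exists_drawing N0 val hst hm.
have [|w vw rw] := @generic_reads_word d1.
  move=> t i j i' j' It ij ij'; rewrite !(draws_ht h1) // => e e'.
  have [r rN ht] := locate_node N0 It; have sp := swapped_pos (proj2 hst r rN).
  have st_inj k l : st r k = st r l :> nat -> k = l by move=> /ord_inj/perm_inj.
  case: (drawn_meet_step N0 hst hm rN ht ij e) => -[/sp[a1 a2 a3] et];
    case: (drawn_meet_step N0 hst hm rN ht ij' e') => -[/sp[b1 b2 b3] et'];
    rewrite et in et'; move/minj: et' => et'.
  - by left; apply: st_inj; rewrite a1 b1 et'.
  - by right; apply: st_inj.
  - by right; apply: st_inj; rewrite a1 b1 et'.
  - by left; apply: st_inj.
exists w, d1; split=> //.
apply: (@rst_trans _ _ _ d0); apply: rst_step; left.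
  exact: isotopic_follows F (draws_mid_follows N0 h0).
exact: isotopic_draws h0 h1.
Qed.

End MovieOfDiagram.

(** * Moves on words are moves on diagrams *)

Section VerticalStrip.
Variable R : realType.
Local Open Scope classical_set_scope.
Local Open Scope ring_scope.
Variables t0 t1 : R.
Hypothesis t0_ge0 : 0 <= t0.
Hypothesis t0_lt : t0 < t1.
Hypothesis t1_le1 : t1 <= 1.

Lemma within_cst (y : R) :
  {within `[t0, t1], continuous (fun _ : R => y)}.
Proof. by apply: continuous_subspaceT => t; exact: cvg_cst. Qed.

(** For moves between drawings a strip of full height suffices: all strands run through it, and
    positions inside it are the global ones. *)
Definition vertical_strip : disc R :=
  @Disc R t0 t1 (fun _ => 0) (fun _ => 1) t0_ge0 t0_lt t1_le1
    (@within_cst 0) (@within_cst 1) (fun _ _ => lexx 0) (fun _ _ => ltr01)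
    (fun _ _ => lexx 1).

End VerticalStrip.

Section MovesOnDrawings.
Variables (R : realType) (n : nat).
Local Open Scope ring_scope.
Implicit Types (b : vbd R n) (i j k l : 'I_n) (s t : R) (w : seq letter).

Lemma swapped_adj_swap (p : 'S_n) (x : nat) i j : swapped p (p * adj_swap n x)%g i j ->
  [/\ (0 < x < n)%N, p i = x :> nat & p j = x.-1 :> nat].
Proof.
have ij : p i = p j -> i = j by exact: perm_inj.
have [hx|hx] := boolP (0 < x < n)%N; last first.
  rewrite (_ : adj_swap n x = 1%g); first by rewrite mulg1 /swapped => /andP[]; lia.
  apply/permP => k; apply: ord_inj; rewrite perm1 adj_swapE; case: ifP => // hn.
  by have -> /= : x = 0%N; [lia|case: eqP => // ->].
rewrite /swapped !permM; have [a [c [ha hc ->]]] := adj_swap_tperm hx.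
case: tpermP => [ea|ec|na nc]; case: tpermP => [ea'|ec'|na' nc'] /andP[h1 h2].
- by move: h1; rewrite ea ea' ltnn.
- by move: h1; rewrite ea ec'; lia.
- by have : p j <> a :> nat; [by move=> /ord_inj|move: h1 h2; rewrite ea; lia].
- by split=> //; rewrite ?ec ?ea'.
- by move: h1; rewrite ec ec' ltnn.
- have : p j <> a :> nat by move=> /ord_inj.
  by move: h1 h2; rewrite ec; lia.
- have : p i <> c :> nat by move=> /ord_inj.
  by move: h1 h2; rewrite ea'; lia.
- have : p i <> a :> nat by move=> /ord_inj.
  have : p i <> c :> nat by move=> /ord_inj.
  by move: h1 h2; rewrite ec'; lia.
- by move: (ltn_trans h1 h2); rewrite ltnn.
Qed.

Lemma adj_swap_swapped (p : 'S_n) (x : nat) : (0 < x < n)%N ->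
  exists i j, swapped p (p * adj_swap n x)%g i j.
Proof.
move=> hx; have [a [c [ha hc e]]] := adj_swap_tperm hx.
exists (p^-1%g c), (p^-1%g a).
by rewrite /swapped !permM e !permKV tpermR tpermL ha hc; lia.
Qed.

Section Fixed.
Variables (b : vbd R n) (w : seq letter).
Let N := size w.
Hypothesis N0 : (0 < N)%N.
Let st := word_state n w.
Hypothesis db : draws N b st (word_value w) (fun r _ => @mid_time R N r).
Local Notation mid := (@mid_time R N).
Local Notation letter_at q := (nth (0%N, Virtual) w q).

Let hst : movie N st. Proof. exact: draws_movie db. Qed.
Let hm : schedule n N (fun r _ => mid r). Proof. exact: draws_schedule db. Qed.

Lemma mid_time_step q : node R N q <= mid q <= node R N q.+1.
Proof. by have /andP[h1 h2] := @mid_time_in R N N0 q; rewrite !ltW. Qed.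

Lemma mid_time_I01 q : (q < N)%N -> I01 (mid q).
Proof. by move=> qN; apply: (node_I01 N0 qN); exact: mid_time_step. Qed.

(** At the crossing the strands below are those in positions below the lower one, [st q j]: every
    other strand keeps its side of the crossing pair during the step. *)
Lemma draws_letter q i j : (q < N)%N -> swapped (st q) (st q.+1) i j ->
  (#|[set k in [set: 'I_n]%SET | (b k (mid q)).2 < (b i (mid q)).2]|.+1,
    value b (b i (mid q))) = letter_at q.
Proof.
move=> qN sw; have Im := mid_time_I01 qN; have hq := mid_time_step q.
have hE k : (b k (mid q)).2 = drawn_height N st (fun r _ => mid r) k (mid q).
  by rewrite strandE // (draws_ht db).
have [e1 e2 e3] := swapped_pos (proj2 hst q qN) sw.
have sw' := sw; rewrite /st word_stateS // in sw'.
have [_ x1 x2] := swapped_adj_swap sw'; rewrite -/(st q) in x1 x2.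
have eij := drawn_swapped_eq N0 hst hm qN sw; rewrite /= in eij.
have -> : #|[set k in [set: 'I_n]%SET | (b k (mid q)).2 < (b i (mid q)).2]| = st q j.
  rewrite -[RHS](card_perm_lt (st q) (ltnW (ltn_ord (st q j)))).
  apply: eq_card => k; rewrite !inE /= !hE.
  have ne k' l : k' != l -> (st q k' == st q l :> nat) = false.
    by move=> kl; apply/negP => /eqP/ord_inj/perm_inj e'; rewrite e' eqxx in kl.
  have ne' k' l : k' != l -> (st q.+1 k' == st q.+1 l :> nat) = false.
    by move=> kl; apply/negP => /eqP/ord_inj/perm_inj e'; rewrite e' eqxx in kl.
  have [->|ki] := eqVneq k i; first by rewrite ltxx e1 ltnNge leqnSn.
  have [->|kj] := eqVneq k j; first by rewrite eij ltxx ltnn.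
  have [h|h] := ltnP (st q k) (st q j).
    apply: (drawn_keep N0 hst hm qN hq); first by lia.
    have [//|h'] := ltnP (st q.+1 k) (st q.+1 i).
    have sw2 : swapped (st q) (st q.+1) i k.
      by have := ne' k i ki; apply: contraFT; rewrite /swapped; lia.
    by have [f1 _ _] := swapped_pos (proj2 hst q qN) sw2; lia.
  apply/negbTE; rewrite -leNgt ltW //; apply: (drawn_keep N0 hst hm qN hq).
    by have := ne k i ki; have := ne k j kj; lia.
  have [//|h'] := ltnP (st q.+1 i) (st q.+1 k).
  have sw2 : swapped (st q) (st q.+1) k i.
    have a1 := ne' k i ki; have a2 := ne k i ki; have a3 := ne k j kj.
    by apply/andP; split; lia.
  have [_ _ f3] := swapped_pos (proj2 hst q qN) sw2.
  by have := ne k j kj; rewrite -f3 e2 eqxx.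
rewrite strandE // (draws_ht db) // (draws_value db qN sw) /word_value.
by rewrite [RHS]surjective_pairing; congr pair; lia.
Qed.

Lemma draws_crossing_letter t (l : letter) : I01 t ->
  crossing_letter b [set: 'I_n]%SET t l <->
  exists q, [/\ (q < N)%N, valid_letter n (letter_at q), t = mid q & l = letter_at q].
Proof.
move=> It; split.
  move=> [i [j [_ _ ij e ->]]]; have [q qN hq] := locate_node N0 It.
  have e' : drawn_height N st (fun r _ => mid r) i t = drawn_height N st (fun r _ => mid r) j t.
    by rewrite -!(draws_ht db) //; apply/strand_eqP.
  have va i' j' : swapped (st q) (st q.+1) i' j' -> valid_letter n (letter_at q).
    by rewrite /st word_stateS // => /swapped_adj_swap[].
  exists q; case: (drawn_meet_step N0 hst hm qN hq ij e') => -[sw et]; split=> //.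
  - exact: va sw.
  - by rewrite et (draws_letter qN sw).
  - exact: va sw.
  - by rewrite e et (draws_letter qN sw).
move=> [q [qN va -> ->]].
have [i [j]] := adj_swap_swapped (st q) va.
rewrite /st -word_stateS // -/st => sw; have ij := swapped_neq sw.
exists i, j; split; rewrite ?finset.in_setT //.
  apply/strand_eqP; first exact: mid_time_I01.
  rewrite !(draws_ht db); try exact: mid_time_I01.
  exact: (drawn_swapped_eq N0 hst hm qN sw).
by rewrite -(draws_letter qN sw).
Qed.

End Fixed.

Section Strip.
Variables (w1 r r' w2 : seq letter).
Let w := w1 ++ r ++ w2.
Let w' := w1 ++ r' ++ w2.
Let N := size w.
Let a := size w1.
Let z := size r.
Hypothesis z0 : (0 < z)%N.
Hypothesis rz : size r' = z.
Hypothesis rr : word_perm n r = word_perm n r'.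
Local Notation mid := (@mid_time R N).

Let N0 : (0 < N)%N. Proof. by rewrite /N /w !size_cat -/z; lia. Qed.
Let azN : (a + z <= N)%N. Proof. by rewrite /N /w !size_cat -/z -/a; lia. Qed.

Let strip_ge0 : 0 <= node R N a. Proof. by rewrite /node divr_ge0. Qed.
Let strip_lt : node R N a < node R N (a + z).
Proof. by rewrite /node ltr_pM2r ?invr_gt0 ?ltr0n // ltr_nat -addn1 leq_add2l. Qed.
Let strip_le1 : node R N (a + z) <= 1.
Proof. by rewrite -(node_N R N0); exact: node_le. Qed.
Let strip := vertical_strip strip_ge0 strip_lt strip_le1.

Let in_strip (b : vbd R n) k t : I01 t ->
  disc_set strip (b k t) <-> node R N a <= t <= node R N (a + z).
Proof.
move=> It; rewrite strandE // /disc_set /=; split=> [[]//|h]; split=> //.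
exact: ht_01.
Qed.

Let nth_r q : (a <= q < a + z)%N -> nth (0%N, Virtual) w q = nth (0%N, Virtual) r (q - a).
Proof.
by move=> /andP[h1 h2]; rewrite /w !nth_cat -/a ltnNge h1 /= -/z ltn_subLR // h2.
Qed.

Let strip_I01 t : node R N a <= t <= node R N (a + z) -> I01 t.
Proof.
move=> /andP[h1 h2]; apply/I01E; apply/andP; split.
  by apply: le_trans h1; rewrite /node divr_ge0.
by apply: le_trans h2 _; rewrite -(node_N R N0); exact: node_le.
Qed.

Let mid_in_strip q : (a <= q < a + z)%N -> node R N a < mid q < node R N (a + z).
Proof.
move=> /andP[h1 h2]; have /andP[m1 m2] := @mid_time_in R N N0 q; apply/andP; split.
  by apply: le_lt_trans m1; exact: node_le.
by apply: lt_le_trans m2 _; exact: node_le.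
Qed.

Let mid_strip q : node R N a <= mid q <= node R N (a + z) -> (a <= q < a + z)%N.
Proof.
move=> /andP[h1 h2]; have /andP[m1 m2] := @mid_time_in R N N0 q.
apply/andP; split; rewrite leqNgt; apply/negP => h.
  by have := lt_le_trans m2 (le_trans (node_le R N0 h) h1); rewrite ltxx.
by rewrite ltnS in h; have := lt_le_trans m1 (le_trans h2 (node_le R N0 h)); rewrite ltxx.
Qed.

Lemma strip_reads b : draws N b (word_state n w) (word_value w) (fun q _ => mid q) ->
  all (valid_letter n) r -> reads b strip [set: 'I_n]%SET r.
Proof.
move=> db vr; pose u := mkseq (fun q => mid (a + q)) z.
have su : size u = z by rewrite size_mkseq.
have nu q : (q < z)%N -> nth 0 u q = mid (a + q) by move=> qz; rewrite nth_mkseq.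
have hin q : (q < z)%N -> (a <= a + q < a + z)%N by move=> qz; rewrite leq_addr ltn_add2l.
exists u; split=> //.
- have mono p q : (p < q)%N -> mid p < mid q.
    move=> pq; have /andP[_ m2] := @mid_time_in R N N0 p.
    have /andP[m1 _] := @mid_time_in R N N0 q.
    by apply: lt_trans m1; apply: lt_le_trans m2 _; exact: node_le.
  have ru q : (q < z)%N -> nth 0 (rcons u (right_time strip)) q = mid (a + q).
    by move=> qz; rewrite nth_rcons su qz nu.
  have rz' : nth 0 (rcons u (right_time strip)) z = node R N (a + z).
    by rewrite nth_rcons su ltnn eqxx.
  apply/(pathP 0) => q; rewrite size_rcons su ltnS leq_eqVlt => /orP[/eqP ->|qz].
    rewrite rz'; have zE : z = z.-1.+1 by rewrite prednK.
    have hz : (z.-1 < z)%N by rewrite {2}zE.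
    rewrite [X in nth 0 _ X]zE /= ru //.
    by have /andP[] := mid_in_strip (hin _ hz).
  rewrite ru //; case: q qz => [|q] qz /=.
    by have /andP[] := mid_in_strip (hin _ qz).
  by rewrite ru ?(ltnW qz) //; apply: mono; rewrite ltn_add2l.
- move=> t l ht; have It := strip_I01 ht.
  rewrite (draws_crossing_letter N0 db l It); split.
    move=> [q [qN va et el]]; have hq : (a <= q < a + z)%N by apply: mid_strip; rewrite -et.
    case/andP: (hq) => h1 h2; exists (q - a)%N; first by rewrite ltn_subLR.
    by rewrite nu ?ltn_subLR // subnKC // et el nth_r.
  move=> [q qz [et el]]; exists (a + q)%N.
  rewrite nth_r ?hin // addKn; split=> //.
  + by apply: leq_trans azN; rewrite ltn_add2l.
  + by move/all_nthP: vr; apply.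
  + by rewrite et nu.
Qed.

Lemma strip_reads_nil b : draws N b (word_state n w) (word_value w) (fun q _ => mid q) ->
  all (predC (valid_letter n)) r -> reads b strip [set: 'I_n]%SET [::].
Proof.
move=> db vr; exists [::]; split=> //.
  by rewrite /= andbT /node ltr_pM2r ?invr_gt0 ?ltr0n // ltr_nat -addn1 leq_add2l.
move=> t l ht; have It := strip_I01 ht.
rewrite (draws_crossing_letter N0 db l It); split=> [|[]//].
move=> [q [qN va et el]]; have hq : (a <= q < a + z)%N by apply: mid_strip; rewrite -et.
rewrite nth_r // in va; case/andP: hq => h1 h2.
have qz : (q - a < z)%N by rewrite ltn_subLR.
by move/all_nthP: vr => /(_ (0%N, Virtual) _ qz)/negP /(_ va).
Qed.

Let same_state q : (q <= a)%N || (a + z <= q)%N -> word_state n w q = word_state n w' q.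
Proof.
rewrite /word_state /w /w' !take_cat -/a -/z rz => /orP[h|h].
  case: ltnP => // h'; have -> : (q - a = 0)%N by lia.
  by rewrite z0 !take0.
have -> : (q < a)%N = false by apply/negbTE; rewrite -leqNgt; lia.
have -> : (q - a < z)%N = false by apply/negbTE; rewrite -leqNgt; lia.
by rewrite !word_perm_cat rr.
Qed.

Let same_letter q : (q < a)%N || (a + z <= q)%N ->
  nth (0%N, Virtual) w q = nth (0%N, Virtual) w' q.
Proof.
rewrite /w /w' !nth_cat -/a -/z rz => /orP[->//|h].
have -> : (q < a)%N = false by apply/negbTE; rewrite -leqNgt; lia.
by have -> : (q - a < z)%N = false by apply/negbTE; rewrite -leqNgt; lia.
Qed.

(** Outside the strip both words have the same letters and, since [r] and [r'] have the same length
    and permutation, the same states, so the drawings agree step by step. The words [x], [x'] that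
    are read may differ from [r], [r'] by letters out of range. *)
Lemma strip_move b b' (x x' : seq letter) : vm_rule x x' ->
  draws N b (word_state n w) (word_value w) (fun q _ => mid q) ->
  draws N b' (word_state n w') (word_value w') (fun q _ => mid q) ->
  reads b strip [set: 'I_n]%SET x -> reads b' strip [set: 'I_n]%SET x' -> vm_move b b'.
Proof.
move=> rule db db' rb rb'; exists x, x', strip, [set: 'I_n]%SET; split=> //.
  by split=> k t ht; rewrite finset.in_setT; split=> // _;
    apply/in_strip => //; exact: strip_I01.
have out t : I01 t -> ~ (node R N a <= t <= node R N (a + z)) -> exists q,
    [/\ (q < N)%N, node R N q <= t <= node R N q.+1 & (q < a)%N || (a + z <= q)%N].
  move=> It ht; have [q qN hq] := locate_node N0 It; exists q; split=> //.
  apply/negP => /negP; rewrite negb_or -leqNgt -ltnNge => /andP[h1 h2].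
  apply: ht; case/andP: hq => h3 h4; apply/andP; split.
    by apply: le_trans h3; exact: node_le.
  by apply: le_trans h4 _; exact: node_le.
have ends q : (q < a)%N || (a + z <= q)%N ->
    word_state n w q = word_state n w' q /\ word_state n w q.+1 = word_state n w' q.+1.
  by move=> h; rewrite !same_state //; case/orP: h => h; apply/orP; [left|right|left|right]; lia.
have hm := draws_schedule db.
split.
  move=> k t It h.
  have nin : ~ (node R N a <= t <= node R N (a + z)).
    by case: h => h ht; apply: h; apply/in_strip.
  have [q [qN hq hqa]] := out t It nin; have [e1 e2] := ends q hqa.
  rewrite !strandE // (draws_ht db) // (draws_ht db') //; congr pair.
  rewrite /drawn_height !(position_step N0 _ _ hm qN hq) //.
  by rewrite /step_ramp e1 e2.
move=> pt [i [j [t [It ij <- e]]]] nd.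
have nin : ~ (node R N a <= t <= node R N (a + z)) by move=> ht; apply: nd; apply/in_strip.
have [q [qN hq hqa]] := out t It nin; have [e1 e2] := ends q hqa.
have el := same_letter hqa.
have hE k : drawn_height N (word_state n w) (fun q _ => mid q) k t =
    drawn_height N (word_state n w') (fun q _ => mid q) k t.
  rewrite /drawn_height !(position_step N0 _ _ hm qN hq) //.
  by rewrite /step_ramp e1 e2.
have e' : drawn_height N (word_state n w) (fun q _ => mid q) i t =
    drawn_height N (word_state n w) (fun q _ => mid q) j t.
  by rewrite -!(draws_ht db) //; apply/strand_eqP.
have val_eq k l : swapped (word_state n w q) (word_state n w q.+1) k l -> t = mid q ->
    value b (b k t) = value b' (b k t).
  move=> sw et; rewrite strandE // (draws_ht db) // [in RHS]hE et.
  rewrite (draws_value db qN sw).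
  have sw' : swapped (word_state n w' q) (word_state n w' q.+1) k l by rewrite -e1 -e2.
  by rewrite (draws_value db' qN sw') /word_value el.
case: (drawn_meet_step N0 (draws_movie db) hm qN hq ij e') => -[sw et].
  exact: val_eq sw et.
by rewrite -e; exact: val_eq sw et.
Qed.

End Strip.

End MovesOnDrawings.

(** * Two distant crossings in one step of a movie *)

Section FarCommutation.
Variables (R : realType) (n : nat).
Local Open Scope ring_scope.
Implicit Types (i j k : 'I_n) (s t : R) (w : seq letter).

Definition swap_nat (x u : nat) : nat :=
  if u == x.-1 then x else if u == x then x.-1 else u.

Lemma adj_swap_nat x (k : 'I_n) : (0 < x < n)%N -> adj_swap n x k = swap_nat x k :> nat.
Proof. by move=> /andP[_ hx]; rewrite adj_swapE hx. Qed.

Lemma swap_nat_cases (x u : nat) :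
  (u = x.-1 /\ swap_nat x u = x) \/ (u = x /\ swap_nat x u = x.-1) \/
  (u <> x.-1 /\ u <> x /\ swap_nat x u = u).
Proof.
rewrite /swap_nat; case: (u =P x.-1) => h; first by left.
by case: (u =P x) => h'; [right; left|right; right].
Qed.

Lemma far_swap_near (x y u : nat) : (0 < x)%N -> (0 < y)%N ->
  (x.+1 < y)%N || (y.+1 < x)%N -> swap_nat y (swap_nat x u) = u \/
  (swap_nat y (swap_nat x u) == u.+1) || (u == (swap_nat y (swap_nat x u)).+1).
Proof.
move=> x0 y0 xy; have := swap_nat_cases x u; have := swap_nat_cases y (swap_nat x u).
move: (swap_nat y (swap_nat x u)) (swap_nat x u) => c d.
by move=> [h1|[h1|h1]] [h2|[h2|h2]]; lia.
Qed.

Lemma far_swap_pair (x y : nat) : (0 < x)%N -> (0 < y)%N ->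
  (x.+1 < y)%N || (y.+1 < x)%N ->
  swap_nat y (swap_nat x x) = x.-1 /\ swap_nat y (swap_nat x x.-1) = x.
Proof.
move=> x0 y0 xy; have -> : swap_nat x x = x.-1.
  by have := swap_nat_cases x x; lia.
have -> : swap_nat x x.-1 = x by have := swap_nat_cases x x.-1; lia.
split; [have := swap_nat_cases y x.-1|have := swap_nat_cases y x].
  by move: (swap_nat y x.-1) => c [h|[h|h]]; lia.
by move: (swap_nat y x) => c [h|[h|h]]; lia.
Qed.

Variables (w1 : seq letter) (l l' : letter) (w2 : seq letter).
Hypothesis vl : valid_letter n l.
Hypothesis vl' : valid_letter n l'.
Hypothesis far : (l.1.+1 < l'.1)%N || (l'.1.+1 < l.1)%N.
Let W := w1 ++ [:: l; l'] ++ w2.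
Let a := size w1.
Let N := (a + (size w2).+1)%N.
Local Notation mid := (@mid_time R N).
Local Notation node := (@node R N).

Let sW : size W = N.+1. Proof. by rewrite /W /N !size_cat /= -/a; lia. Qed.
Let N0 : (0 < N)%N. Proof. by rewrite /N addnS. Qed.
Let aN : (a < N)%N. Proof. by rewrite /N addnS ltnS leq_addr. Qed.

(* The movie in which the crossings [l] and [l'] take place in the same step. *)
Definition joint_state (q : nat) : 'S_n := word_state n W (bump a.+1 q).

(** In the joint step the position tells the two crossings apart; from there on the letters of [W]
    are one index ahead of the steps, whence [bump a]. *)
Definition joint_value (q p : nat) : crossing_value :=
  if q == a then (if p.+1 == l.1 then l.2 else l'.2)
  else (nth (0%N, Virtual) W (bump a q)).2.

Definition third (c : R) : R := node a + c * (node a.+1 - node a).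

(** The crossing [l] takes place after one third of the joint step and [l'] after two thirds. With
    [l] and [l'] interchanged, the same movie is obtained with another schedule. *)
Definition joint_time (q p : nat) : R :=
  if q == a then (if p.+1 == l.1 then third (1 / 3) else third (2 / 3)) else mid q.

Let na : node a < node a.+1. Proof. exact: node_lt. Qed.

Let third_lt c d : c < d -> third c < third d.
Proof. by move=> cd; rewrite ltrD2l ltr_pM2r // subr_gt0. Qed.

Let third12 : third (1 / 3) < third (2 / 3).
Proof. by apply: third_lt; lra. Qed.

Let third_in c : 0 < c < 1 -> node a < third c < node a.+1.
Proof.
move=> /andP[c0 c1]; have t0 : third 0 = node a by rewrite /third mul0r addr0.
have t1 : third 1 = node a.+1 by rewrite /third mul1r addrC subrK.
by rewrite -t0 -t1 !third_lt.
Qed.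

Let bump_le q : (q <= a)%N -> bump a.+1 q = q.
Proof. by rewrite /bump; case: ltnP; lia. Qed.

Let bump_gt q : (a < q)%N -> bump a.+1 q = q.+1.
Proof. by rewrite /bump; case: ltnP; lia. Qed.

Lemma joint_schedule : schedule n N joint_time.
Proof.
move=> r p rN pn; rewrite /joint_time; case: eqP => [->|_]; last exact: mid_time_in.
by case: ifP => _; apply: third_in; lra.
Qed.

Let state_a1 : word_state n W a.+1 = (word_state n W a * adj_swap n l.1)%g.
Proof.
by rewrite word_stateS ?sW; [rewrite nth_cat -/a ltnn subnn|rewrite ltnS ltnW].
Qed.

Let state_a2 : word_state n W a.+2 =
  (word_state n W a * (adj_swap n l.1 * adj_swap n l'.1))%g.
Proof.
rewrite word_stateS ?sW // state_a1 mulgA nth_cat -/a.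
by rewrite ltnNge leqnSn /= subSnn.
Qed.

Let swap_far : (adj_swap n l.1 * adj_swap n l'.1 = adj_swap n l'.1 * adj_swap n l.1)%g.
Proof.
case/andP: vl => l0 ln; case/andP: vl' => l0' ln'.
by case/orP: far => h; [exact: adj_swap_far|apply/esym; exact: adj_swap_far].
Qed.

Lemma joint_movie : movie N joint_state.
Proof.
split; first by rewrite /joint_state bump_le // /word_state take0 word_perm_nil.
move=> r rN; rewrite /joint_state; have [h|h|h] := ltngtP r a.
- by rewrite !bump_le ?(ltnW h) // word_stateS ?sW; [exact: adj_swap_step|lia].
- rewrite (bump_gt h) (bump_gt (leqW h)) [word_state n W r.+2]word_stateS ?sW //; exact: adj_swap_step.
rewrite h bump_le // bump_gt // state_a2.
set p := word_state n W a; set x := (adj_swap n l.1 * adj_swap n l'.1)%g.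
have xx : (x * x = 1)%g.
  by rewrite /x {2}swap_far -mulgA (mulgA (adj_swap n l'.1)) adj_swapK mul1g adj_swapK.
case/andP: (vl) => l0 _; case/andP: (vl') => l0' _.
move=> k; have := far_swap_near (p k) l0 l0' far.
rewrite -(adj_swap_nat (p k) vl) -(adj_swap_nat _ vl').
have -> : adj_swap n l'.1 (adj_swap n l.1 (p k)) = x (p k) by rewrite /x permM.
case=> [e|e]; first by left; rewrite permM.
right; exists (p^-1 (x (p k)))%g; split.
- by rewrite permM permKV.
- by rewrite permM permKV -[LHS]permM xx perm1.
- by rewrite permKV.
Qed.

(** The letters act on disjoint pairs of positions, so a pair exchanged in the joint step belongs to
    [l], and is exchanged already in the state after [l] alone, or to [l'], and is untouched by
    [l]. *)
Lemma joint_swapped i j : swapped (joint_state a) (joint_state a.+1) i j ->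
  ((joint_state a j).+1 = l.1 /\ swapped (joint_state a) (word_state n W a.+1) i j) \/
  [/\ (joint_state a j).+1 = l'.1, (joint_state a j).+1 <> l.1,
   word_state n W a.+1 i = joint_state a i & word_state n W a.+1 j = joint_state a j].
Proof.
rewrite /joint_state bump_le // bump_gt // state_a2 state_a1.
set p := word_state n W a; rewrite mulgA; set p1 := (p * _)%g => /andP[h1 h2].
have fix_far (x : 'I_n) : x = l'.1 :> nat \/ x = l'.1.-1 :> nat -> adj_swap n l.1 x = x.
  by case/andP: vl => l0 ln; case/andP: vl' => l0' ln' h; apply: adj_swap_id; move: far; lia.
have p1K k : p k = adj_swap n l.1 (p1 k) by rewrite /p1 permM -[RHS]permM adj_swapK perm1.
have ij : i != j by apply/eqP => ij; rewrite ij ltnn in h1.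
have [h3|h3] := boolP (p1 i < p1 j)%N.
  have sw : swapped p p1 i j by rewrite /swapped h1.
  have [/andP[l0 _] _ e2] := swapped_adj_swap sw.
  by left; rewrite e2 prednK.
have sw : swapped p1 (p1 * adj_swap n l'.1)%g i j.
  by rewrite /swapped h2 (perm_neq p1) ?h3 // eq_sym.
have [/andP[l0 _] e1 e2] := swapped_adj_swap sw.
right; have ei : p1 i = p i by rewrite [RHS]p1K fix_far; [|left].
have ej : p1 j = p j by rewrite [RHS]p1K fix_far; [|right].
by split=> //; rewrite -ej e2 prednK //; case/andP: vl => l0' _; move: far; lia.
Qed.

(** The time of the letter [q] of [W]; [stp q] is the step of the joint movie in which it takes
    place. *)
Let e (q : nat) : R :=
  if (q < a)%N then mid q else if q == a then third (1 / 3)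
  else if q == a.+1 then third (2 / 3) else mid q.-1.

Let stp (q : nat) : nat := if (q <= a)%N then q else q.-1.

Let e_in q : node (stp q) < e q < node (stp q).+1.
Proof.
rewrite /e /stp; case: ltngtP => h.
- exact: mid_time_in.
- case: eqP => [->|_] /=; last exact: mid_time_in.
  by apply: third_in; lra.
- by rewrite h; apply: third_in; lra.
Qed.

Let stpN q : (q < N.+1)%N -> (stp q < N)%N.
Proof.
rewrite /stp ltnS => qN; case: (leqP q a) => h; first exact: (leq_ltn_trans h aN).
by rewrite prednK ?(leq_ltn_trans (leq0n a) h).
Qed.

Let X := crossing_nodes N.+1 e.

Let e_lt q : e q < e q.+1.
Proof.
have [->|h] := eqVneq q a.
  by rewrite /e ltnn eqxx ltnNge leqnSn /= eqxx; case: eqP => [|_]; [lia|apply: third_lt; lra].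
have /andP[_ h1] := e_in q; have /andP[h2 _] := e_in q.+1.
apply: lt_trans h1 (le_lt_trans _ h2); apply: node_le => //.
by rewrite /stp; move/eqP: h; case: (leqP q a); case: (leqP q.+1 a); lia.
Qed.

Let X_incr : increasing_upto N.+2 X.
Proof.
move=> [|q] qN; rewrite /X /=.
  by have /andP[h1 _] := e_in 0; apply: le_lt_trans h1; rewrite /node divr_ge0.
rewrite ltnS in qN; rewrite qN; case: ifP => // _.
have /andP[_ h2] := e_in q; apply: lt_le_trans h2 _.
by rewrite -(node_N R N0); apply: node_le => //; exact: stpN.
Qed.

Let X_last : X N.+2 = 1. Proof. by rewrite /X /= ltnn. Qed.

Let gap_unique q q' t : (q <= N.+1)%N -> (q' <= N.+1)%N ->
  X q < t < X q.+1 -> X q' <= t <= X q'.+1 -> q = q'.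
Proof.
move=> qN qN' /andP[h1 h2] /andP[h3 h4]; apply/eqP; case: ltngtP => // qq.
  have := increasing_le X_incr (_ : q.+1 <= q' <= N.+2)%N; rewrite qq leqW // => /(_ isT) h.
  by have := lt_le_trans h2 (le_trans h h3); rewrite ltxx.
have := increasing_le X_incr (_ : q'.+1 <= q <= N.+2)%N; rewrite qq leqW // => /(_ isT) h.
by have := le_lt_trans h4 (le_lt_trans h h1); rewrite ltxx.
Qed.

Let gap_not_node q q' t : (q <= N.+1)%N -> (q' <= N.+2)%N -> X q < t < X q.+1 -> t <> X q'.
Proof.
move=> qN qN' /andP[h1 h2] et; have [h|h] := leqP q' q.
  have := increasing_le X_incr (_ : q' <= q <= N.+2)%N; rewrite h leqW // -et => /(_ isT) h'.
  by have := lt_le_trans h1 h'; rewrite ltxx.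
have := increasing_le X_incr (_ : q.+1 <= q' <= N.+2)%N; rewrite h qN' -et => /(_ isT) h'.
by have := lt_le_trans h2 h'; rewrite ltxx.
Qed.

Let X_le_node q t : (q <= N.+1)%N -> 0 <= t -> node (stp q) <= t -> q != a.+1 -> X q <= t.
Proof.
case: q => [|q] qN t0 ht qa; first by [].
rewrite /X /= qN; have /andP[_ h] := e_in q; apply: le_trans (ltW h) (le_trans _ ht).
by apply: node_le => //; move/eqP: qa; rewrite /stp; case: (leqP q a); case: (leqP q.+1 a); lia.
Qed.

Let X_ge_node q t : (q <= N.+1)%N -> t <= 1 -> t <= node (stp q) -> t <= X q.+1.
Proof.
move=> qN t1 ht; rewrite /X /=; case: ifP => // qN'.
by have /andP[h _] := e_in q; apply: le_trans ht (ltW h).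
Qed.

Let aN0 : (a <= N.+1)%N. Proof. by clear -aN; lia. Qed.
Let aN1 : (a.+1 <= N.+1)%N. Proof. by clear -aN; lia. Qed.
Let aN2 : (a.+2 <= N.+1)%N. Proof. by clear -aN; lia. Qed.

(** The drawing has [N] steps but the word [N.+1] letters: the joint step shows three successive
    states of [W], separated by its two crossing times. *)
Lemma joint_reads_word (b : vbd R n) : draws N b joint_state joint_value joint_time ->
  reads_word b W.
Proof.
move=> db; have hst := draws_movie db; have hm := draws_schedule db.
exists X; rewrite sW; split=> //.
- move=> q t i j qN hq.
  have It : I01 t.
    apply/I01E; case/andP: hq => h1 h2; rewrite -X_last -[X in X <= t]/(X 0%N).
    apply/andP; split.
      by apply: le_trans (ltW h1); apply: (increasing_le X_incr); rewrite /= leqW.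
    by apply: le_trans (ltW h2) _; apply: (increasing_le X_incr); rewrite ltnS qN /=.
  have /I01E/andP[t0 t1] := It.
  rewrite !(draws_ht db) //; have [r rN hr] := locate_node N0 It; have /andP[r1 r2] := hr.
  (* The joint step is cut at its thirds into parts of the gaps [a], [a.+1], [a.+2]; any other step
     has all its crossings at its midpoint and is cut there. *)
  have [ra|ra] := eqVneq r a.
    subst r; have timeE p : joint_time a p = third (1 / 3) \/ joint_time a p = third (2 / 3).
      by rewrite /joint_time eqxx; case: ifP; [left|right].
    have t12 : third (1 / 3) < third (2 / 3) by apply: third_lt; lra.
    have Xa1 : X a.+1 = third (1 / 3).
      by rewrite /X /= ltnS ltnW // /e ltnn eqxx.
    have Xa2 : X a.+2 = third (2 / 3).
      by rewrite /X /= ltnS aN /e ltnNge leqnSn /= eqxx; rewrite gtn_eqF.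
    have ne1 : t <> third (1 / 3) by rewrite -Xa1; exact: (gap_not_node qN (leqW aN1) hq).
    have ne2 : t <> third (2 / 3) by rewrite -Xa2; exact: (gap_not_node qN (leqW aN2) hq).
    have [h1|h1|//] := ltgtP t (third (1 / 3)).
      have -> : q = a.
        apply: (gap_unique qN aN0 hq).
        rewrite Xa1 (ltW h1) andbT; by apply: X_le_node => //; rewrite ?/stp ?leqnn // ltn_eqF.
      rewrite -[in RHS](bump_le (leqnn a)); apply: (drawn_before N0 _ _ hst hm rN hr).
      by move=> k m _; case: (timeE (joint_state a m)) => -> //; exact: lt_trans h1 t12.
    have [h2|h2|//] := ltgtP t (third (2 / 3)); last first.
      have -> : q = a.+2.
        apply: (gap_unique qN aN2 hq).
        rewrite Xa2 (ltW h2) /=; apply: X_ge_node => //.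
        by rewrite /stp leqNgt leqW.
      rewrite -[in RHS](bump_gt (ltnSn a)); apply: (drawn_after N0 _ _ hst hm rN hr).
      by move=> k m _; case: (timeE (joint_state a m)) => -> //; exact: lt_trans t12 h2.
    have -> : q = a.+1.
      by apply: (gap_unique qN aN1 hq); rewrite Xa1 Xa2 (ltW h1) (ltW h2).
    have [->|ij] := eqVneq i j; first by rewrite ltxx ltnn.
    have side k m : swapped (joint_state a) (joint_state a.+1) k m ->
        (drawn_height N joint_state joint_time k t < drawn_height N joint_state joint_time m t) =
          (word_state n W a.+1 k < word_state n W a.+1 m)%N /\
        (drawn_height N joint_state joint_time m t < drawn_height N joint_state joint_time k t) =
          (word_state n W a.+1 m < word_state n W a.+1 k)%N.
      move=> sw; have [d1 d2] := drawn_swapped N0 hst hm rN hr sw.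
      rewrite d1 d2 /joint_time eqxx; have /andP[s1 s2] := sw.
      have [[e1 /andP[_ sw1]]|[e1 /eqP/negbTE e2 e3 e4]] := joint_swapped sw.
        rewrite e1 eqxx h1 sw1; split=> //.
        by rewrite ltNge (ltW h1) /= ltnNge ltnW.
      rewrite e2 h2 e3 e4 s1; split=> //.
      by rewrite ltNge (ltW h2) /= ltnNge ltnW.
    have [sw|nsw] := boolP (swapped (joint_state a) (joint_state a.+1) i j).
      by have [-> _] := side i j sw.
    have [sw|nsw'] := boolP (swapped (joint_state a) (joint_state a.+1) j i).
      by have [_ ->] := side j i sw.
    have keep := not_swapped ij nsw nsw'.
    have st1 : movie_step (joint_state a) (word_state n W a.+1).
      by rewrite state_a1 /joint_state bump_le //; exact: adj_swap_step.
    (* A pair exchanged by [l] stays exchanged in the joint step, as [l'] does not move its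
       positions. *)
    have ns1 k m : ~~ swapped (joint_state a) (joint_state a.+1) k m ->
        ~~ swapped (joint_state a) (word_state n W a.+1) k m.
      apply: contra => sw; have := sw; rewrite state_a1 /joint_state bump_le //.
      move=> /swapped_adj_swap[_ x1 x2].
      rewrite bump_gt // state_a2 /swapped !permM.
      case/andP: (vl) => l0 ln; case/andP: (vl') => l0' ln'.
      rewrite !(adj_swap_nat _ vl') !(adj_swap_nat _ vl) x1 x2.
      have [-> ->] := far_swap_pair l0 l0' far.
      by rewrite !ltn_predL l0.
    have keep1 := not_swapped ij (ns1 _ _ nsw) (ns1 _ _ nsw').
    rewrite keep1; have [h|h] := boolP (joint_state a i < joint_state a j)%N.
      by apply: (drawn_keep N0 hst hm rN hr) => //; rewrite keep.
    apply/negbTE; rewrite -leNgt ltW //; apply: (drawn_keep N0 hst hm rN hr).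
      by rewrite (perm_neq (joint_state a)) // eq_sym.
    by rewrite (perm_neq (joint_state a.+1)) ?keep // eq_sym.
  have timeE p : joint_time r p = mid r by rewrite /joint_time (negbTE ra).
  (* The index in [W] of the letter drawn in step [r], shifted after the joint step. *)
  pose q0 := if (r < a)%N then r else r.+1.
  have q0N : (q0 < N.+1)%N by rewrite /q0; case: ifP => _; [exact: leqW|].
  have eq0 : e q0 = mid r.
    rewrite /q0 /e; case: (ltngtP r a) ra => // h _; first by rewrite h.
    by rewrite ltnNge leqW ?(ltnW h) //= gtn_eqF ?leqW // eqSS gtn_eqF.
  have sq0 : stp q0 = r.
    by rewrite /q0 /stp; case: (ltngtP r a) ra => // h _; [rewrite ltnW|rewrite leqNgt leqW].
  have sq1 : stp q0.+1 = r.+1.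
    by rewrite /q0 /stp; case: (ltngtP r a) ra => // h _; [rewrite h|rewrite leqNgt !leqW].
  have q0a : q0 != a.+1 by rewrite /q0; case: (ltngtP r a) ra => // h _; [rewrite ltn_eqF // ltnW|rewrite eqSS gtn_eqF].
  have Xq0 : X q0.+1 = mid r by rewrite /X /= q0N eq0.
  have ne : t <> mid r by rewrite -Xq0; exact: (gap_not_node qN (leqW q0N) hq).
  have jq0 : joint_state r = word_state n W q0.
    by rewrite /joint_state /q0; case: (ltngtP r a) ra => // h _; [rewrite bump_le // ltnW|rewrite bump_gt].
  have jq1 : joint_state r.+1 = word_state n W q0.+1.
    by rewrite /joint_state /q0; case: (ltngtP r a) ra => // h _; [rewrite bump_le|rewrite bump_gt // leqW].
  have [h|h|//] := ltgtP t (mid r).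
    have -> : q = q0.
      apply: (gap_unique qN (ltnW q0N) hq); rewrite Xq0 (ltW h) andbT.
      by apply: X_le_node; rewrite ?sq0 // leqW.
    rewrite -jq0; apply: (drawn_before N0 _ _ hst hm rN hr).
    by move=> k m _; rewrite timeE.
  have -> : q = q0.+1.
    apply: (gap_unique qN q0N hq); rewrite Xq0 (ltW h) /=.
    by apply: X_ge_node; rewrite ?sq1.
  rewrite -jq1; apply: (drawn_after N0 _ _ hst hm rN hr).
  by move=> k m _; rewrite timeE.
- move=> q i j qN ij; rewrite /X /= qN => meet.
  have rN := stpN qN; have hr : node (stp q) <= e q <= node (stp q).+1.
    by have /andP[h1 h2] := e_in q; rewrite !ltW.
  have Ie := node_I01 N0 rN hr.
  rewrite strandE // (draws_ht db) //; move: meet; rewrite !(draws_ht db) // => meet.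
  have val k m : swapped (joint_state (stp q)) (joint_state (stp q).+1) k m ->
      e q = joint_time (stp q) (joint_state (stp q) m) ->
      value b (e q, drawn_height N joint_state joint_time k (e q)) = word_value W q 0.
    move=> sw et; rewrite {1 2}et (draws_value db rN sw) /joint_value /word_value.
    move: et; rewrite /stp /e /joint_time; case: ltngtP => h; last 1 first.
    - rewrite h eqxx; case: ifP => [_ _|_ /eqP].
        by rewrite /W nth_cat -/a ltnn subnn.
      by rewrite (lt_eqF third12).
    - by rewrite ltn_eqF // /bump leqNgt h.
    case: (q =P a.+1) => [->|qa1] /=.
      rewrite eqxx; case: ifP => [_ /eqP|_ _].
        by rewrite (gt_eqF third12).
      by rewrite /W nth_cat -/a ltnNge leqnSn /= subSnn.
    have hq : (a < q.-1)%N by clear -h qa1; lia.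
    by rewrite gtn_eqF // /bump ltnW //= add1n prednK ?(leq_ltn_trans (leq0n a) h).
  have [[sw et]|[sw et]] := drawn_meet_step N0 hst hm rN hr ij meet.
    exact: val sw et.
  by rewrite meet; exact: val sw et.
Qed.

End FarCommutation.

(** * Equivalent words are read by virtually equivalent diagrams *)

Section WordMoves.
Variables (R : realType) (n : nat).
Local Open Scope ring_scope.
Implicit Types (b : vbd R n) (w : seq letter).

Lemma joint_state_sym w1 l l' w2 : valid_letter n l -> valid_letter n l' ->
  (l.1.+1 < l'.1)%N || (l'.1.+1 < l.1)%N -> joint_state n w1 l l' w2 = joint_state n w1 l' l w2.
Proof.
move=> vl vl' far; apply: funext => q; rewrite /joint_state /word_state !take_cat.
case: ltnP => // h; rewrite !word_perm_cat; congr (_ * _)%g.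
have : (bump (size w1).+1 q - size w1 != 1)%N.
  by apply/eqP; move: h; rewrite /bump; case: leqP; lia.
case: (_ - _)%N => [|[|d]] // _; rewrite ?take0 //= !word_perm_cons !mulgA; congr (_ * _)%g.
case/andP: vl => l0 ln; case/andP: vl' => l0' ln'.
by case/orP: far => h'; [exact: adj_swap_far|apply/esym; exact: adj_swap_far].
Qed.

(** Both words are read by drawings of one joint movie, which differ only in the order of the two
    times within the joint step; [isotopic_draws] lets the crossings overtake each other. *)
Lemma far_virtually_equivalent w1 l l' w2 b b' : valid_letter n l -> valid_letter n l' ->
  (l.1.+1 < l'.1)%N || (l'.1.+1 < l.1)%N -> reads_word b (w1 ++ [:: l; l'] ++ w2) ->
  reads_word b' (w1 ++ [:: l'; l] ++ w2) -> virtually_equivalent b b'.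
Proof.
move=> vl vl' far rb rb'; have far' : (l'.1.+1 < l.1)%N || (l.1.+1 < l'.1)%N by rewrite orbC.
set a := size w1; pose N := (a + (size w2).+1)%N.
have N0 : (0 < N)%N by rewrite /N addnS.
have [c dc] := exists_drawing N0 (joint_value w1 l l' w2) (joint_movie R w1 w2 vl vl' far)
  (@joint_schedule R n w1 l w2).
have [c' dc'] := exists_drawing N0 (joint_value w1 l' l w2) (joint_movie R w1 w2 vl' vl far')
  (@joint_schedule R n w1 l' w2).
have rc := joint_reads_word vl vl' far dc.
have rc' := joint_reads_word vl' vl far' dc'.
have es := joint_state_sym w1 w2 vl vl' far.
(* The drawing [c'] is regarded as a drawing of the first movie with the other schedule. It remains
   to match the values, which in the joint step are attached to [l] and [l'] by position. *)
have dcc : draws N c' (joint_state n w1 l l' w2) (joint_value w1 l l' w2)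
    (joint_time R w1 l' w2).
  split; first exact: draws_movie dc.
  - exact: joint_schedule.
  - by move=> k t It; rewrite es; exact: (draws_ht dc').
  - move=> r i j rN sw; rewrite [in LHS]es (draws_value dc' rN) -?es //.
    rewrite /joint_value; case: eqP => [ra|ra].
      rewrite ra in sw.
      have := joint_swapped R vl' vl far' (w1 := w1) (w2 := w2); rewrite -es => h'.
      have := joint_swapped R vl vl' far sw; move: h'.
      move=> /(_ _ _ sw) h' h; rewrite -/a in ra; rewrite ra.
      case: h => [[-> _]|[-> _ _ _]]; rewrite eqxx; case: ifP => // /eqP e.
      + by move: far; rewrite e; lia.
      + by move: far; rewrite e; lia.
    congr (_.2); rewrite !nth_cat; case: ltnP => // h.
    have : (bump (size w1) r - size w1 != 0)%N /\ (bump (size w1) r - size w1 != 1)%N.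
      by split; apply/eqP; move: h ra; rewrite /bump -/a; case: leqP; lia.
    by case: (_ - _)%N => [|[|d]] // [].
apply: (rst_trans _ _ _ c); first by apply: rst_step; left; exact: isotopic_reads_word rb rc.
apply: (rst_trans _ _ _ c'); first by apply: rst_step; left; have := isotopic_draws N0 dc dcc; exact.
by apply: rst_step; left; exact: isotopic_reads_word rc' rb'.
Qed.

Lemma reads_times b (V V' : disc R) K w : left_time V = left_time V' ->
  right_time V = right_time V' -> reads b V K w -> reads b V' K w.
Proof. by rewrite /reads => -> ->. Qed.

Lemma vm_rule_virtually_equivalent w1 r r' w2 b b' : vm_rule r r' -> all (valid_letter n) (r ++ r') ->
  reads_word b (w1 ++ r ++ w2) -> reads_word b' (w1 ++ r' ++ w2) -> virtually_equivalent b b'.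
Proof.
move=> rule vr rb rb'; have rr : word_perm n r = word_perm n r'.
  by apply: word_rule_perm; exact: word_rule_vm.
(* Only V2 changes the length. Two idle letters restore it, so that the drawings have the same steps
   outside the strip; the strip still reads the empty word. *)
pose pad := if r' is [::] then [:: tau 0; tau 0] else r'.
have s0 : adj_swap n 0 = 1%g.
  by apply/permP => k; apply: ord_inj; rewrite perm1 adj_swapE /=; case: ifP => //; case: eqP.
have [sr spad rpad] : [/\ (0 < size r)%N, size pad = size r & word_perm n r = word_perm n pad].
  have [h0 hs] : (0 < size r)%N /\ (if r' is [::] then size r = 2 else size r' = size r).
    by clear -rule; case: rule.
  split=> //; first by move: hs; rewrite /pad; case: (r').
  rewrite rr /pad.
  by case: (r') => //; rewrite !word_perm_cons s0 !mul1g.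
have srw : (0 < size (w1 ++ r ++ w2))%N by rewrite !size_cat; lia.
have sw : size (w1 ++ pad ++ w2) = size (w1 ++ r ++ w2) by rewrite !size_cat spad.
have [c dc] := exists_drawing srw (word_value (w1 ++ r ++ w2))
  (word_movie n (leqnn _)) (@schedule_mid R n _ srw).
have [c' dc'] : exists c', draws (size (w1 ++ r ++ w2)) c' (word_state n (w1 ++ pad ++ w2))
    (word_value (w1 ++ pad ++ w2)) (fun q _ => @mid_time R (size (w1 ++ r ++ w2)) q).
  by apply: exists_drawing => //; [apply: word_movie; rewrite sw|exact: schedule_mid].
have rc := draws_word_reads srw dc.
have rc' : reads_word c' (w1 ++ pad ++ w2).
  by apply: draws_word_reads; rewrite sw.
have rc'' : reads_word c' (w1 ++ r' ++ w2).
  move: rc'; rewrite /pad; case: (r') => // /reads_word_idle -/(_ s0).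
  by move=> /reads_word_idle -/(_ s0).
apply: (rst_trans _ _ _ c); first by apply: rst_step; left; exact: isotopic_reads_word rb rc.
apply: (rst_trans _ _ _ c'); last by apply: rst_step; left; exact: isotopic_reads_word rc'' rb'.
apply: rst_step; right; move: vr; rewrite all_cat => /andP[vr vr'].
apply: (strip_move (z0 := sr) (rz := spad) rpad rule dc dc'); first exact: strip_reads.
have sp0 : (0 < size pad)%N by rewrite spad.
have dcp : draws (size (w1 ++ pad ++ w2)) c' (word_state n (w1 ++ pad ++ w2))
    (word_value (w1 ++ pad ++ w2)) (fun q _ => @mid_time R (size (w1 ++ pad ++ w2)) q).
  by rewrite sw.
have [r0|er] : r' = [::] \/ pad = r' by rewrite /pad; case: (r'); [left|right].
  have vp : all (predC (valid_letter n)) pad by rewrite /pad r0.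
  rewrite r0; apply: reads_times (strip_reads_nil sp0 erefl dcp vp); by rewrite /= sw ?spad.
have vp : all (valid_letter n) pad by rewrite er.
rewrite -[X in reads _ _ _ X]er; apply: reads_times (strip_reads sp0 erefl dcp vp);
  by rewrite /= sw ?spad.
Qed.

Lemma weq_virtually_equivalent w w' : weq n w w' -> forall b b', reads_word b w ->
  reads_word b' w' -> virtually_equivalent b b'.
Proof.
elim=> [u|u v _ IH|u v x _ IH1 _ IH2|w1 r r' w2 rule] b b' rb rb'.
- by apply: rst_step; left; exact: isotopic_reads_word rb rb'.
- by apply: rst_sym; exact: IH.
- have [c rc] := exists_reads_word R n v.
  by apply: (rst_trans _ _ _ c); [exact: IH1|exact: IH2].
case: rule rb rb' => [{}r {}r' rule vr|l l' vl vl' far] rb rb'.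
  exact: vm_rule_virtually_equivalent rule vr rb rb'.
by apply: (far_virtually_equivalent vl vl' _ rb rb'); rewrite far.
Qed.

End WordMoves.

(** * Gauss diagrams of words *)

HB.instance Definition _ := gen_eqMixin sign.

Section Timed.
Variables (R : realType) (D : eqType).
Local Open Scope ring_scope.
Implicit Types (x : nat -> R) (es : seq (option D)).

Fixpoint timed x es : seq (R * D) :=
  if es is o :: es' then
    let l := timed (x \o S) es' in if o is Some d then (x 0%N, d) :: l else l
  else [::].

Lemma timed_snd x es : map snd (timed x es) = pmap id es.
Proof. by elim: es x => //= -[d|] es IH x /=; rewrite IH. Qed.

Lemma timedP x es t d :
  reflect (exists2 r, (r < size es)%N & nth None es r = Some d /\ t = x r)
    ((t, d) \in timed x es).
Proof.
elim: es x => [|o es IH] x /=; first by apply: (iffP idP) => // -[].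
have tl : (exists2 r, (r < size es)%N & nth None es r = Some d /\ t = x r.+1) ->
    exists2 r, (r < (size es).+1)%N & nth None (o :: es) r = Some d /\ t = x r.
  by move=> [r h1 h2]; exists r.+1.
case: o tl => [d'|] tl; rewrite ?in_cons; last first.
  by apply: (iffP (IH _)) => // -[[|r] h1 [h2 h3]] //; exists r.
apply: (iffP orP) => [[/eqP[-> ->]|/IH]|[[|r] h1 [h2 h3]]].
- by exists 0%N.
- exact: tl.
- by left; move: h2 => [->]; rewrite h3.
- by right; apply/IH; exists r.
Qed.

Lemma sorted_timed x es : increasing_upto (size es).-1 x ->
  sorted (fun p q : R * D => p.1 < q.1) (timed x es).
Proof.
have tr : transitive (fun p q : R * D => p.1 < q.1) by move=> ? ? ?; exact: lt_trans.
rewrite sorted_pairwise //; elim: es x => //= o es IH x hx.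
have hx' : increasing_upto (size es).-1 (x \o S) by move=> r rN; apply: hx; lia.
case: o => [d|]; last exact: IH.
rewrite pairwise_cons IH // andbT; apply/allP => -[t e] /timedP[r rN [_ ->]] /=.
by apply: (increasing_lt hx); lia.
Qed.

End Timed.

Section WordGauss.
Variables (R : realType) (n : nat).
Local Open Scope ring_scope.
Implicit Types (b : vbd R n) (w : seq letter) (i j k : 'I_n) (s : sign).

Lemma crossing_arrow_inj i j (t : R) s i' j' t' s' :
  crossing_arrow i j t s = crossing_arrow i' j' t' s' -> [/\ i = i', j = j', t = t' & s = s'].
Proof. by case: s; case: s' => -[]. Qed.

Lemma map_crossing_arrow (h : 'I_n -> R -> R) i j (t : R) s i' j' t' s' :
  map_arrow h (crossing_arrow i j t s) = crossing_arrow i' j' t' s' ->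
  [/\ i = i', j = j', s = s', h i t = t' & h j t = t'].
Proof. by case: s; case: s' => -[] -> <- -> <-. Qed.

Lemma nth_events (p : 'S_n) w r : (r < size w)%N ->
  nth None (events p w) r =
  event (p * word_state n w r)%g (nth (0%N, Virtual) w r).
Proof.
elim: w p r => // l w IH p [|r] rw /=.
  by rewrite /word_state take0 word_perm_nil mulg1.
by rewrite IH // -mulgA /word_state /= word_perm_cons.
Qed.

Lemma regular_arrows_word b w x a : all (valid_letter n) w ->
  follows b (size w) (word_state n w) (word_value w) x ->
  regular_arrows b a <-> exists r i j s, [/\ (r < size w)%N,
    event (word_state n w r) (nth (0%N, Virtual) w r) = Some (i, j, s) &
    a = crossing_arrow i j (x r.+1) s].
Proof.
move=> vw F; split=> [[i [j [t [s [It d va ->]]]]]|[r [i [j [s [rw /eventP[e1 e2 e3] ->]]]]]].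
  have t01 := descends_interior It d; have /(descends_ht _ _ _ t01)[e c] := d.
  have ij : i != j by apply/eqP => ij; move: d; rewrite ij => /descends_irr.
  have [l hl] := exists_location (follows_incr F) (follows_0 F) (follows_1 F) It.
  case: l hl => [t0|t1|r [rN ht]|r [rN tE]].
  - by rewrite t0 ltxx in t01.
  - by rewrite t1 ltxx andbF in t01.
  - have := follows_gap F i j rN ht; have := follows_gap F j i rN ht.
    rewrite e ltxx => h1; rewrite (perm_neq _ ij) => h2.
    by move: h2; rewrite -h1.
  rewrite tE in e c va *; exists r, i, j, s; split=> //.
  have /andP[c1 c2] := (follows_node_crosses i j F rN).1 c.
  have : swapped (word_state n w r) (word_state n w r.+1) i j by rewrite /swapped c1.
  rewrite word_stateS // => /swapped_adj_swap[_ p1 p2]; apply/eventP; split=> //.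
  by move: va; rewrite (follows_value F rN ij e).
have vl : valid_letter n (nth (0%N, Virtual) w r) by move/all_nthP: vw; exact.
set l := nth _ _ _ in vl e1 e2 e3; case/andP: vl => l0 ln.
have sw : (word_state n w r j < word_state n w r i)%N by rewrite e2 e3 ltn_predL.
have sw' : (word_state n w r.+1 i < word_state n w r.+1 j)%N.
  rewrite word_stateS // -/l !permM !adj_swapE e2 e3 ln !eqxx.
  by case: eqP => [|_]; lia.
have ij : i != j by apply/eqP => ij; rewrite ij ltnn in sw.
have c : crosses (ht b) i j (x r.+1) by apply/(follows_node_crosses _ _ F rw); rewrite sw.
have e : ht b i (x r.+1) = ht b j (x r.+1).
  apply/eqP; rewrite eq_le !leNgt !(follows_node F rw) //; last by rewrite eq_sym.
  by rewrite sw ltnNge (ltnW sw') ltnNge (ltnW sw) /=.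
have Ix : I01 (x r.+1) by apply: (follows_node_I01 F); rewrite ltnS ltnW.
exists i, j, (x r.+1), s; split=> //.
  by apply/descends_ht => //; exact: ht_meet_interior e.
by rewrite (follows_value F rw ij e).
Qed.

(** The shift by [S] is that of [follows], where the letter [r] takes place at [x r.+1]. *)
Definition timed_word w (x : nat -> R) := timed (x \o S) (events (1%g : 'S_n) w).

Lemma timed_wordP b w x i j t s : all (valid_letter n) w ->
  follows b (size w) (word_state n w) (word_value w) x ->
  (t, (i, j, s)) \in timed_word w x <-> regular_arrows b (crossing_arrow i j t s).
Proof.
move=> vw F; split=> [/timedP[r]|/(regular_arrows_word _ vw F)[r [i' [j' [s' [rw e]]]]]].
  rewrite size_events => rw []; rewrite nth_events // mul1g => e -> /=.
  by apply/(regular_arrows_word _ vw F); exists r, i, j, s.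
move=> /crossing_arrow_inj[-> -> -> ->]; apply/timedP; exists r; rewrite ?size_events //.
by rewrite nth_events // mul1g.
Qed.

Lemma sorted_timed_word b w x : follows b (size w) (word_state n w) (word_value w) x ->
  sorted (fun p q : R * arrow_data n => p.1 < q.1) (timed_word w x).
Proof.
move=> F; apply: sorted_timed => r; rewrite size_events => rN /=.
by apply: (follows_incr F); lia.
Qed.

(** Along the strand [k] the increasing map [h k] carries the timed arrows of [w] to those of [w'].
    Both lists are sorted by time and have the same members, hence are equal; forgetting the times
    gives the hypothesis of [weq_projections]. *)
Lemma gauss_equiv_weq b b' w w' : all (valid_letter n) w -> all (valid_letter n) w' ->
  reads_word b w -> reads_word b' w' -> gauss_equiv (gauss b) (gauss b') -> weq n w w'.
Proof.
move=> vw vw' rb rb' [/= pe [h [hh e]]].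
have tr : transitive (fun p q : R * arrow_data n => p.1 < q.1).
  by move=> ? ? ?; exact: lt_trans.
apply: (weq_projections (p := 1%g)) => //; first by rewrite -(reads_word_perm rb) -(reads_word_perm rb').
case: rb rb' => [x F] [x' F'] k.
rewrite /word_arrows -(timed_snd (x \o S)) -(timed_snd (x' \o S)) !filter_map.
rewrite -/(timed_word w x) -/(timed_word w' x').
pose g (p : R * arrow_data n) := (h k p.1, p.2).
set l := seq.filter _ (timed_word w x); set l' := seq.filter _ (timed_word w' x').
suff <- : map g l = l' by rewrite -map_comp.
have Il p : p \in timed_word w x -> I01 p.1.
  case: p => t [[i j] s] /(timed_wordP _ _ _ _ vw F)/regular_arrows_interior.
  by case: s => -[/andP[t0 t1] _]; apply/I01E; rewrite !ltW.
apply: (irr_sorted_eq tr) => [p|||].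
- by rewrite /= ltxx.
- apply: (homo_sorted_in (P := mem l) (e := fun p q : R * arrow_data n => p.1 < q.1)).
  + move=> p q; rewrite !mem_filter => /andP[_ hp] /andP[_ hq] /=.
    by have [_ _] := hh k; apply; exact: Il.
  + exact: allss.
  + exact: sorted_filter (sorted_timed_word F).
- exact: sorted_filter (sorted_timed_word F').
move=> [u [[i j] s]]; apply/mapP/idP => [[[t [[i' j'] s']]]|].
  rewrite mem_filter => /andP[/= tk /(timed_wordP _ _ _ _ vw F) ra] [-> -> -> ->].
  have : regular_arrows b' (map_arrow h (crossing_arrow i' j' t s')) by rewrite -e; exists (crossing_arrow i' j' t s').
  move=> ra'; rewrite mem_filter /= tk; apply/(timed_wordP _ _ _ _ vw' F').
  have [i2 [j2 [t2 [s2 [_ _ _ e2]]]]] := ra'.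
  have [? ? ? e3 e4] := map_crossing_arrow e2; subst i2 j2 s2.
  have -> : h k t = t2 by case/orP: tk => /eqP ->.
  by rewrite -e2.
rewrite mem_filter => /andP[/= tk /(timed_wordP _ _ _ _ vw' F')].
rewrite -[regular_arrows b' _]/((regular_arrows b' : set _) _) -e => -[a ra ea].
have [i2 [j2 [t2 [s2 [_ _ _ e2]]]]] := ra; rewrite e2 in ea ra.
have [? ? ? e3 e4] := map_crossing_arrow ea; subst i2 j2 s2.
exists (t2, (i, j, s)).
  by rewrite mem_filter /= tk; apply/(timed_wordP _ _ _ _ vw F).
by rewrite /g /=; congr pair; case/orP: tk => /eqP ->.
Qed.

End WordGauss.

(** * Every braid Gauss diagram is realized *)

Section Realization.
Variables (R : realType) (n : nat).
Local Open Scope classical_set_scope.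
Local Open Scope ring_scope.

Lemma exists_zip (T D : eqType) (P : T -> D -> Prop) (s : seq T) :
  (forall t, t \in s -> exists d, P t d) ->
  exists l : seq (T * D), map fst l = s /\ forall p, p \in l -> P p.1 p.2.
Proof.
elim: s => [|t s IH] h; first by exists [::].
have [d hd] := h t (mem_head _ _).
have [u us|l [e hl]] := IH; first by apply: h; rewrite in_cons us orbT.
exists ((t, d) :: l); split=> [|p]; first by rewrite /= e.
by rewrite in_cons => /orP[/eqP ->|/hl].
Qed.

Lemma nth_pair (T D : Type) (t : T) (d : D) (l : seq (T * D)) q :
  nth (t, d) l q = (nth t (map fst l) q, nth d (map snd l) q).
Proof.
case: (ltnP q (size l)) => h; last by rewrite !nth_default ?size_map.
by rewrite !(nth_map (t, d)) //; case: nth.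
Qed.

(** The distinct times of the parametrization put the arrows in a linear order. A word with this
    list of arrows and the permutation of [g] is read by a diagram, whose crossings then have to be
    moved to the ends of the arrows of [g]. *)
Lemma braid_gauss_realization (g : gauss_diagram R n) : braid_gauss_diagram g ->
  exists b : vbd R n, gauss_equiv (gauss b) g.
Proof.
move=> [_ loop [p [time [hp hta inj]]]].
have {}inj a c : arrows g a -> arrows g c -> time a = time c -> a = c.
  by move=> ga gc e; apply: contrapT => /(inj _ _ ga gc).
have [s0 hs0] : exists s : seq R, forall t, t \in s <-> exists2 a, arrows g a & time a = t.
  have /finite_seqP[s hs] : finite_set (time @` arrows g).
    by apply: finite_image; exact: arrows_finite.
  by exists s => t; rewrite -[exists2 _, _ & _]/((time @` arrows g) t) hs.
pose s := sort <=%R (undup s0).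
have hs t : t \in s <-> exists2 a, arrows g a & time a = t.
  by rewrite mem_sort mem_undup; exact: hs0.
have ss : sorted <%R s by rewrite sort_lt_sorted undup_uniq.
pose arr t (d : arrow_data n) := map_arrow p (crossing_arrow d.1.1 d.1.2 t d.2).
have dataE a : arrows g a -> exists d, proper_arrow d /\ a = arr (time a) d.
  move=> ga; have := loop a ga; have := hta a ga.
  case: a ga => ti tp hi hp' [] ga /= [_ e1 e2] th.
    by exists (ti, hi, Plus); split=> //; rewrite /arr /map_arrow /= -e1 -e2.
  by exists (hi, ti, Minus); split; rewrite ?/proper_arrow 1?eq_sym // /arr /map_arrow /= -e1 -e2.
have [t /hs[a ga <-]|l [ls hl]] := @exists_zip _ _ (fun t d =>
    [/\ proper_arrow d, arrows g (arr t d) & time (arr t d) = t]) s.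
  by have [d [pd e]] := dataE a ga; exists d; rewrite -e.
have [w [vw ew pw]] : exists w, [/\ all (valid_letter n) w,
    word_arrows (1%g : 'S_n) w = map snd l & (1 * word_perm n w)%g = gauss_perm g].
  by apply: word_of_arrows; apply/allP => d /mapP[q /hl[h _ _] ->].
rewrite mul1g in pw.
have [b rb] := exists_reads_word R n w; exists b.
have [x F] := rb; pose T := timed_word n w x.
have sT := sorted_timed_word F; rewrite -/T in sT.
have eT : map snd T = map snd l by rewrite /T /timed_word timed_snd -ew.
have sz : size T = size l by rewrite -(size_map snd T) eT size_map.
have szs : size s = size l by rewrite -ls size_map.
pose u := map fst T; have us : sorted <%R u by rewrite sorted_map.
have szu : size u = size l by rewrite size_map.
(* The [q]-th regular crossing time of [b] goes to the [q]-th arrow time of [g], and from there to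
   the interval [k] by its parametrization; both steps are increasing. *)
pose f k t := p k (nth 0 s (index t u)).
have fE k q : (q < size l)%N -> f k (nth 0 u q) = p k (nth 0 s q).
  by move=> ql; rewrite /f index_uniq ?szu //; apply: lt_sorted_uniq.
have mem_s q : (q < size l)%N -> nth 0 s q \in s by move=> ql; rewrite mem_nth ?szs.
have Is t : t \in s -> I01 t by move=> /hs[a ga <-]; case: (hta a ga).
have arrb a : regular_arrows b a <-> exists q i j v, [/\ (q < size l)%N,
    nth (0, (i, j, v)) T q = (nth 0 u q, (i, j, v)),
    nth (0, (i, j, v)) l q = (nth 0 s q, (i, j, v)) & a = crossing_arrow i j (nth 0 u q) v].
  split=> [ra|[q [i [j [v [ql e1 _ ->]]]]]].
    have [i [j [t [v [_ _ _ e]]]]] := ra; rewrite e in ra *.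
    move/(timed_wordP _ _ _ _ vw F): ra => mT; have mT' := mT.
    rewrite -index_mem -/T sz in mT'.
    have := nth_index (0, (i, j, v)) mT; rewrite -/T; set q := index _ T in mT' * => e1.
    have eu : nth 0 u q = t by rewrite /u (nth_map (0, (i, j, v))) ?sz // e1.
    exists q, i, j, v; split=> //; last by rewrite eu.
      by rewrite e1 eu.
    by rewrite nth_pair ls -eT (nth_map (0, (i, j, v))) ?sz // e1.
  apply/(timed_wordP _ _ _ _ vw F); rewrite -e1; apply: mem_nth.
  by rewrite -/T sz.
have ltl q : (q < size l)%N -> forall i j v, nth (0, (i, j, v)) l q = (nth 0 s q, (i, j, v)) ->
    arrows g (map_arrow p (crossing_arrow i j (nth 0 s q) v)) /\
    time (map_arrow p (crossing_arrow i j (nth 0 s q) v)) = nth 0 s q.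
  by move=> ql i j v e; have := hl _ (mem_nth (0, (i, j, v)) ql); rewrite e => -[].
have timeE k t : arrow_time (gauss b) k t -> exists q, [/\ (q < size l)%N, t = nth 0 u q &
    0 < p k (nth 0 s q) < 1].
  move=> [a /arrb[q [i [j [v [ql _ e ->]]]]]] h; exists q.
  have [/arrows_interior[h1 h2] _] := ltl q ql i j v e.
  by case: v e h h1 h2 => _ /arrow_endsP[[-> ->]|[-> ->]] /=.
apply: (@gauss_equiv_increasing _ _ _ _ f).
- by rewrite /= (reads_word_perm rb).
- by move=> k t /timeE[q [ql -> h]]; rewrite fE.
- move=> k t t' /timeE[q [ql -> _]] /timeE[q' [ql' -> _]] lt; rewrite !fE //.
  have [_ _ mono] := hp k; apply: mono; [exact/Is/mem_s|exact/Is/mem_s|].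
  by move: lt; rewrite !lt_sorted_ltn_nth // inE ?szu ?szs.
apply/seteqP; split=> [a [c /arrb[q [i [j [v [ql _ e ->]]]]] <-]|a ga].
  have [ga _] := ltl q ql i j v e.
  suff -> : map_arrow f (crossing_arrow i j (nth 0 u q) v) =
      map_arrow p (crossing_arrow i j (nth 0 s q) v) by [].
  by case: (v); rewrite /map_arrow /= !fE.
have : time a \in map fst l by rewrite ls; apply/hs; exists a.
move=> /mapP[[t [[i j] v]] lt /= et]; have ql := lt; rewrite -index_mem in ql.
have e2 := nth_index (0, (i, j, v)) lt; set q := index _ l in ql e2.
have st : nth 0 s q = t by rewrite -ls (nth_map (0, (i, j, v))) // e2.
have e3 : nth (0, (i, j, v)) l q = (nth 0 s q, (i, j, v)) by rewrite st.
have [ga' ta] := ltl q ql i j v e3.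
exists (crossing_arrow i j (nth 0 u q) v).
  apply/arrb; exists q, i, j, v; split=> //.
  by rewrite nth_pair eT; congr pair; rewrite (nth_map (0, (i, j, v))) // e2.
have -> : a = map_arrow p (crossing_arrow i j (nth 0 s q) v) by apply: inj; rewrite // ta et st.
by case: (v); rewrite /map_arrow /= !fE.
Qed.

End Realization.

(** * Isotopy invariance of the Gauss diagram *)

Section IsotopyInvariance.
Variables (R : realType) (n m : nat) (H : R -> vbd R n) (c : 'I_m -> R -> R * R).
Local Open Scope classical_set_scope.
Local Open Scope ring_scope.
Implicit Types (i j k : 'I_n) (q : 'I_m) (s t u : R).
Hypothesis H_cont : forall k, {within square, continuous (fun st : R * R => H st.1 k st.2)}.
Hypothesis c_cont : forall q, {within I01, continuous (c q)}.
Hypothesis c_inj : forall s, I01 s -> injective (c^~ s).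
Hypothesis c_range : forall s, I01 s -> range (c^~ s) = crossing (H s).

Let C q s : R * R := c q (clamp s).
Let tm q s : R := (C q s).1.
Let G i s t : R := ht (H (clamp s)) i t.
Let thru i q s : Prop := G i s (tm q s) = (C q s).2.

Let G_cont i : continuous (fun st : R * R => G i st.1 st.2).
Proof.
move=> [s t]; have /subspace_continuousP cf := @H_cont i.
apply: (@cvg_comp _ _ _ (fun st : R * R => H (clamp st.1) i (clamp st.2)) (@snd R R)
  (nbhs (s, t)) (nbhs (H (clamp s) i (clamp t)))); last exact: cvg_snd.
have sq u v : square (clamp u, clamp v) by split; exact: clamp_I01.
apply: (@cvg_comp _ _ _ (fun st : R * R => (clamp st.1, clamp st.2))
  (fun st : R * R => H st.1 i st.2) _ _ _ _ (cf _ (sq s t))).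
have cc : (clamp st.1, clamp st.2) @[st --> (s, t)] --> (clamp s, clamp t).
  have cs := @continuous_clamp R s; have ct := @continuous_clamp R t.
  apply: cvg_to_pair.
    by apply: (@cvg_comp _ _ _ (@fst R R) (@clamp R) _ (nbhs s) _ _ cs); exact: cvg_fst.
  by apply: (@cvg_comp _ _ _ (@snd R R) (@clamp R) _ (nbhs t) _ _ ct); exact: cvg_snd.
move=> A hA.
have h0 : nbhs (s, t) (fun st : R * R => square (clamp st.1, clamp st.2) ->
  A (clamp st.1, clamp st.2)) := cc _ hA.
by apply: (@filterS _ (nbhs (s, t)) _ _ _ _ h0) => -[u v] h; exact: (h (sq u v)).
Qed.

Let C_cont q : continuous (C q). Proof. by apply: within_clamp; exact: c_cont. Qed.

Let tm_cont q : continuous (tm q).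
Proof. by move=> s; apply: (@cvg_comp _ _ _ (C q) (@fst R R) (nbhs s) (nbhs (C q s)) _ (@C_cont q s));
exact: cvg_fst. Qed.

Let G_cvg i s (f : R -> R) : {for s, continuous f} -> G i s' (f s') @[s' --> s] --> G i s (f s).
Proof.
move=> cf; apply: (@cvg_comp _ _ _ (fun s' => (s', f s')) (fun st : R * R => G i st.1 st.2)
  (nbhs s) (nbhs (s, f s))); last exact: (@G_cont i (s, f s)).
by apply: cvg_to_pair; [exact: cvg_id|exact: cf].
Qed.

(** Not passing through the track is an open condition, both the strand and the track being
    continuous. *)
Let thru_near i q s : \forall s' \near s, thru i q s' -> thru i q s.
Proof.
have [h|h] := pselect (thru i q s); first by near=> s'.
have cd : G i s' (tm q s') - (C q s').2 @[s' --> s] --> G i s (tm q s) - (C q s).2.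
  apply: cvgB; first by apply: G_cvg; exact: tm_cont.
  by apply: (@cvg_comp _ _ _ (C q) (@snd R R) (nbhs s) (nbhs (C q s)) _ (@C_cont q s));
    exact: cvg_snd.
have : \forall s' \near s, G i s' (tm q s') - (C q s').2 != 0.
  have nz : G i s (tm q s) - (C q s).2 != 0 by rewrite subr_eq0; apply/eqP.
  exact: (cvgr_neq0 _ cd nz).
by apply: filterS => s' /eqP h1 h2; case: h1; rewrite h2 subrr.
Unshelve. all: by end_near. Qed.

Let thru_pair q s : exists i j, [/\ i != j, thru i q s & thru j q s].
Proof.
have : crossing (H (clamp s)) (C q s) by rewrite -c_range; [exists q|exact: clamp_I01].
move=> [i [j [t [It ij ei ej]]]]; exists i, j; split=> //.
  by rewrite /thru /tm -ei !strandE.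
by rewrite /thru /tm -ej !strandE.
Qed.

Let tm_I01 q s : I01 (tm q s).
Proof.
have : crossing (H (clamp s)) (C q s) by rewrite -c_range; [exists q|exact: clamp_I01].
by move=> [i [j [t [It ij ei ej]]]]; rewrite /tm -ei strand_fst.
Qed.

Let thru_three i j k q s : i != j -> thru i q s -> thru j q s -> thru k q s -> k = i \/ k = j.
Proof.
move=> ij hi hj hk; have [->|ki] := eqVneq k i; [by left|have [->|kj] := eqVneq k j; first by right].
case: (@no_triple _ _ (H (clamp s)) k i j (tm q s)) => //; split.
  by rewrite -/(G k s _) hk -hi.
by rewrite -/(G i s _) hi -hj.
Qed.

Let exists_thru i j s t : I01 t -> i != j -> G i s t = G j s t ->
  exists q, [/\ tm q s = t, thru i q s & thru j q s].
Proof.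
move=> It ij e.
have : range (c^~ (clamp s)) (H (clamp s) i t).
  rewrite c_range; last exact: clamp_I01.
  by exists i, j, t; split=> //; apply/esym/strand_eqP.
move=> [q _ eq]; have tE : tm q s = t by rewrite /tm /C eq strand_fst.
by exists q; split=> //; rewrite /thru tE /C eq strandE.
Qed.

Let thru_tm i q q' s : thru i q s -> thru i q' s -> tm q s = tm q' s -> q = q'.
Proof.
move=> h h' e; apply: (c_inj (clamp_I01 s)); rewrite -/(C q s) -/(C q' s).
by rewrite [C q s]surjective_pairing [C q' s]surjective_pairing -h -h' -/(tm q s) -/(tm q' s) e.
Qed.

Definition through_descending i j q s : Prop :=
  [/\ thru i q s, thru j q s & crosses (ht (H (clamp s))) i j (tm q s)].
Local Notation D := through_descending.

Let D_neq i j q s : D i j q s -> i != j.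
Proof. by case=> _ _ h; apply/eqP => e; rewrite e in h; case: (crosses_asym h h). Qed.

Let exists_D q s : exists i j, D i j q s.
Proof.
have [i [j [ij hi hj]]] := thru_pair q s.
have e : ht (H (clamp s)) i (tm q s) = ht (H (clamp s)) j (tm q s).
  by rewrite -/(G i s _) hi -hj.
by have [h|h] := ht_crosses (tm_I01 q s) ij e; [exists i, j|exists j, i].
Qed.

Let D_unique i j i' j' q s : D i j q s -> D i' j' q s -> i = i' /\ j = j'.
Proof.
move=> d d'; have ij := D_neq d; have ij' := D_neq d'.
case: d d' => hi hj h [hi' hj' h'].
have [ei|ei] := thru_three ij hi hj hi'; have [ej|ej] := thru_three ij hi hj hj';
  subst i' j'; rewrite ?eqxx // in ij' *.
by case: (crosses_asym h h').
Qed.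

(** Nearby, the two strands through the track are among those at [s], hence are the same two. Just
    before the crossing, [i] is still above [j] at the fixed time [a'], and the strands do not meet
    between [a'] and the crossing, since every other common crossing stays outside the window; so
    [i] still descends. *)
Let D_near i j q s : D i j q s -> \forall s' \near s, D i j q s'.
Proof.
move=> d; have ij := D_neq d; case: d => hi hj [a [e [at_ te ha he]]].
have eij : G i s (tm q s) = G j s (tm q s) by rewrite hi -hj.
have /andP[t0 t1] := ht_meet_interior (tm_I01 q s) ij eij.
(* A window around the crossing inside the unit interval, in which [i] and [j] meet only at
   [tm q s]. *)
pose a' := (Num.max a 0 + tm q s) / 2; pose e' := (tm q s + Num.min e 1) / 2.
have [aa a0 at'] : [/\ a < a', 0 < a' & a' < tm q s].
  have h1 : a <= Num.max a 0 by rewrite le_max lexx.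
  have h2 : 0 <= Num.max a 0 by rewrite le_max lexx orbT.
  have h3 : Num.max a 0 < tm q s by rewrite gt_max at_.
  by rewrite /a'; move: (Num.max a 0) h1 h2 h3 => y *; split; lra.
have [ee e1 te'] : [/\ e' < e, e' < 1 & tm q s < e'].
  have h1 : Num.min e 1 <= e by rewrite ge_min lexx.
  have h2 : Num.min e 1 <= 1 by rewrite ge_min lexx orbT.
  have h3 : tm q s < Num.min e 1 by rewrite lt_min te.
  by rewrite /e'; move: (Num.min e 1) h1 h2 h3 => y *; split; lra.
have meet u : a' <= u <= e' -> G i s u = G j s u -> u = tm q s.
  move=> /andP[u1 u2] eu; case: (ltgtP u (tm q s)) => // h.
    have := ha u; rewrite h (lt_le_trans aa u1) -/(G i s u) -/(G j s u) eu ltxx => /(_ isT).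
    by [].
  have := he u; rewrite h (le_lt_trans u2 ee) -/(G i s u) -/(G j s u) eu ltxx => /(_ isT).
  by [].
have E1 : \forall s' \near s, forall k, thru k q s' -> thru k q s.
  by apply: (@filter_forall _ _ (fun k s' => thru k q s' -> thru k q s) (nbhs s)) => k; exact: thru_near.
have E2 : \forall s' \near s, a' < tm q s' < e'.
  have h1 := cvgr_gt (tm q s) (@tm_cont q s) _ at'.
  have h2 := cvgr_lt (tm q s) (@tm_cont q s) _ te'.
  by near=> s'; apply/andP; split; near: s'; [exact: h1|exact: h2].
have E3 : \forall s' \near s, G j s' a' < G i s' a'.
  have h : 0 < G i s a' - G j s a' by rewrite subr_gt0; apply: ha; rewrite aa.
  have cd : G i s' a' - G j s' a' @[s' --> s] --> G i s a' - G j s a'.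
    by apply: cvgB; apply: (@G_cvg _ _ (cst a')); exact: cst_continuous.
  by near=> s'; rewrite -subr_gt0; near: s'; exact: (cvgr_gt _ cd _ h).
(* A track on both strands at nearby stages is on both at [s] by [thru_near]; there it lies outside
   the closed window, and by continuity it stays outside. *)
have E4 : \forall s' \near s, forall q', q' != q -> thru i q' s' -> thru j q' s' ->
    ~ (a' <= tm q' s' <= e').
  apply: (@filter_forall _ _ (fun q' s' => q' != q -> thru i q' s' -> thru j q' s' ->
    ~ (a' <= tm q' s' <= e')) (nbhs s)) => q'; have [->|qq] := eqVneq q' q; first by near=> s'.
  have [hi'|hi'] := pselect (thru i q' s); last first.
    by near=> s' => _ h; case: hi'; move: h; near: s'; exact: thru_near.
  have [hj'|hj'] := pselect (thru j q' s); last first.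
    by near=> s' => _ _ h; case: hj'; move: h; near: s'; exact: thru_near.
  have out : (tm q' s < a') || (e' < tm q' s).
    rewrite -[_ || _]negbK negb_or -!leNgt; apply/negP => h.
    have te2 : tm q' s = tm q s by apply: (meet _ h); rewrite hi' -hj'.
    by have := thru_tm hi' hi te2 => e2; rewrite e2 eqxx in qq.
  case/orP: out => out.
    near=> s' => _ _ _ /andP[h1 _]; have : tm q' s' < a'.
      by near: s'; exact: (cvgr_lt _ (@tm_cont q' s) _ out).
    by rewrite ltNge h1.
  near=> s' => _ _ _ /andP[_ h1]; have : e' < tm q' s'.
    by near: s'; exact: (cvgr_gt _ (@tm_cont q' s) _ out).
  by rewrite ltNge h1.
near=> s'.
have F1 : forall k, thru k q s' -> thru k q s by near: s'.
have /andP[F2 F2'] : a' < tm q s' < e' by near: s'.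
have F3 : G j s' a' < G i s' a' by near: s'.
have F4 : forall q', q' != q -> thru i q' s' -> thru j q' s' -> ~ (a' <= tm q' s' <= e').
  by near: s'.
have [hi1 hj1] : thru i q s' /\ thru j q s'.
  have [i1 [j1 [ij1 h1 h2]]] := thru_pair q s'.
  have [ei|ei] := thru_three ij hi hj (F1 _ h1); have [ej|ej] := thru_three ij hi hj (F1 _ h2);
  by subst i1 j1; rewrite ?eqxx // in ij1 *.
split=> //; have eij' : ht (H (clamp s')) i (tm q s') = ht (H (clamp s')) j (tm q s').
  by rewrite -/(G i s' _) hi1 -hj1.
have [//|[a2 [e2 [at2 te2 ha2 _]]]] := ht_crosses (tm_I01 q s') ij eij'.
pose y := (Num.max a' a2 + tm q s') / 2.
have [y1 y2 y3] : [/\ a' <= y, a2 < y & y < tm q s'].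
  have h1 : a' <= Num.max a' a2 by rewrite le_max lexx.
  have h2 : a2 <= Num.max a' a2 by rewrite le_max lexx orbT.
  have h3 : Num.max a' a2 < tm q s' by rewrite gt_max F2 at2.
  by rewrite /y; move: (Num.max a' a2) h1 h2 h3 => z *; split; lra.
have nomeet u : a' <= u <= y -> ht (H (clamp s')) j u <> ht (H (clamp s')) i u.
  move=> /andP[u1 u2] eu.
  have ut : u < tm q s' := le_lt_trans u2 y3.
  have [|q' [tq' hi' hj']] := @exists_thru i j s' u _ ij (esym eu).
    by apply/I01E; rewrite (le_trans (ltW a0) u1) /= (le_trans (ltW ut)) // (le_trans (ltW F2')) // ltW.
  apply: (F4 q') => //; first by apply/eqP => qq; rewrite -tq' qq ltxx in ut.
  by rewrite tq' u1 (le_trans (ltW ut)) // ltW.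
have := ht_order_const y1 nomeet; rewrite -/(G j s' a') -/(G i s' a') F3 => /esym F5.
have := ha2 y; rewrite y2 y3 => /(_ isT) F6.
by have := lt_trans F5 F6; rewrite ltxx.
Unshelve. all: by end_near. Qed.

Lemma through_descending_const i j q s : I01 s -> D i j q s = D i j q 0.
Proof.
apply: (locally_constant (f := fun s => D i j q s)) => {}s _.
have [i' [j' d]] := exists_D q s; near=> s' => _.
have d' : D i' j' q s' by near: s'; exact: D_near.
apply/propext; split=> h.
  by have [-> ->] := D_unique h d'.
by have [-> ->] := D_unique h d.
Unshelve. all: by end_near. Qed.

Let clampS s : I01 s -> clamp s = s. Proof. by move=> /I01E; exact: clamp_id. Qed.

(** The right ends take finitely many heights, so by continuity they are locally constant during the
    isotopy. *)
Lemma strand_perm_const s : I01 s -> strand_perm (H s) = strand_perm (H 0).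
Proof.
move=> Is; have := @locally_constant R _ (fun s => strand_perm (H s)) _ s Is; apply => {Is}s Is.
have G1 u k : G k u 1 = height (strand_perm (H (clamp u)) k) by exact: ht1.
have close k j : \forall s' \near s, G k s' 1 = height j -> G k s 1 = height j.
  have [h|h] := pselect (G k s 1 = height j); first by near=> s'.
  have cd : G k s' 1 - height j @[s' --> s] --> G k s 1 - height j.
    apply: cvgB; last exact: cvg_cst.
    by apply: (@G_cvg _ _ (cst 1)); exact: cst_continuous.
  have nz : G k s 1 - height j != 0 by rewrite subr_eq0; apply/eqP.
  near=> s' => h'; have : G k s' 1 - height j != 0 by near: s'; exact: (cvgr_neq0 _ cd nz).
  by rewrite h' subrr eqxx.
near=> s' => Is'.
have F : forall k j, G k s' 1 = height j -> G k s 1 = height j.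
  near: s'; apply: (@filter_forall _ _ (fun k s' => forall j, G k s' 1 = height j ->
    G k s 1 = height j) (nbhs s)) => k.
  by apply: (@filter_forall _ _ (fun j s' => G k s' 1 = height j ->
    G k s 1 = height j) (nbhs s)) => j; exact: close.
apply/permP => k; apply: (@height_inj R).
by have := F k _ (G1 s' k); rewrite G1 !clampS.
Unshelve. all: by end_near. Qed.

Hypothesis c_value : forall s, I01 s -> forall q, value (H s) (c q s) = value (H 0) (c q 0).

Let thru_const i j q k s : I01 s -> D i j q 0 -> thru k q 0 -> thru k q s.
Proof.
move=> Is d; have ij := D_neq d; have [hi hj _] := d.
move: d; rewrite -(through_descending_const _ _ _ Is) => -[hi' hj' _] hk.
by have [->|->] := thru_three ij hi hj hk.
Qed.

Lemma regular_arrows_isotopy s a : I01 s -> regular_arrows (H s) a <->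
  exists i j q v, [/\ D i j q 0, value (H 0) (c q 0) = Regular v &
    a = crossing_arrow i j (c q s).1 v].
Proof.
move=> Is; split=> [[i [j [t [v [It d va ->]]]]]|[i [j [q [v [d va ->]]]]]].
  have ij : i != j by apply/eqP => ij; move: d; rewrite ij => /descends_irr.
  have t01 := descends_interior It d; have [e cr] := (descends_ht _ _ _ t01).1 d.
  have [|q [tq hi hj]] := @exists_thru i j s t It ij; first by rewrite /G clampS.
  have cE : c q s = H s i t.
    by move: hi tq; rewrite /thru /tm /G /C clampS // [c q s]surjective_pairing /= => <- ->; rewrite strandE.
  exists i, j, q, v; split; last by rewrite cE strand_fst.
    rewrite -(through_descending_const _ _ _ Is); split=> //.
    by rewrite tq clampS.
  by rewrite -(c_value Is) cE.
move: d; rewrite -(through_descending_const _ _ _ Is) => d; have ij := D_neq d.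
have It := tm_I01 q s; case: d; rewrite /thru /tm /C /G clampS // => hi hj cr.
rewrite /tm /C clampS // in It.
have e : ht (H s) i (c q s).1 = ht (H s) j (c q s).1 by rewrite hi -hj.
exists i, j, (c q s).1, v; split=> //.
  by apply/descends_ht => //; exact: ht_meet_interior e.
by rewrite strandE // hi -surjective_pairing c_value.
Qed.

(** Each arrow end is moved along its track. Two tracks through one strand never have equal times,
    by injectivity of the tracks, so their order along the strand is preserved. *)
Lemma isotopy_gauss_equiv : gauss_equiv (gauss (H 0)) (gauss (H 1)).
Proof.
have I0 : I01 (0 : R) by apply/I01E; rewrite lexx ler01.
have I1 : I01 (1 : R) by apply/I01E; rewrite lexx ler01.
pose f k t := if [pick q | `[< thru k q 0 /\ tm q 0 = t >]] is Some q then tm q 1 else 0.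
have fE k q : thru k q 0 -> f k (tm q 0) = tm q 1.
  move=> hk; rewrite /f; case: pickP => [q' /asboolP[h e]|/(_ q)/asboolP[]//].
  by rewrite (thru_tm hk h).
have tE q s : I01 s -> (c q s).1 = tm q s by move=> Is; rewrite /tm /C clampS.
have timeE k t : arrow_time (gauss (H 0)) k t -> exists i j q v, [/\ D i j q 0,
    value (H 0) (c q 0) = Regular v, t = tm q 0 & thru k q 0].
  move=> [a /(regular_arrows_isotopy _ I0)[i [j [q [v [d va ->]]]]]] h.
  exists i, j, q, v; have [hi hj _] := d; rewrite tE // in h; split=> //.
    by case: v h {va} => /arrow_endsP[[_ ->]|[_ ->]].
  by case: v h {va} => /arrow_endsP[[-> _]|[-> _]].
apply: (@gauss_equiv_increasing _ _ _ _ f).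
- by rewrite /= (strand_perm_const I1).
- move=> k t /timeE[i [j [q [v [d _ -> hk]]]]]; rewrite fE //.
  have ij := D_neq d; move: d; rewrite -(through_descending_const _ _ _ I1) => -[hi hj _].
  have e : ht (H (clamp 1)) i (tm q 1) = ht (H (clamp 1)) j (tm q 1) := etrans hi (esym hj).
  exact: ht_meet_interior (tm_I01 q 1) ij e.
- move=> k t t' /timeE[i [j [q [v [d _ -> hk]]]]] /timeE[i' [j' [q' [v' [d' _ -> hk']]]]] lt.
  rewrite !fE // -subr_gt0.
  rewrite -(@nonzero_pos R (fun s => tm q' s - tm q s) 0 1) ?ler01 ?subr_gt0 //.
    by move=> s; apply: cvgB; exact: tm_cont.
  move=> s /I01E Is; rewrite subr_eq0; apply/eqP => e.
  have := thru_tm (thru_const Is d' hk') (thru_const Is d hk) e => qq.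
  by move: lt; rewrite qq ltxx.
have mapE i j q v : D i j q 0 -> map_arrow f (crossing_arrow i j (c q 0).1 v) =
    crossing_arrow i j (c q 1).1 v.
  by move=> [hi hj _]; rewrite !tE //; case: v; rewrite /map_arrow /= !fE.
apply/seteqP; split=> [_ [a /(regular_arrows_isotopy _ I0)[i [j [q [v [d va ->]]]]] <-]|].
  by rewrite mapE //; apply/(regular_arrows_isotopy _ I1); exists i, j, q, v.
move=> a /(regular_arrows_isotopy _ I1)[i [j [q [v [d va ->]]]]].
exists (crossing_arrow i j (c q 0).1 v); last exact: mapE.
by apply/(regular_arrows_isotopy _ I0); exists i, j, q, v.
Qed.

End IsotopyInvariance.

Section IsotopicGauss.
Variables (R : realType) (n : nat).
Local Open Scope ring_scope.
Implicit Types (b : vbd R n).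

Lemma gauss_equiv_arrows (g g' : gauss_diagram R n) : gauss_perm g = gauss_perm g' ->
  arrows g = arrows g' -> gauss_equiv g g'.
Proof.
move=> e1 e2; split=> //; have [_ [h [hh e]]] := gauss_equiv_refl g.
by exists h; split=> //; rewrite e.
Qed.

Lemma vbd_eq_ht b b' k t : vbd_eq b b' -> ht b k t = ht b' k t.
Proof. by move=> [e _]; rewrite /ht e //; exact: clamp_I01. Qed.

Lemma vbd_eq_sym b b' : vbd_eq b b' -> vbd_eq b' b.
Proof.
move=> [e v]; split=> [k t It|p]; first by rewrite e.
move=> [i [j [t [It ij h1 h2]]]]; rewrite v //.
by exists i, j, t; rewrite !e.
Qed.

Lemma vbd_eq_gauss b b' : vbd_eq b b' -> gauss_equiv (gauss b) (gauss b').
Proof.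
have sub (c c' : vbd R n) a : vbd_eq c c' -> regular_arrows c a -> regular_arrows c' a.
  move=> e [i [j [t [s [It d va ->]]]]]; exists i, j, t, s.
  have ij : i != j by apply/eqP => ij; move: d; rewrite ij => /descends_irr.
  have t01 := descends_interior It d; have [eh cr] := (descends_ht _ _ _ t01).1 d.
  have eht : ht c = ht c'.
    apply/funext => k; apply/funext => u.
    exact: (vbd_eq_ht _ _ e).
  split=> //; first by apply/descends_ht => //; rewrite -eht.
  case: e => e v; rewrite -e // -v //; exists i, j, t; split=> //.
  by apply/esym/strand_eqP.
move=> e; apply: gauss_equiv_arrows; last first.
  by apply/seteqP; split=> a; apply: sub => //; exact: vbd_eq_sym.
apply/permP => k; apply: (@height_inj R).
by rewrite /= -!ht1; exact: vbd_eq_ht.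
Qed.

Lemma isotopic_gauss b b' : isotopic b b' -> gauss_equiv (gauss b) (gauss b').
Proof.
move=> [H [e0 e1 Hc [m [c [cc cr]]]]].
have c1 s : I01 s -> injective (c^~ s) by move=> /cr[].
have c2 s : I01 s -> range (c^~ s) = crossing (H s) by move=> /cr[].
have c3 s : I01 s -> forall q, value (H s) (c q s) = value (H 0) (c q 0) by move=> /cr[].
have g01 := isotopy_gauss_equiv Hc cc c1 c2 c3.
exact: gauss_equiv_trans (vbd_eq_gauss (vbd_eq_sym e0)) (gauss_equiv_trans g01 (vbd_eq_gauss e1)).
Qed.

End IsotopicGauss.

(** * Invariance of the Gauss diagram under virtual and mixed moves *)

Section Trace.
Variables (R : realType) (n : nat).
Local Open Scope ring_scope.
Implicit Types (i j k l : 'I_n) (s t : R).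

Lemma crossing_letterE (b : vbd R n) (K : {set 'I_n}) t (x : letter) : I01 t ->
  crossing_letter b K t x <-> exists i j, [/\ i \in K, j \in K, i != j,
    ht b i t = ht b j t & x = ((rank b K t i).+1, value b (b i t))].
Proof.
move=> It; have rE i : #|[set k in K | (b k t).2 < (b i t).2]| = rank b K t i.
  by apply: eq_card => k; rewrite !inE !strandE.
by split=> -[i [j [iK jK ij e ->]]]; exists i, j; split=> //;
  rewrite ?rE //; apply/strand_eqP.
Qed.

Definition swaps (w : seq letter) (x : nat) : nat :=
  foldl (fun y (l : letter) => swap_nat l.1 y) x w.

Variables (b : vbd R n) (V : disc R) (K : {set 'I_n}) (w : seq letter) (u : seq R).
Let L := left_time V.
Let U := right_time V.
Hypothesis size_u : size u = size w.
Hypothesis sorted_u : sorted <%R (L :: rcons u U).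
Hypothesis letters : forall t (x : letter), L <= t <= U ->
  (crossing_letter b K t x <-> exists2 r, (r < size w)%N &
     t = nth 0 u r /\ x = nth (0%N, Virtual) w r).
Let N := size w.
Local Notation e := (nth 0 (L :: rcons u U)).
Local Notation lt r := (nth (0%N, Virtual) w r).

Let eS r : (r < N)%N -> e r.+1 = nth 0 u r.
Proof. by move=> rN; rewrite /= nth_rcons size_u rN. Qed.

Let eN : e N.+1 = U. Proof. by rewrite /= nth_rcons size_u ltnn eqxx. Qed.

Let e_lt r q : (r < q)%N -> (q <= N.+1)%N -> e r < e q.
Proof.
move=> rq qN; rewrite lt_sorted_ltn_nth // inE /= size_rcons size_u !ltnS //.
by rewrite (leq_trans (ltnW rq)).
Qed.

Let e_le r q : (r <= q)%N -> (q <= N.+1)%N -> e r <= e q.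
Proof. by rewrite leq_eqVlt => /orP[/eqP ->//|rq] qN; rewrite ltW // e_lt. Qed.

Lemma letter_time r : (r < N)%N -> L < nth 0 u r < U.
Proof.
move=> rN; have h1 := e_lt (ltn0Sn r) (leqW rN); have h2 := e_lt (rN : (r.+1 < N.+1)%N) (leqnn _).
by rewrite eN in h2; rewrite eS // in h1 h2; rewrite [L < _]h1.
Qed.

Let in01 t : L <= t <= U -> I01 t.
Proof.
move=> /andP[h1 h2]; apply/I01E; rewrite (le_trans (left_ge0 V) h1) /=.
exact: le_trans h2 (right_le1 V).
Qed.

Let meet_letter i j t : i \in K -> j \in K -> i != j -> L <= t <= U -> ht b i t = ht b j t ->
  exists2 r, (r < N)%N & t = nth 0 u r /\ lt r = ((rank b K t i).+1, value b (b i t)).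
Proof.
move=> iK jK ij ht_ e_.
have /(letters _ ht_) : crossing_letter b K t ((rank b K t i).+1, value b (b i t)).
  by apply/crossing_letterE; [exact: in01|exists i, j].
by move=> [r rN [h1 h2]]; exists r.
Qed.

Let gap r : R := (e r + e r.+1) / 2.

Let gap_in r : (r <= N)%N -> e r < gap r < e r.+1.
Proof. by move=> rN; have := @e_lt r r.+1 (ltnSn _) rN; rewrite /gap => h; lra. Qed.

Let gap_LU r : (r <= N)%N -> L < gap r < U.
Proof.
move=> rN; have /andP[h1 h2] := gap_in rN; apply/andP; split.
  exact: le_lt_trans (e_le (leq0n r) (leqW rN)) h1.
by apply: lt_le_trans h2 _; have := e_le (rN : (r.+1 <= N.+1)%N) (leqnn _); rewrite eN.
Qed.

Let rank_const s t k : L <= s -> s <= t -> t <= U -> k \in K ->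
  (forall r, (r < N)%N -> ~ (s <= nth 0 u r <= t)) -> rank b K s k = rank b K t k.
Proof.
move=> Ls st tU kK no; apply: rank_eq => l lK.
have [->|lk] := eqVneq l k; first by rewrite !ltxx.
apply: ht_order_const => // v /andP[sv vt] ev.
have [|r rN [vE _]] := meet_letter lK kK lk _ ev.
  by rewrite (le_trans Ls sv) (le_trans vt tU).
by apply: (no r rN); rewrite -vE sv.
Qed.

Lemma rank_inj t : (forall i j, i \in K -> j \in K -> i != j -> ht b i t <> ht b j t) ->
  {in K &, injective (rank b K t)}.
Proof.
move=> no i j iK jK eij; apply/eqP/contraT => ij.
by have [/(rank_lt iK)|/(rank_lt jK)|/(no i j iK jK ij)//] := ltgtP (ht b i t) (ht b j t);
  rewrite eij ltnn.
Qed.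

Let gap_no_meet r i j : (r <= N)%N -> i \in K -> j \in K -> i != j ->
  ht b i (gap r) <> ht b j (gap r).
Proof.
move=> rN iK jK ij eij; have /andP[h1 h2] := gap_LU rN.
have [|q qN [gE _]] := meet_letter iK jK ij _ eij; first by rewrite !ltW.
have := gap_in rN; rewrite gE -eS // => /andP[h3 h4].
have [qr|rq] := ltnP q r.
  by have := lt_le_trans h3 (e_le qr (leqW rN)); rewrite ltxx.
by have := lt_le_trans h4 (e_le (rq : (r.+1 <= q.+1)%N) (ltnW qN : (q.+1 <= N.+1)%N)); rewrite ltxx.
Qed.

Section Step.
Variable r : nat.
Hypothesis rN : (r < N)%N.
Let t := nth 0 u r.

Let gt1 : gap r < t.
Proof. by have /andP[_] := gap_in (ltnW rN); rewrite eS. Qed.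

Let gt2 : t < gap r.+1.
Proof. by have /andP[] := gap_in rN; rewrite eS. Qed.

Let tLU : L <= t <= U.
Proof. by have /andP[h1 h2] := letter_time rN; rewrite !ltW. Qed.

Let u_inj q : (q < N)%N -> nth 0 u q = t -> q = r.
Proof.
move=> qN; rewrite /t -!eS // => eq; case: (ltngtP q r) => // h.
  by have := e_lt (h : (q.+1 < r.+1)%N) (ltnW rN : (r.+1 <= N.+1)%N); rewrite eq ltxx.
by have := e_lt (h : (r.+1 < q.+1)%N) (ltnW qN : (q.+1 <= N.+1)%N); rewrite eq ltxx.
Qed.

Let only s i j : i \in K -> j \in K -> i != j -> gap r <= s <= gap r.+1 -> s != t ->
  ht b i s <> ht b j s.
Proof.
move=> iK jK ij /andP[s1 s2] st es.
have /andP[h1 _] := gap_LU (ltnW rN); have /andP[_ h2] := gap_LU rN.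
have [|q qN [sE _]] := meet_letter iK jK ij _ es.
  by rewrite (le_trans (ltW h1) s1) (le_trans s2 (ltW h2)).
case: (ltngtP q r) => qr; last by rewrite sE qr eqxx in st.
  have /andP[h3 _] := gap_in (ltnW rN); have := lt_le_trans h3 s1.
  by rewrite sE -eS // ltNge e_le // leqW // ltnW.
have /andP[_ h3] := gap_in rN; have := le_lt_trans s2 h3.
by rewrite sE -eS // ltNge e_le // ltnW.
Qed.

(** The letter records the rank at the crossing; passing it exchanges the ranks of the two strands
    and keeps all others. *)
Lemma crossing_step i j : i \in K -> j \in K -> i != j -> ht b i t = ht b j t ->
  crosses (ht b) i j t ->
  [/\ rank b K (gap r) i = (lt r).1, rank b K (gap r) j = (lt r).1.-1, (0 < (lt r).1)%N,
      value b (b i t) = (lt r).2 &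
   forall k, k \in K -> rank b K (gap r.+1) k = swap_nat (lt r).1 (rank b K (gap r) k)].
Proof.
move=> iK jK ij meet cross.
have [q qN [/esym/u_inj -> // lE]] := meet_letter iK jK ij tLU meet.
have [ai aj ci cj] := rank_step_cross gt1 gt2 only iK jK ij (in01 tLU) meet cross.
rewrite lE; split=> // k kK /=.
have [->|ki] := eqVneq k i; first by rewrite ci ai /swap_nat /= gtn_eqF // eqxx.
have [->|kj] := eqVneq k j; first by rewrite cj aj /swap_nat /= eqxx.
(* Another crossing at the same time would have the same letter, hence the same rank and the same
   height, and make a triple point. *)
have alone l : l \in K -> l != k -> ht b l t <> ht b k t.
  move=> lK lk /esym el; rewrite eq_sym in lk.
  have [q' q'N [/esym/u_inj -> // ]] := meet_letter kK lK lk tLU el; rewrite lE => -[er _].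
  have [h|h|h] := ltgtP (ht b k t) (ht b i t).
  - by have := rank_lt kK h; rewrite er ltnn.
  - by have := rank_lt iK h; rewrite er ltnn.
  - apply: (@no_triple _ _ b k i j t) => //; exact: in01.
have acin : gap r <= gap r <= gap r.+1 by rewrite lexx ltW // (lt_trans gt1).
have ccin : gap r <= gap r.+1 <= gap r.+1 by rewrite lexx ltW // (lt_trans gt1).
rewrite (rank_step_alone gt1 gt2 only kK ccin alone).
rewrite -(rank_step_alone gt1 gt2 only kK acin alone).
have inj := rank_inj (fun i j => @gap_no_meet r i j (ltnW rN)).
rewrite /swap_nat /= ifN; last first.
  by apply/eqP; rewrite -aj => /(inj _ _ kK jK) h; rewrite h eqxx in kj.
by rewrite ifN //; apply/eqP; rewrite -ai => /(inj _ _ kK iK) h; rewrite h eqxx in ki.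
Qed.

Lemma letter_step : exists i j, [/\ i \in K, j \in K, i != j, ht b i t = ht b j t &
  crosses (ht b) i j t].
Proof.
have /(crossing_letterE _ _ _ (in01 tLU))[i [j [iK jK ij eij _]]] : crossing_letter b K t (lt r).
  by apply/letters => //; exists r.
by have [h|h] := ht_crosses (in01 tLU) ij eij; [exists i, j|exists j, i; split=> //; rewrite eq_sym].
Qed.

End Step.

Lemma letter_pos r : (r < N)%N -> (0 < (lt r).1)%N.
Proof. by move=> rN; have [i [j [iK jK ij eij cr]]] := letter_step rN; case: (crossing_step rN iK jK ij eij cr). Qed.

Lemma rank_trace r k : (r <= N)%N -> k \in K ->
  rank b K (gap r) k = swaps (take r w) (rank b K L k).
Proof.
move=> rN kK; elim: r rN => [|r IH] rN.
  rewrite take0 /=; apply/esym; have /andP[h1 h2] := gap_LU rN.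
  apply: rank_const => //; try exact: ltW.
  move=> q qN /andP[_]; rewrite -eS //; have /andP[_ h3] := gap_in rN.
  by rewrite leNgt (lt_le_trans h3 (e_le (ltn0Sn q) (leqW qN))).
have [i [j [iK jK ij eij cr]]] := letter_step rN.
have [_ _ _ _ ->] := crossing_step rN iK jK ij eij cr => //.
by rewrite (IH (ltnW rN)) (take_nth (0%N, Virtual)) // /swaps foldl_rcons.
Qed.

Lemma rank_right k : k \in K -> rank b K U k = swaps w (rank b K L k).
Proof.
move=> kK; rewrite -[w in RHS]take_size -(rank_trace (leqnn N)) //; apply/esym.
have /andP[h1 h2] := gap_LU (leqnn N).
apply: rank_const => //; try exact: ltW.
move=> q qN /andP[h3 _]; move: h3; rewrite -eS //; have /andP[h4 _] := gap_in (leqnn N).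
by move/(lt_le_trans h4); rewrite ltNge e_le.
Qed.

(** Which strands cross at which letter depends only on the word and on the ranks at the left side
    of the disc. This allows the two sides of a move to be compared. *)
Lemma descends_letter i j t : i \in K -> j \in K -> L <= t <= U ->
  descends b i j t <-> exists2 r, (r < N)%N & [/\ t = nth 0 u r,
    swaps (take r w) (rank b K L i) = (lt r).1 & swaps (take r w) (rank b K L j) = (lt r).1.-1].
Proof.
move=> iK jK tLU; have It := in01 tLU; split=> [d|[r rN [tE ei ej]]].
  have ij : i != j by apply/eqP => ij; move: d; rewrite ij => /descends_irr.
  have t01 := descends_interior It d; have [eij cr] := (descends_ht _ _ _ t01).1 d.
  have [r rN [tE lE]] := meet_letter iK jK ij tLU eij; exists r => //.
  rewrite tE in eij cr; have [h1 h2 _ _ _] := crossing_step rN iK jK ij eij cr.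
  by rewrite -!rank_trace // ltnW.
have [i0 [j0 [iK0 jK0 ij0 eij cr]]] := letter_step rN.
have [h1 h2 _ _ _] := crossing_step rN iK0 jK0 ij0 eij cr.
have inj := rank_inj (fun i j => @gap_no_meet r i j (ltnW rN)).
have -> : i = i0 by apply: inj => //; rewrite rank_trace ?(ltnW rN) // ei h1.
have -> : j = j0 by apply: inj => //; rewrite rank_trace ?(ltnW rN) // ej h2.
by rewrite tE in It *; apply/descends_ht => //; exact: ht_meet_interior eij.
Qed.

Lemma descends_value i j t r : i \in K -> j \in K -> (r < N)%N -> t = nth 0 u r ->
  descends b i j t -> value b (b i t) = (lt r).2.
Proof.
move=> iK jK rN tE d.
have It : I01 t by have /andP[h1 h2] := letter_time rN; apply: in01; rewrite tE !ltW.
have ij : i != j by apply/eqP => ij; move: d; rewrite ij => /descends_irr.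
have t01 := descends_interior It d; have [eij cr] := (descends_ht _ _ _ t01).1 d.
by rewrite tE in eij cr *; case: (crossing_step rN iK jK ij eij cr).
Qed.

End Trace.

(** * Comparison of two diagrams that agree outside a disc *)

Section Move.
Variables (R : realType) (n : nat).
Local Open Scope classical_set_scope.
Local Open Scope ring_scope.
Implicit Types (b : vbd R n) (V : disc R) (K : {set 'I_n}) (i j k l : 'I_n) (s t : R).

Lemma agree_outside_sym V b b' : agree_outside V b b' -> agree_outside V b' b.
Proof.
move=> [e v]; split=> [k t It h|p [i [j [t [It ij ei ej]]]] nd].
  by rewrite e //; case: h; [right|left].
have ei' : b i t = b' i t by apply: e => //; right; rewrite ei.
have ej' : b j t = b' j t by apply: e => //; right; rewrite ej.
rewrite v //; exists i, j, t; split=> //; first by rewrite ei'.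
by rewrite ej'.
Qed.

Lemma disc_I01 V t : left_time V <= t <= right_time V -> I01 t.
Proof.
move=> /andP[h1 h2]; apply/I01E; rewrite (le_trans (left_ge0 V) h1) /=.
exact: le_trans h2 (right_le1 V).
Qed.

Lemma crosses_near (f f' : 'I_n -> R -> R) i j t a c : a < t < c ->
  (forall s, a < s < c -> f i s = f' i s /\ f j s = f' j s) ->
  crosses f i j t -> crosses f' i j t.
Proof.
move=> /andP[at_ tc] e [a' [c' [a't tc' ha hc]]].
exists (Num.max a a'), (Num.min c c'); split.
- by rewrite gt_max at_.
- by rewrite lt_min tc.
- move=> s; rewrite gt_max => /andP[/andP[h1 h2] h3].
  have [|<- <-] := e s; first by rewrite h1 (lt_trans h3).
  by apply: ha; rewrite h2.
- move=> s; rewrite lt_min => /andP[h3 /andP[h1 h2]].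
  have [|<- <-] := e s; first by rewrite h1 (lt_trans at_).
  by apply: hc; rewrite h2 h3.
Qed.

Lemma eq_left_limit (f g : R -> R) a t : continuous f -> continuous g -> a < t ->
  (forall s, a < s < t -> f s = g s) -> f t = g t.
Proof.
move=> cf cg at_ e; apply/eqP; rewrite -subr_eq0; apply/negPn/negP => nz.
have cd : f s - g s @[s --> t] --> f t - g t by apply: cvgB; [exact: cf|exact: cg].
have near_t : \forall s \near t, f s - g s != 0 by exact: (cvgr_neq0 _ cd nz).
have [r /= r0 hr] := (nbhs_ballP _ _).1 near_t.
have m : Num.max a (t - r) < t by rewrite gt_max at_ ltrBlDr ltrDl.
pose s := (Num.max a (t - r) + t) / 2.
have [s1 s2 s3] : [/\ a < s, t - r < s & s < t].
  have h1 : a <= Num.max a (t - r) by rewrite le_max lexx.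
  have h2 : t - r <= Num.max a (t - r) by rewrite le_max lexx orbT.
  by rewrite /s; move: (Num.max a (t - r)) m h1 h2 => y *; split; lra.
have : f s - g s != 0.
  by apply: hr; rewrite /ball /= ger0_norm ?subr_ge0 ?ltW // ltrBlDr -ltrBlDl.
by rewrite e ?subrr ?eqxx // s1.
Qed.

Section Agree.
Variables (V : disc R) (K : {set 'I_n}).
Local Notation L := (left_time V).
Local Notation U := (right_time V).

Section Pair.
Variables b b' : vbd R n.
Hypothesis run : runs_through b V K.
Hypothesis run' : runs_through b' V K.
Hypothesis agree : agree_outside V b b'.

Lemma agree_strand k t : I01 t -> ~ (L <= t <= U) \/ k \notin K -> b k t = b' k t.
Proof.
move=> It h; apply: agree.1 => //; left; case: (boolP (L <= t <= U)) => ht_.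
  by case: h => // kK; rewrite run //; apply/negP.
by rewrite /disc_set /= strand_fst // (negbTE ht_) => -[].
Qed.

Lemma agree_ht k t : ~ (L <= clamp t <= U) \/ k \notin K -> ht b k t = ht b' k t.
Proof. by move=> h; rewrite /ht agree_strand //; exact: clamp_I01. Qed.

(** The left side belongs to the disc, so agreement there comes as a limit from earlier times, or
    from the common starting points if the disc begins at time 0. *)
Lemma agree_left k : ht b k L = ht b' k L.
Proof.
have L0 := left_ge0 V; move: L0; rewrite le_eqVlt => /orP[/eqP <-|L0].
  by rewrite !ht0.
apply: (eq_left_limit _ _ L0); [exact: continuous_ht|exact: continuous_ht|].
move=> s /andP[s0 sL]; apply: agree_ht; left.
rewrite clamp_id; first by rewrite leNgt sL.
by rewrite ltW //= (le_trans (ltW sL)) // (le_trans (ltW (left_lt_right V))) // right_le1.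
Qed.

Lemma no_mixed_meeting i j t : i \in K -> j \notin K -> L <= t <= U -> ht b i t <> ht b j t.
Proof.
move=> iK jK ht_ /strand_eqP-/(_ (disc_I01 ht_)) e.
by move/negP: jK; apply; apply/(run j ht_); rewrite -e; apply/(run i ht_).
Qed.

Lemma agree_rank_left k : rank b K L k = rank b' K L k.
Proof. by apply: eq_card => l; rewrite !inE !agree_left. Qed.

Lemma agree_descends i j t : I01 t -> descends b i j t ->
  ~ [/\ i \in K, j \in K & L <= t <= U] ->
  descends b' i j t /\ value b' (b' i t) = value b (b i t).
Proof.
move=> It d out; have ij : i != j by apply/eqP => ij; move: d; rewrite ij => /descends_irr.
have t01 := descends_interior It d; have [eij cr] := (descends_ht _ _ _ t01).1 d.
have side : ~ (L <= t <= U) \/ (i \notin K /\ j \notin K).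
  case: (boolP (L <= t <= U)) => ht_; [right|by left].
  case: (boolP (i \in K)) => iK; case: (boolP (j \in K)) => jK //.
  - by case: out.
  - by case: (no_mixed_meeting iK jK ht_).
  - by case: (no_mixed_meeting jK iK ht_).
have ei : b i t = b' i t by apply: agree_strand => //; case: side => [|[]]; [left|right].
have ej : b j t = b' j t by apply: agree_strand => //; case: side => [|[]]; [left|right].
split; last first.
  rewrite -ei; apply/esym; apply: agree.2.
    by exists i, j, t; split=> //; apply/esym/strand_eqP.
  case: side => [h|[iK _]]; first by rewrite /disc_set /= strand_fst // => -[].
  case: (boolP (L <= t <= U)) => ht_; first by rewrite run //; apply/negP.
  by rewrite /disc_set /= strand_fst // (negbTE ht_) => -[].
apply/descends_ht => //; split.
  by apply/strand_eqP => //; rewrite -ei -ej; apply/strand_eqP.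
case: side => [h|[iK jK]]; last first.
  apply: (crosses_near t01) cr => s _.
  by split; apply: agree_ht; right.
case/andP: t01 => t0 t1.
have [tL|Lt] := ltP t L.
  apply: (@crosses_near _ _ _ _ _ 0 L) cr; first by rewrite t0.
  move=> s /andP[s0 sL]; have cs : clamp s = s.
    by apply: clamp_id; rewrite ltW //= (le_trans (ltW sL)) // (le_trans (ltW (left_lt_right V))) // right_le1.
  by split; apply: agree_ht; left; rewrite cs leNgt sL.
have Ut : U < t by rewrite ltNge; apply/negP => tU; apply: h; rewrite Lt.
apply: (@crosses_near _ _ _ _ _ U 1) cr; first by rewrite Ut.
move=> s /andP[Us s1]; have cs : clamp s = s.
  by apply: clamp_id; rewrite (ltW s1) andbT (le_trans _ (ltW Us)) // (le_trans (left_ge0 V)) // ltW // left_lt_right.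
by split; apply: agree_ht; left; rewrite cs [s <= U]leNgt Us andbF.
Qed.

(** Only a disc reaching time 1 needs an argument. The order at the end is given by the ranks for
    two strands in [K] and by agreement for two outside; a mixed pair does not meet inside the disc,
    so its order is that at the left side. *)
Lemma agree_perm : (forall k, k \in K -> rank b K U k = rank b' K U k) ->
  strand_perm b = strand_perm b'.
Proof.
move=> rk; have := right_le1 V; rewrite le_eqVlt => /orP[/eqP U1|U1]; last first.
  apply/permP => k; apply: (@height_inj R); rewrite -!ht1; apply: agree_ht; left.
  by rewrite clamp_id ?ler01 ?lexx // [1 <= U]leNgt U1 andbF.
have LU : L <= U by rewrite ltW // left_lt_right.
have neq (c : vbd R n) i j : i != j -> ht c i 1 <> ht c j 1.
  by move=> ij; rewrite !ht1 => /height_inj/perm_inj/eqP; rewrite (negbTE ij).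
have rlt (c : vbd R n) i j : i \in K -> j \in K ->
    (ht c i 1 < ht c j 1) = (rank c K 1 i < rank c K 1 j)%N.
  move=> iK jK; have [->|ij] := eqVneq i j; first by rewrite ltxx ltnn.
  have [h|h|/(neq c i j ij)//] := ltgtP (ht c i 1) (ht c j 1).
    by rewrite rank_lt.
  by apply/esym/negbTE; rewrite -leqNgt ltnW // rank_lt.
rewrite U1 in rk LU.
have mixed (c : vbd R n) i j : runs_through c V K -> (i \in K) != (j \in K) ->
    (ht c i L < ht c j L) = (ht c i 1 < ht c j 1).
  move=> rc h; apply: ht_order_const => // s hs e.
  have hs' : L <= s <= U by rewrite U1.
  have /strand_eqP-/(_ (disc_I01 hs')) e' := e.
  case: (boolP (i \in K)) h => iK; case: (boolP (j \in K)) => jK // _.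
    by move/negP: jK; apply; apply/(rc j s hs'); rewrite -e'; apply/(rc i s hs').
  by move/negP: iK; apply; apply/(rc i s hs'); rewrite e'; apply/(rc j s hs').
apply: perm_lt_eq => i j; rewrite -!(@height_lt R) -!ht1.
have [h|h] := boolP ((i \in K) == (j \in K)); last by rewrite -!mixed // !agree_left.
case: (boolP (i \in K)) (eqP h) => iK /esym jK; first by rewrite !rlt // !rk.
by rewrite !agree_ht //; right; rewrite ?jK.
Qed.

End Pair.

(* The disc contains at most one regular crossing between the strands in [K]; it
   takes place at time [T], and [Q] holds of the strands going down and up. *)
Definition regular_inside (b : vbd R n) (T : R) (Q : 'I_n -> 'I_n -> Prop) (s0 : sign) : Prop :=
  forall i j t v, i \in K -> j \in K -> L <= t <= U ->
    (descends b i j t /\ value b (b i t) = Regular v) <-> [/\ Q i j, t = T & v = s0].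

(** All arrows agree but the one inside the disc, if any. The reparametrization [f] sends its time
    [T] to [T'] on the strands in [K]; no other arrow end on these strands lies between the sides of
    the disc, so [f] is increasing on the arrow ends. *)
Lemma regular_inside_gauss b b' T T' Q (s0 : sign) : runs_through b V K -> runs_through b' V K ->
  agree_outside V b b' -> strand_perm b = strand_perm b' ->
  L < T < U -> L < T' < U -> regular_inside b T Q s0 -> regular_inside b' T' Q s0 ->
  gauss_equiv (gauss b) (gauss b').
Proof.
move=> run run' ag ep /andP[LT TU] /andP[LT' TU'] ins ins'.
have Tin : L <= T <= U by rewrite !ltW.
have Tin' : L <= T' <= U by rewrite !ltW.
pose f k t := if (k \in K) && (L <= t <= U) then T' else t.
have split_arrow (c c' : vbd R n) i j t v : runs_through c V K -> runs_through c' V K ->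
    agree_outside V c c' -> I01 t -> descends c i j t -> value c (c i t) = Regular v ->
    [/\ i \in K, j \in K & L <= t <= U] \/
    [/\ descends c' i j t, value c' (c' i t) = Regular v, f i t = t & f j t = t].
  move=> rc rc' agc It d va.
  have [h|h] := pselect [/\ i \in K, j \in K & L <= t <= U]; [by left|right].
  have [d' va'] := agree_descends rc agc It d h; rewrite va'; split=> //.
    rewrite /f; case: ifP => // /andP[iK ht_]; case: (boolP (j \in K)) => jK; first by case: h.
    by have [e _ _] := d; case: (no_mixed_meeting rc iK jK ht_); apply/(strand_eqP _ _ _ It).
  rewrite /f; case: ifP => // /andP[jK ht_]; case: (boolP (i \in K)) => iK; first by case: h.
  by have [e _ _] := d; case: (no_mixed_meeting rc jK iK ht_); apply/(strand_eqP _ _ _ It).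
have timeE k t : arrow_time (gauss b) k t -> k \in K -> L <= t <= U -> t = T.
  move=> [a [i [j [t' [v [It d va ->]]]]] h] kK ht_.
  have tE : t' = t by case: v h {va} => /arrow_endsP[[_ ->]|[_ ->]].
  have kE : k = i \/ k = j.
    by case: v h {va} => /arrow_endsP[[-> _]|[-> _]]; [left|right|right|left].
  rewrite tE in It d va.
  have [[iK jK _]|[_ _ fi fj]] := split_arrow b b' i j t v run run' ag It d va.
    by have [_ tT _] := (ins i j t v iK jK ht_).1 (conj d va).
  have fk : f k t = t by case: kE => ->.
  have [iK jK] : i \in K /\ j \in K.
    have [e _ _] := d; have e' := (strand_eqP _ _ _ It).1 e.
    case: kE kK => -> kK; split=> //; apply/negPn/negP => h'.
      by case: (no_mixed_meeting run kK h' ht_).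
    by case: (no_mixed_meeting run kK h' ht_).
  by have [_ tT _] := (ins i j t v iK jK ht_).1 (conj d va).
have fK k : k \in K -> f k T = T' by move=> kK; rewrite /f kK Tin.
apply: (@gauss_equiv_increasing _ _ _ _ f) => //.
- move=> k t kt; rewrite /f; case: ifP => _; last exact: arrow_time_interior kt.
  by rewrite (le_lt_trans (left_ge0 V) LT') (lt_le_trans TU' (right_le1 V)).
- move=> k s t ks kt st; rewrite /f.
  case: ifP => [/andP[kK hs]|hs]; case: ifP => [/andP[kK' ht_]|ht_] //.
  + by move: st; rewrite (timeE k s ks kK hs) (timeE k t kt kK' ht_) ltxx.
  + move/negbT: ht_; rewrite kK /= negb_and -!ltNge; case/andP: hs => Ls sU.
    case/orP => h; last exact: lt_trans TU' h.
    by have := lt_trans (le_lt_trans Ls st) h; rewrite ltxx.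
  + move/negbT: hs; rewrite kK' /= negb_and -!ltNge; case/andP: ht_ => Lt tU.
    case/orP => h; first exact: lt_trans h LT'.
    by have := lt_le_trans (lt_trans h st) tU; rewrite ltxx.
have mapK i j v : i \in K -> j \in K ->
    map_arrow f (crossing_arrow i j T v) = crossing_arrow i j T' v.
  by move=> iK jK; case: v; rewrite /map_arrow /= !fK.
apply/seteqP; split=> [_ [a [i [j [t [v [It d va ->]]]]] <-]|a [i [j [t [v [It d va ->]]]]]].
  have [[iK jK ht_]|[d' va' fi fj]] := split_arrow b b' i j t v run run' ag It d va.
    have [q tT vE] := (ins i j t v iK jK ht_).1 (conj d va).
    have [d' va'] := (ins' i j T' v iK jK Tin').2 (And3 q erefl vE).
    rewrite tT mapK //; exists i, j, T', v; split=> //; exact: disc_I01 Tin'.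
  have -> : map_arrow f (crossing_arrow i j t v) = crossing_arrow i j t v.
    by case: (v); rewrite /map_arrow /= fi fj.
  by exists i, j, t, v.
have [[iK jK ht_]|[d' va' fi fj]] :=
    split_arrow b' b i j t v run' run (agree_outside_sym ag) It d va.
  have [q tT vE] := (ins' i j t v iK jK ht_).1 (conj d va).
  have [d' va'] := (ins i j T v iK jK Tin).2 (And3 q erefl vE).
  exists (crossing_arrow i j T v); last by rewrite mapK // tT.
  exists i, j, T, v; split=> //; exact: disc_I01 Tin.
exists (crossing_arrow i j t v); first by exists i, j, t, v.
by case: (v); rewrite /map_arrow /= fi fj.
Qed.

End Agree.
End Move.

(** * Moves preserve the Gauss diagram; the two implications *)

Section VirtualMoves.
Variables (R : realType) (n : nat).
Local Open Scope ring_scope.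
Implicit Types (b : vbd R n) (V : disc R) (K : {set 'I_n}) (w : seq letter).
Local Notation lt w r := (nth (0%N, Virtual) w r).

Let swapl x : swap_nat x.+1 x = x.+1. Proof. by rewrite /swap_nat eqxx. Qed.

Let swapr x : swap_nat x.+1 x.+1 = x.
Proof. by rewrite /swap_nat /= gtn_eqF // eqxx. Qed.

Let swap_far x y : y != x -> y != x.+1 -> swap_nat x.+1 y = y.
Proof. by rewrite /swap_nat /= => /negbTE -> /negbTE ->. Qed.

Let lt1 x : (x.+1 == x) = false. Proof. by rewrite gtn_eqF. Qed.
Let lt2 x : (x.+2 == x) = false. Proof. by rewrite gtn_eqF // leqW. Qed.
Let gt1 x : (x == x.+1) = false. Proof. by rewrite ltn_eqF. Qed.
Let gt2 x : (x == x.+2) = false. Proof. by rewrite ltn_eqF // leqW. Qed.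

Lemma swaps_braid x y : swap_nat x.+1 (swap_nat x.+2 (swap_nat x.+1 y)) =
  swap_nat x.+2 (swap_nat x.+1 (swap_nat x.+2 y)).
Proof.
have [->|h1] := eqVneq y x.
  by rewrite (swap_far (y := x) (x := x.+1)) ?gt1 ?gt2 // !swapl swap_far ?lt1 ?lt2.
have [->|h2] := eqVneq y x.+1.
  by rewrite swapr (swap_far (y := x) (x := x.+1)) ?gt1 ?gt2 // !swapl (swap_far (y := x.+2)) ?lt1 ?lt2 // swapr.
have [->|h3] := eqVneq y x.+2.
  by rewrite (swap_far (y := x.+2)) ?lt1 ?lt2 // !swapr swap_far ?gt1 ?gt2.
by rewrite ?(swap_far h1 h2, swap_far h2 h3).
Qed.

Lemma swaps_twice x y : swap_nat x.+1 (swap_nat x.+1 y) = y.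
Proof.
have [->|h1] := eqVneq y x; first by rewrite swapl swapr.
have [->|h2] := eqVneq y x.+1; first by rewrite swapr swapl.
by rewrite !swap_far.
Qed.

Lemma swap_nat_inj x : injective (swap_nat x.+1).
Proof. exact: (can_inj (swaps_twice x)). Qed.

Lemma swaps_rule w w' y : vm_rule w w' -> (0 < (lt w 0).1)%N -> swaps w y = swaps w' y.
Proof.
by case=> -[|x] //= _; rewrite /swaps /= ?swaps_twice ?swaps_braid.
Qed.

Lemma regular_inside_virtual b V K w T s0 : reads b V K w ->
  (forall r, (r < size w)%N -> (lt w r).2 = Virtual) ->
  regular_inside V K b T (fun _ _ => False) s0.
Proof.
move=> [u [su ss hl]] virt i j t v iK jK ht_; split=> [[d va]|[]//].
have [r rN [tE _ _]] := (descends_letter su ss hl iK jK ht_).1 d.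
by move: va; rewrite (descends_value su ss hl iK jK rN tE d) virt.
Qed.

Lemma regular_inside_letter b V K w r0 (s0 : sign) : reads b V K w -> (r0 < size w)%N ->
  (lt w r0).2 = Regular s0 ->
  (forall r, (r < size w)%N -> r != r0 -> (lt w r).2 = Virtual) ->
  exists2 T, left_time V < T < right_time V & regular_inside V K b T (fun i j =>
    swaps (take r0 w) (rank b K (left_time V) i) = (lt w r0).1 /\
    swaps (take r0 w) (rank b K (left_time V) j) = (lt w r0).1.-1) s0.
Proof.
move=> [u [su ss hl]] r0N reg virt; exists (nth 0 u r0); first exact: letter_time su ss r0 r0N.
move=> i j t v iK jK ht_; split=> [[d va]|[[qi qj] tE ->]].
  have [r rN [tE ei ej]] := (descends_letter su ss hl iK jK ht_).1 d.
  have vE := descends_value su ss hl iK jK rN tE d.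
  have [rr|/(virt r rN) h] := eqVneq r r0; last by move: va; rewrite vE h.
  by subst r; split=> //; move: va; rewrite vE reg => -[].
have d : descends b i j t by apply/(descends_letter su ss hl iK jK ht_); exists r0.
by split=> //; rewrite (descends_value su ss hl iK jK r0N tE d).
Qed.

(** Both sides of a rule permute the ranks in the same way, which fixes the permutation. A virtual
    move has no regular letter, a mixed move one on each side, and tracing the ranks back to the
    left side of the disc shows that it is crossed by the same strands in the same roles. *)
Lemma vm_move_gauss b b' : vm_move b b' -> gauss_equiv (gauss b) (gauss b').
Proof.
move=> [w [w' [V [K [rule [run run'] rw rw' ag]]]]].
have w0 : (0 < size w)%N by case: rule.
have pos : (0 < (lt w 0).1)%N.
  by case: rw => u [su ss hl]; exact: letter_pos su ss hl 0%N w0.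
have rk k : k \in K -> rank b K (right_time V) k = rank b' K (right_time V) k.
  case: rw rw' => u [su ss hl] [u' [su' ss' hl']] kK.
  rewrite (rank_right su ss hl kK) (rank_right su' ss' hl' kK).
  by rewrite (agree_rank_left run ag) (swaps_rule _ rule pos).
have ep := agree_perm run run' ag rk.
pose T := (left_time V + right_time V) / 2.
have Tin : left_time V < T < right_time V by have := left_lt_right V; rewrite /T => h; lra.
have virtual : (forall r, (r < size w)%N -> (lt w r).2 = Virtual) ->
    (forall r, (r < size w')%N -> (lt w' r).2 = Virtual) ->
    gauss_equiv (gauss b) (gauss b').
  (* With no regular crossing inside, the predicate is false, and the time [T] and the sign are
     arbitrary. *)
  move=> vw vw'; apply: (regular_inside_gauss run run' ag ep Tin Tin).
    exact: (regular_inside_virtual _ Plus rw vw).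
  exact: (regular_inside_virtual _ Plus rw' vw').
have mixed s i : w = [:: sigma s i; tau i.+1; tau i] ->
    w' = [:: tau i.+1; tau i; sigma s i.+1] -> gauss_equiv (gauss b) (gauss b').
  move=> wE w'E; subst w w'.
  have [|//|[|[|[|r]]] //|T1 T1in ins] := @regular_inside_letter _ _ _ _ 0%N s rw; first by [].
  have [|//|[|[|[|r]]] //|T2 T2in ins'] := @regular_inside_letter _ _ _ _ 2%N s rw'; first by [].
  apply: (regular_inside_gauss run run' ag ep T1in T2in ins).
  move=> k l t v kK lK ht_; rewrite (ins' k l t v kK lK ht_) /= /swaps /=.
  rewrite !(agree_rank_left run ag).
  have [x ix] : exists x, i = x.+1 by exists i.-1; rewrite prednK.
  subst i.
  (* The two virtual letters raise the ranks [x] and [x.+1] by one, to those at which the letter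
     [i.+1] acts. *)
  have e1 : x.+2 = swap_nat x.+1 (swap_nat x.+2 x.+1).
    by rewrite swapl swap_far ?lt1 ?lt2.
  have e2 : x.+1 = swap_nat x.+1 (swap_nat x.+2 x).
    by rewrite (swap_far (y := x)) ?gt1 ?gt2 // swapl.
  split=> -[[h1 h2] h3 h4]; split=> //; split.
  - by move: h1; rewrite [in RHS]e1 => /swap_nat_inj/swap_nat_inj.
  - by move: h2; rewrite /= [in RHS]e2 => /swap_nat_inj/swap_nat_inj.
  - by rewrite h1 -e1.
  - by rewrite h2 /= -e2.
case: rule virtual mixed {w0 pos rw rw'} => i virtual mixed.
- by apply: virtual => -[|[|r]].
- by apply: virtual => -[|[|[|r]]].
- exact: mixed.
- exact: mixed.
Qed.

Lemma virtually_equivalent_gauss b b' : virtually_equivalent b b' ->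
  gauss_equiv (gauss b) (gauss b').
Proof.
elim=> [c c' [/isotopic_gauss|/vm_move_gauss]|c|c c' _|c c1 c2 _ h1 _ h2] //.
- exact: gauss_equiv_refl.
- exact: gauss_equiv_sym.
- exact: gauss_equiv_trans h1 h2.
Qed.

Lemma gauss_virtually_equivalent b b' : gauss_equiv (gauss b) (gauss b') ->
  virtually_equivalent b b'.
Proof.
move=> e; have [w [c [vw rc bc]]] := exists_word b; have [w' [c' [vw' rc' bc']]] := exists_word b'.
have ec : gauss_equiv (gauss c) (gauss c').
  apply: gauss_equiv_trans (gauss_equiv_sym (virtually_equivalent_gauss bc)) _.
  exact: gauss_equiv_trans e (virtually_equivalent_gauss bc').
apply: (rst_trans _ _ _ c) => //; apply: (rst_trans _ _ _ c'); last exact: rst_sym.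
exact: weq_virtually_equivalent (gauss_equiv_weq vw vw' rc rc' ec) _ _ rc rc'.
Qed.

End VirtualMoves.

Theorem theorem2p10 (R : realType) (n : nat) :
  (forall g : gauss_diagram R n, braid_gauss_diagram g ->
     exists b : vbd R n, gauss_equiv (gauss b) g) /\
  (forall b1 b2 : vbd R n,
     gauss_equiv (gauss b1) (gauss b2) <-> virtually_equivalent b1 b2).
Proof.
split=> [g|b1 b2]; first exact: braid_gauss_realization.
by split; [exact: gauss_virtually_equivalent|exact: virtually_equivalent_gauss].
Qed.
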